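(* Let $u_0\ge 0$ be a $1$-periodic function such that $u_0^3\in H^2_{\mathrm{per}}([0,1])$ and $\int_0^1 \frac{1}{u_0}\,\mathrm{d}h=m_0<+\infty$. Let $u$ be a global non-negative weak solution to the PDE $u_t=-u^2(u^3)_{hhhh}$ with initial data $u_0$ as obtained in the paper's existence theorem (that is, for every $T>0$, $u$ is a weak solution on $[0,T]$ in the sense of the definition given in the context, and $u>0$ a.e. in $[0,T]\times[0,1]$). Then there exists a constant $u^\star$ such that, as $t\to+\infty$, $$\|u(t,\cdot)^3-(u^\star)^3\|_{H^1([0,1])}\to 0\qquad\text{and}\qquad \|u(t,\cdot)-u^\star\|_{L^\infty([0,1])}\to 0.$$
   Context: All functions of $h$ are $1$-periodic in $h$. $H^m_{\mathrm{per}}([0,1])$ denotes the space of functions $u\in H^m_{\mathrm{loc}}(\mathbb{R})$ with $u(h+1)=u(h)$ for a.e. $h\in\mathbb{R}$, with the norm of $H^m([0,1])$; $L^2_{\mathrm{per}}([0,1])$ is the case $m=0$. Existence theorem referred to: for every $u_0$ satisfying the stated hypotheses there exists a global non-negative weak solution with initial data $u_0$ which is positive a.e. Energies: $F(u):=\frac12\int_0^1u^2\,\mathrm{d}h$ and $E(u):=\int_0^1\frac16[(u^3)_{hh}]^2\,\mathrm{d}h$. For a function $u$ on $[0,T]\times[0,1]$ set $P_T:=(0,T)\times(0,1)\setminus\{(t,h):u(t,h)=0\}$. For $u$ with $u^3$ continuous this is an open set, and $(u^3)_{hhhh}$ is understood as a distribution on $P_T$. Definition (weak solution). For any $T>0$,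 a non-negative function $u(t,h)$ with regularities $$u^3\in L^\infty([0,T];H^2_{\mathrm{per}}([0,1])),\quad u^2(u^3)_{hhhh}\in L^2(P_T),\quad u_t\in L^2([0,T];L^2_{\mathrm{per}}([0,1])),\quad u^3\in C([0,T];H^1_{\mathrm{per}}([0,1]))$$ is called a weak solution to $u_t=-u^2(u^3)_{hhhh}$ with initial data $u_0$ (i.e. $u(0,\cdot)=u_0$) if (i) for any $\phi\in C^\infty([0,T]\times\mathbb{R})$ that is $1$-periodic in $h$, $$\int_0^T\int_0^1\phi u_t\,\mathrm{d}h\,\mathrm{d}t+\iint_{P_T}\phi u^2(u^3)_{hhhh}\,\mathrm{d}h\,\mathrm{d}t=0;$$ (ii) $E(u(T,\cdot))+\iint_{P_T}(u^2(u^3)_{hhhh})^2\,\mathrm{d}h\,\mathrm{d}t\le E(u(0,\cdot))$; (iii) $F(u(T,\cdot))+6\int_0^TE(u(t,\cdot))\,\mathrm{d}t\le F(u(0,\cdot))$.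
   Formalization: The distribution (u³)_hhhh is taken on the circle, i.e. on (0,T)×(R/Z) minus {u=0}, rather than on P_T with 0<h<1: otherwise jumps of (u³)_hh and (u³)_hhh at h=0 would be allowed, and solutions with such jumps can oscillate forever without converging. *)

(* Defs.v *)
From HB Require Import structures.
From mathcomp Require Import all_boot all_order all_algebra.
From mathcomp Require Import all_classical all_reals all_analysis.

Set Implicit Arguments.
Unset Strict Implicit.
Unset Printing Implicit Defensive.

Import Order.TTheory GRing.Theory Num.Theory.
Import numFieldNormedType.Exports.

Local Open Scope classical_set_scope.
Local Open Scope ring_scope.

(** ** Smooth functions and test functions *)

(* On a finite-dimensional [V] this is C^oo: all iterated directional
   derivatives exist and are continuous. *)
Definition smooth (R : realType) (V : normedModType R) (f : V -> R) : Prop :=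
  forall s : seq V, let g := foldr (fun v f => 'D_v f) f s in
    continuous g /\ forall x v, derivable g x v.

Definition test_function (R : realType) (V : normedModType R) (U : set V)
    (phi : V -> R) : Prop :=
  [/\ smooth phi, compact (closure [set x | phi x != 0])
    & closure [set x | phi x != 0] `<=` U].

(** ** Sobolev spaces of periodic functions of one variable *)

Section Sobolev.
Variable R : realType.
Local Notation mu := (@lebesgue_measure R).
Implicit Types (f g v : R -> R) (k m : nat).

Definition L2loc f : Prop :=
  measurable_fun setT f /\ locally_integrable setT (fun x => f x ^+ 2).

Definition is_wderiv k f g : Prop :=
  forall phi : R -> R, test_function setT phi ->
    \int[mu]_x (f x * derive1n k phi x) = (-1) ^+ k * \int[mu]_x (g x * phi x).

Definition Hloc m f : Prop :=
  L2loc f /\ forall k, (k <= m)%N -> exists2 g, L2loc g & is_wderiv k f g.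

Definition Hper m f : Prop :=
  Hloc m f /\ {ae mu, forall h, f (h + 1) = f h}.

(* A representative of the k-th weak derivative, which is unique up to a.e.
   equality; junk (the zero function) when there is none in L2loc, so it is only
   used below under a membership test. *)
Definition wderiv k f : R -> R :=
  xget (cst 0) [set g | L2loc g /\ is_wderiv k f g].

(* The norm of H^m([0,1]), with value +oo outside of Hper m, so that a finite
   bound on it (or a convergence to 0) includes membership in the space. *)
Definition Hnorm m f : \bar R :=
  if `[< Hper m f >] then
    (Num.sqrt (\sum_(k < m.+1) \int[mu]_(h in `[0, 1]) (wderiv k f h ^+ 2)))%:E
  else +oo%E.

Definition cube f : R -> R := fun h => f h ^+ 3.

Definition energyF v : \bar R :=
  ((2^-1)%:E * \int[mu]_(h in `[0%R, 1%R]) (v h ^+ 2)%:E)%E.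

(* As usual for a quadratic energy, E = +oo when v^3 is not in H^2. *)
Definition energyE v : \bar R :=
  if `[< Hper 2 (cube v) >] then
    (\int[mu]_(h in `[0%R, 1%R]) (6^-1 * wderiv 2 (cube v) h ^+ 2)%:E)%E
  else +oo%E.

End Sobolev.

(** ** Functions of (t, h) *)

Section SpaceTime.
Variable R : realType.
Local Notation mu := (@lebesgue_measure R).
Local Notation mu2 := (mu \x mu)%E.
Implicit Types (u ut w f g phi : R * R -> R) (T t : R) (U : set (R * R)).

Definition slice u t : R -> R := fun h => u (t, h).

Definition L1loc2 U f : Prop :=
  measurable_fun U f /\
  forall K : set (R * R), compact K -> K `<=` U ->
    (\int[mu2]_(p in K) `|f p|%:E < +oo)%E.

Definition is_wderiv2 U (d : R * R) k f g : Prop :=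
  forall phi, test_function U phi ->
    \int[mu2]_(p in U) (f p * iter k (fun f => 'D_d f) phi p) =
    (-1) ^+ k * \int[mu2]_(p in U) (g p * phi p).

Definition dir_t : R * R := (1, 0).
Definition dir_h : R * R := (0, 1).

Definition closed_strip T : set (R * R) := `[0, T] `*` setT.
Definition open_strip T : set (R * R) := `]0, T[ `*` setT.

Definition PT T u : set (R * R) :=
  (`]0, T[ `*` `]0, 1[) `\` [set p | u p = 0].

(* The set P_T seen in (0,T) x (R/Z), unrolled to a subset of R * R: since all
   functions are 1-periodic in h, the fourth derivative of u^3 is a distribution
   on the circle, and the point h = 0 (identified with h = 1) is not a boundary
   point.  Test functions supported in (0,1) only would leave u^3 free to have
   jumps of its second and third derivatives at h = 0. *)
Definition PTper T u : set (R * R) :=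
  open_strip T `\` [set p | u p = 0].

Definition L2L2per T f : Prop :=
  [/\ measurable_fun (closed_strip T) f,
      {ae mu2, forall p, closed_strip T p -> f (p.1, p.2 + 1) = f p}
    & (\int[mu2]_(p in `[0%R, T] `*` `[0%R, 1%R]) (f p ^+ 2)%:E < +oo)%E].

(* The pointwise function u is the one for which u^3 is continuous.
   [ut] is the distributional derivative u_t, and [w] is (u^3)_{hhhh}.
   The latter is asked to be a function: since u^2 is continuous and positive on
   P_T, the requirement u^2 (u^3)_{hhhh} \in L^2(P_T) makes the distribution
   (u^3)_{hhhh} a locally (square-)integrable function there.
   A smooth function on [0,T] x R is the restriction of one on R x R. *)
Record weak_solution_with T (u0 : R -> R) u ut w : Prop := {
  ws_ge0 : forall t h, 0 <= t <= T -> 0 <= u (t, h) ;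
  ws_periodic : forall t h, 0 <= t <= T -> u (t, h + 1) = u (t, h) ;
  ws_continuous : {within closed_strip T, continuous (fun p => u p ^+ 3)} ;
  ws_Linfty_H2 : exists M : R,
    {ae mu, forall t, 0 <= t <= T -> (Hnorm 2 (cube (slice u t)) <= M%:E)%E} ;
  ws_C_H1 : forall s, 0 <= s <= T ->
    Hper 1 (cube (slice u s)) /\
    Hnorm 1 (cube (slice u t) \- cube (slice u s)) @[t --> within `[0, T] (nbhs s)]
      --> 0%E ;
  ws_ut : is_wderiv2 (open_strip T) dir_t 1 u ut ;
  ws_ut_L2 : L2L2per T ut ;
  ws_w_loc : L1loc2 (PTper T u) w ;
  ws_w : is_wderiv2 (PTper T u) dir_h 4 (fun p => u p ^+ 3) w ;
  ws_flux_meas : measurable_fun (PT T u) (fun p => u p ^+ 2 * w p) ;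
  ws_flux_L2 : (\int[mu2]_(p in PT T u) ((u p ^+ 2 * w p) ^+ 2)%:E < +oo)%E ;
  ws_init : {ae mu, forall h, u (0, h) = u0 h} ;
  ws_weak : forall phi, smooth phi ->
    (forall t h, 0 <= t <= T -> phi (t, h + 1) = phi (t, h)) ->
    \int[mu]_(t in `[0, T]) (\int[mu]_(h in `[0, 1]) (phi (t, h) * ut (t, h)))
    + \int[mu2]_(p in PT T u) (phi p * (u p ^+ 2 * w p)) = 0 ;
  ws_energyE : (energyE (slice u T)
    + \int[mu2]_(p in PT T u) ((u p ^+ 2 * w p) ^+ 2)%:E
    <= energyE (slice u 0))%E ;
  ws_energyF : (energyF (slice u T)
    + 6%:E * \int[mu]_(t in `[0%R, T]) energyE (slice u t)
    <= energyF (slice u 0))%E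
}.

Definition weak_solution T (u0 : R -> R) u : Prop :=
  exists ut w, weak_solution_with T u0 u ut w.

End SpaceTime.

(* Main.v *)
Require Import Defs.
From HB Require Import structures.
From mathcomp Require Import all_boot all_order all_algebra.
From mathcomp Require Import all_classical all_reals all_analysis.
From mathcomp Require Import measurable_realfun ess_sup_inf.
From mathcomp Require Import ring lra.

Set Implicit Arguments.
Unset Strict Implicit.
Unset Printing Implicit Defensive.

Import Order.TTheory GRing.Theory Num.Theory.
Import numFieldNormedType.Exports.

Local Open Scope classical_set_scope.
Local Open Scope ring_scope.

(** Why the theorem is true. Along the flow the energy E stays below its initial
    value, F decreases at the rate 6 E at least, and the inverse mass, the
    integral of 1/u over a period, is constant as long as u stays positive,
    because (1/u)_t = (u^3)_hhhh has mean zero on the circle. The first two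
    facts make u flat, the third one selects the constant.

    Flattening. The bound E(u(t)) <= E(u(0)) makes u^3 uniformly Lipschitz in h,
    hence u uniformly Hoelder continuous in h. Since the integral of E over all
    times is finite, times s with E(u(s)) as small as desired recur in every
    late time window of a given length (recurrent_smallness), and at such a time
    u(s, .) is almost constant. Between t and s the function moves little: u_t
    is square integrable in space and time, which controls the means of u over
    short intervals in h, and the Hoelder bound passes from these means to point
    values (sol_time_modulus). So the oscillation of u(t, .) tends to 0
    (sol_flattens).

    The limit. Suppose that at some late time t0 the value u(t0, 0) is at least
    5 e, when the oscillation has become at most e. While u >= e, the inverse
    mass is frozen, which gives u(t, 0) >= 3 e; by continuity in time u can then
    never come down to e (barrier, sol_stays_positive). The inverse mass J is
    thus constant after t0, and flatness forces u to converge uniformly to 1/J.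
    If no such t0 exists for any e, then u converges uniformly to 0
    (sol_uniform_limit).

    Norms. Uniform convergence is the L^oo statement. It also makes u^3 - c^3
    uniformly small, and as the second derivative of u^3 is bounded in L^2,
    interpolation makes the first derivative small too (wderiv2_short_slope,
    energyE_Hnorm1).

    Weak formulation. Differentiating 1/u would require testing the equation
    with 1/u^2, which is not smooth. Instead, 1/u(x) - 1/u(y) = (u(y) - u(x)) /
    (u(x) u(y)) and u(y) - u(x) is minus the time integral of the flux u^2 w,
    where w = (u^3)_hhhh. On a time interval short enough for u^2 / (u(x) u(y))
    to be within e of 1, the increment of the inverse mass is the integral of w,
    which is 0 (w_rect), up to e times the integral of |w| over that interval
    (inv_mass_local). These errors add up along a subdivision to at most e times
    the integral of |w|, and e is arbitrary (inv_mass_conserved). The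
    distributional identities are turned into identities on rectangles by
    testing with smooth approximations of indicators. *)

(** * Smooth functions of one variable, steps and ramps *)

Section smooth_line.
Variable R : realType.
Implicit Types f g : R -> R.

(** The derivative is provided as a witness, so that closure under products and
    composition is a plain induction on n, without computing derivatives of
    arbitrary order. *)
Fixpoint Ck n f : Prop :=
  if n is m.+1 then exists2 f', (forall x : R, is_derive x 1 f (f' x)) & Ck m f'
  else True.

Definition Cinf f := forall n, Ck n f.

Lemma CkS n f : Ck n.+1 f -> Ck n f.
Proof.
elim: n f => [//|n IH] f [f' df hf].
by exists f' => //; exact: IH.
Qed.

Lemma derive1_eq f f' : (forall x : R, is_derive x 1 f (f' x)) -> (derive1 f) = f'.
Proof. by move=> df; apply/funext => x; rewrite derive1E derive_val. Qed.

Lemma Cinf_derive f : Cinf f -> forall x : R, is_derive x 1 f ((derive1 f) x).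
Proof.
move=> /(_ 1%N) [f' df _] x; rewrite (derive1_eq df); exact: df.
Qed.

Lemma Cinf_derive1 f : Cinf f -> Cinf (derive1 f).
Proof. by move=> cf n; have [f' df hf] := cf n.+1; rewrite (derive1_eq df). Qed.

Lemma Cinf_intro f f' : (forall x : R, is_derive x 1 f (f' x)) -> Cinf f' -> Cinf f.
Proof. by move=> df cf [//|n]; exists f'. Qed.

Lemma Cinf_cont f : Cinf f -> continuous f.
Proof.
move=> cf x; apply: differentiable_continuous; apply/derivable1_diffP.
by have [] := Cinf_derive cf x.
Qed.

Lemma Ck_cst n (c : R) : Ck n (cst c).
Proof. by elim: n c => [//|n IH] c; exists (cst 0) => // x; exact: is_derive_cst. Qed.

Lemma Ck_id n : Ck n (@id R).
Proof. by case: n => [//|n]; exists (cst 1) => [x|]; [exact: is_derive_id|exact: Ck_cst]. Qed.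

Lemma CkD n f g : Ck n f -> Ck n g -> Ck n (fun x => f x + g x).
Proof.
elim: n f g => [//|n IH] f g [f' df hf] [g' dg hg].
by exists (fun x => f' x + g' x); [move=> x; exact: is_deriveD|exact: IH].
Qed.

Lemma CkM n f g : Ck n f -> Ck n g -> Ck n (fun x => f x * g x).
Proof.
elim: n f g => [//|n IH] f g cf cg.
have [f' df hf] := cf; have [g' dg hg] := cg.
exists (fun x => f x * g' x + g x * f' x).
  by move=> x; exact: is_deriveM.
by apply: CkD; apply: IH => //; exact: CkS.
Qed.

Lemma CkN n f : Ck n f -> Ck n (fun x => - f x).
Proof.
move=> cf; have := CkM (@Ck_cst n (-1)) cf.
by congr Ck; apply/funext => x; rewrite mulN1r.
Qed.

Lemma Ck_comp n f g : Ck n f -> Ck n g -> Ck n (fun x => f (g x)).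
Proof.
elim: n f g => [//|n IH] f g cf cg.
have [f' df hf] := cf; have [g' dg hg] := cg.
exists (fun x => f' (g x) * g' x).
  by move=> x; exact: is_derive1_comp.
by apply: CkM => //; apply: IH => //; exact: CkS.
Qed.

Lemma Cinf_cst c : Cinf (cst c). Proof. by move=> n; exact: Ck_cst. Qed.
Lemma Cinf_id : Cinf id. Proof. by move=> n; exact: Ck_id. Qed.
Lemma CinfD f g : Cinf f -> Cinf g -> Cinf (fun x => f x + g x).
Proof. by move=> cf cg n; exact: CkD. Qed.
Lemma CinfM f g : Cinf f -> Cinf g -> Cinf (fun x => f x * g x).
Proof. by move=> cf cg n; exact: CkM. Qed.
Lemma CinfB f g : Cinf f -> Cinf g -> Cinf (fun x => f x - g x).
Proof. by move=> cf cg n; apply: CkD => //; exact: CkN. Qed.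
Lemma Cinf_comp f g : Cinf f -> Cinf g -> Cinf (fun x => f (g x)).
Proof. by move=> cf cg n; exact: Ck_comp. Qed.

Lemma Cinf_derive1n f k : Cinf f -> Cinf (derive1n k f).
Proof. by move=> cf; elim: k => [//|k IH]; exact: Cinf_derive1. Qed.

Lemma Cinf_cos : Cinf cos.
Proof.
move=> n; have [] : Ck n (@cos R) /\ Ck n (@sin R); last by [].
elim: n => [//|n [cc cs]]; split.
  by exists (fun x => - sin x) => [x|]; [exact: is_derive_cos|exact: CkN].
by exists (@cos R) => // x; exact: is_derive_sin.
Qed.

(** The functions x^-k exp(-1/x), extended by 0. The family is closed under
    derivation up to linear combinations, which is why all k are considered at
    once. *)
Definition flat (k : nat) (x : R) : R :=
  if 0 < x then x^-1 ^+ k * expR (- x^-1) else 0.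

Lemma flat_ge0 k x : 0 <= flat k x.
Proof.
rewrite /flat; case: ifP => // x0.
by rewrite mulr_ge0 ?expR_ge0// exprn_ge0// invr_ge0 ltW.
Qed.

Lemma flat_le0 k x : x <= 0 -> flat k x = 0.
Proof. by move=> x0; rewrite /flat ltNge x0. Qed.

(** The exponential series at 1/x dominates its term of order k + 1. *)
Lemma flat_le k (x : R) : flat k x <= k.+1`!%:R * `|x|.
Proof.
rewrite /flat; case: ifPn => x0; last by rewrite mulr_ge0.
have y0 : 0 < x^-1 by rewrite invr_gt0.
have h : x^-1 ^+ k.+1 / k.+1`!%:R <= expR (x^-1).
  by apply: le_trans (expR_ge1Dxn k (ltW y0)); rewrite lerDr.
have f0 : 0 < k.+1`!%:R :> R by rewrite ltr0n fact_gt0.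
rewrite expRN gtr0_norm//.
move: h; rewrite ler_pdivrMr// => h.
have -> : x^-1 ^+ k = x^-1 ^+ k.+1 * x.
  by rewrite exprS mulrAC mulVf ?mul1r// gt_eqF.
rewrite ler_pdivrMr ?expR_gt0// mulrAC [_ * expR _]mulrC.
exact: ler_wpM2r (ltW x0) _ _ h.
Qed.

(** At 0 the difference quotient of flat k is flat k.+1, which tends to 0 by
    flat_le. *)
Lemma flat_derive k (x : R) :
  is_derive x 1 (flat k) (flat k.+2 x - k%:R * flat k.+1 x).
Proof.
have [x0|x0|->] := ltgtP x 0.
- have -> : flat k.+2 x - k%:R * flat k.+1 x = 0.
    by rewrite /flat ltNge (ltW x0)/= mulr0 subr0.
  have nf : \near x, cst 0 x = flat k x.
    near=> y; rewrite /flat ifF//; apply/negbTE; rewrite -leNgt ltW//.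
    by near: y; exact: lt_nbhsl.
  apply: near_eq_is_derive nf _; exact: is_derive_cst.
- have nf : \near x, (fun y => y^-1 ^+ k * expR (- y^-1)) x = flat k x.
    near=> y; rewrite /flat ifT//.
    by near: y; exact: lt_nbhsr.
  apply: near_eq_is_derive nf _.
  have xn0 : x != 0 by rewrite gt_eqF.
  rewrite /flat x0.
  have d1 : is_derive x 1 (fun y : R => y^-1) (- x ^- 2).
    have := is_deriveV xn0 (is_derive_id x 1).
    by move/is_derive_eq; apply; rewrite /GRing.scale/= mulr1.
  have d2 := is_deriveX k d1.
  have d3 : is_derive x 1 (fun y : R => expR (- y^-1)) (expR (- x^-1) * (x ^- 2)).
    apply: is_derive1_comp.
    by have := is_deriveN d1; move/is_derive_eq; apply; rewrite opprK.
  have := is_deriveM d2 d3.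
  have <- : (fun y : R => y^-1) ^+ k * (fun y : R => expR (- y^-1)) =
            (fun y : R => y^-1 ^+ k * expR (- y^-1)).
    by apply/funext => y; rewrite /GRing.mul/= exprfctE.
  move=> /(@is_derive_eq _ _ _ _ _ _ _) h; apply: h; rewrite /GRing.scale/=.
  clear d2; case: k => [|k]; rewrite ?exprfctE; first by rewrite -?exprVn; ring.
  by rewrite -?exprVn !exprS/=; ring.
- have E : flat k.+2 0 - k%:R * flat k.+1 0 = 0 by rewrite /flat ltxx mulr0 subr0.
  rewrite E.
  have H : h^-1 *: ((flat k \o shift 0) (h *: 1) - flat k 0) @[h --> 0^'] --> (0:R).
    apply/cvgr0Pnorm_le => e e0; near=> h.
    rewrite /= addr0 /GRing.scale/= mulr1 {2}/flat ltxx subr0.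
    have -> : h^-1 * flat k h = flat k.+1 h.
      by rewrite /flat; case: ifP; rewrite ?mulr0// exprS mulrA.
    rewrite ger0_norm ?flat_ge0//; apply: (le_trans (flat_le _ _)).
    rewrite -ler_pdivlMl ?ltr0n ?fact_gt0//.
    near: h; apply: dnbhs0_le; rewrite mulr_gt0// invr_gt0 ltr0n fact_gt0//.
  apply: DeriveDef; last exact: cvg_lim.
  by apply/cvg_ex; exists 0.
Unshelve. all: by end_near. Qed.

Lemma Ck_flat n k : Ck n (flat k).
Proof.
elim: n k => [//|n IH] k.
exists (fun x => flat k.+2 x - k%:R * flat k.+1 x); first exact: flat_derive.
by apply: CkD => //; apply: CkN; apply: CkM => //; exact: Ck_cst.
Qed.

Lemma is_derive_continuous f f' :
  (forall x : R, is_derive x 1 f (f' x)) -> continuous f.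
Proof.
move=> df x; apply: differentiable_continuous; apply/derivable1_diffP.
by have [] := df x.
Qed.

Lemma MVT_all f f' (a b : R) : (forall x : R, is_derive x 1 f (f' x)) -> a < b ->
  exists2 c, a < c < b & f b - f a = f' c * (b - a).
Proof.
move=> df ab; have cf := continuous_subspaceT (is_derive_continuous df).
have [c cab E] := MVT ab (fun x _ => df x) (cf _).
by exists c => //; rewrite in_itv/= in cab.
Qed.

Lemma antiderivative f : continuous f -> (forall x, x <= 0 -> f x = 0) ->
  exists2 F : R -> R, (forall x : R, is_derive x 1 F (f x)) & forall x, x <= 0 -> F x = 0.
Proof.
move=> cf f0.
pose F x := \int[@lebesgue_measure R]_(t in `[-1, x]) f t.
have F0 x : x <= 0 -> F x = 0.
  move=> x0; rewrite /F.
  rewrite (@eq_Rintegral _ _ _ _ _ (cst 0)) => [|t]; last first.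
    rewrite inE/= in_itv/= => /andP[_ tx]; apply: f0; exact: le_trans tx x0.
  by rewrite /Rintegral integral0.
exists F => // x; have [x1|x1] := ltP x 0.
  rewrite f0 ?ltW//.
  have nf : \near x, cst 0 x = F x.
    near=> y; rewrite F0//=; apply: ltW; near: y; exact: lt_nbhsl.
  apply: near_eq_is_derive nf _; exact: is_derive_cst.
have i : lebesgue_measure.-integrable `[-1, x + 1] (EFin \o f).
  apply: continuous_compact_integrable; first exact: segment_compact.
  exact: continuous_subspaceT.
have [|||d E] := @continuous_FTC1_closed R f (-1) x (x + 1) _ i.
- by rewrite ltrDl.
- by rewrite (lt_le_trans _ x1)// ltrN10.
- exact: cf.
- by apply: DeriveDef; [exact: d|rewrite -E derive1E].
Unshelve. all: by end_near. Qed.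

(** Normalised primitive of the product of exp(-1/x) and exp(-1/(1 - x)), which is
    supported in [0, 1]. *)
Lemma smooth_step_ex : exists S : R -> R,
  [/\ Cinf S, forall x, x <= 0 -> S x = 0, forall x, 1 <= x -> S x = 1 &
    forall x, 0 <= (derive1 S) x].
Proof.
pose r x := flat 0 x * flat 0 (1 - x).
have cr : Cinf r.
  apply: CinfM; first by move=> n; exact: Ck_flat.
  apply: (@Cinf_comp (flat 0) (fun x => 1 - x)); first by move=> n; exact: Ck_flat.
  by apply: CinfB; [exact: Cinf_cst|exact: Cinf_id].
have r0 x : 0 <= r x by rewrite mulr_ge0 ?flat_ge0.
have [||F dF F0] := @antiderivative r.
- exact: Cinf_cont.
- by move=> x x0; rewrite /r flat_le0// mul0r.
have F1 : 0 < F 1.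
  have [c /andP[c0 c1]] := MVT_all dF ltr01.
  rewrite (F0 0)// !subr0 mulr1 => ->.
  by rewrite /r /flat c0 subr_gt0 c1 !mulr_gt0 ?expR_gt0.
have F2 x : 1 <= x -> F x = F 1.
  rewrite le_eqVlt => /predU1P[->//|x1].
  have [c /andP[c0 c1]] := MVT_all dF x1.
  have E : flat 0 (1 - c) = 0 by apply: flat_le0; rewrite subr_le0 ltW.
  have -> : r c = 0 by rewrite /r E mulr0.
  by rewrite mul0r => /eqP; rewrite subr_eq0 => /eqP.
have dS (x : R) : is_derive x 1 (fun x => (F 1)^-1 * F x) ((F 1)^-1 * r x).
  have := @is_deriveZ _ _ _ F (F 1)^-1 x 1 (r x) (dF x); exact.
exists (fun x => (F 1)^-1 * F x); split.
- apply: (Cinf_intro dS); apply: CinfM => //; exact: Cinf_cst.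
- by move=> x x0; rewrite (F0 x)// mulr0.
- by move=> x x0; rewrite (F2 x)// mulVf// gt_eqF.
- by move=> x; rewrite (derive1_eq dS) mulr_ge0// invr_ge0 ltW.
Qed.

Definition step : R -> R := sval (cid smooth_step_ex).

Lemma step_Cinf : Cinf step. Proof. by rewrite /step; case: cid => S []. Qed.
Lemma step_le0 x : x <= 0 -> step x = 0.
Proof. by move: x; rewrite /step; case: cid => S []. Qed.
Lemma step_ge1 x : 1 <= x -> step x = 1.
Proof. by move: x; rewrite /step; case: cid => S []. Qed.
Lemma dstep_ge0 x : 0 <= (derive1 step) x.
Proof. by move: x; rewrite /step; case: cid => S []. Qed.

Lemma step_ge0 x : 0 <= step x.
Proof.
have [x0|x0] := leP x 0; first by rewrite step_le0.
have [c _] := MVT_all (Cinf_derive step_Cinf) x0.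
rewrite (step_le0 (lexx 0)) subr0 => ->.
by rewrite mulr_ge0 ?dstep_ge0 ?subr_ge0 ?ltW.
Qed.

Lemma step_le1 x : step x <= 1.
Proof.
have [x0|x0] := leP 1 x; first by rewrite step_ge1.
have [c _] := MVT_all (Cinf_derive step_Cinf) x0.
rewrite (step_ge1 (lexx 1)) => E.
by rewrite -subr_ge0 E mulr_ge0 ?dstep_ge0 ?subr_ge0 ?ltW.
Qed.

(** A primitive of the step: a smooth version of the positive part. *)
Lemma ramp_ex : exists P : R -> R,
  (forall x : R, is_derive x 1 P (step x)) /\ (forall x, x <= 0 -> P x = 0).
Proof.
have [||F dF F0] := @antiderivative step.
- exact: Cinf_cont step_Cinf.
- exact: step_le0.
- by exists F.
Qed.

Definition ramp : R -> R := sval (cid ramp_ex).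
Lemma ramp_derive (x : R) : is_derive x 1 ramp (step x).
Proof. by move: x; rewrite /ramp; case: cid => S []. Qed.
Lemma ramp_le0 x : x <= 0 -> ramp x = 0.
Proof. by move: x; rewrite /ramp; case: cid => S []. Qed.
Lemma ramp_Cinf : Cinf ramp.
Proof. exact: (Cinf_intro ramp_derive step_Cinf). Qed.
(** The slope is 1 beyond 1, so the ramp is the positive part up to a fixed shift 1
    - ramp 1, which disappears under rescaling. *)
Lemma ramp_ge1 x : 1 <= x -> ramp x = x - (1 - ramp 1).
Proof.
rewrite le_eqVlt => /predU1P[<-|x1]; first by rewrite subKr.
have [c /andP[c1 _]] := MVT_all ramp_derive x1.
by rewrite step_ge1 ?ltW// mul1r => E; rewrite opprB addrCA -E; ring.
Qed.
Lemma ramp_ge0 x : 0 <= x -> 0 <= ramp x <= x.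
Proof.
rewrite le_eqVlt => /predU1P[<-|x0]; first by rewrite ramp_le0 ?lexx.
have [c _] := MVT_all ramp_derive x0.
rewrite (ramp_le0 (lexx 0)) !subr0 => ->.
rewrite (mulr_ge0 (step_ge0 c) (ltW x0))/=.
apply: ler_piMl; [exact: ltW|exact: step_le1].
Qed.

(** Approximations, as k tends to infinity, of the indicator of ]a, +oo[, of the
    Dirac mass at a, and of the positive part of x - a; each is the derivative
    of the next one in the order pulse, step, ramp. They live on the right of a:
    the pulse is supported in [a, a + 1/k]. *)
Definition scaled_step (k a x : R) := step (k * (x - a)).
Definition pulse (k a x : R) := k * (derive1 step) (k * (x - a)).
Definition scaled_ramp (k a x : R) := ramp (k * (x - a)) / k.

Lemma is_derive_aff (k a x : R) : is_derive x 1 (fun x => k * (x - a)) k.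
Proof.
have h : is_derive x 1 (fun x : R => x - a) 1.
  by have := is_deriveB (is_derive_id x (1:R)) (is_derive_cst a x (1:R));
    move=> /(@is_derive_eq _ _ _ _ _ _ _) HH; apply: HH; rewrite subr0.
have := is_deriveZ k h => /(@is_derive_eq _ _ _ _ _ _ _) HH.
by apply: HH; rewrite /GRing.scale/= mulr1.
Qed.

Lemma Cinf_aff (k a : R) : Cinf (fun x => k * (x - a)).
Proof.
apply: CinfM; first exact: Cinf_cst.
by apply: CinfB; [exact: Cinf_id|exact: Cinf_cst].
Qed.

Lemma scaled_step_Cinf k a : Cinf (scaled_step k a).
Proof. exact: (Cinf_comp step_Cinf (Cinf_aff k a)). Qed.

Lemma scaled_ramp_Cinf k a : Cinf (scaled_ramp k a).
Proof.
by apply: CinfM; [exact: (Cinf_comp ramp_Cinf (Cinf_aff k a))|exact: Cinf_cst].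
Qed.

Lemma scaled_step_derive k a (x : R) : is_derive x 1 (scaled_step k a) (pulse k a x).
Proof.
have := @is_derive1_comp R step (fun x => k * (x - a)) x _ _
  (Cinf_derive step_Cinf (k * (x - a))) (is_derive_aff k a x).
by move=> /(@is_derive_eq _ _ _ _ _ _ _) HH; apply: HH; rewrite mulrC.
Qed.

Lemma scaled_ramp_derive k a (x : R) : k != 0 ->
  is_derive x 1 (scaled_ramp k a) (scaled_step k a x).
Proof.
move=> k0.
have h := @is_derive1_comp R ramp (fun x => k * (x - a)) x _ _
  (ramp_derive (k * (x - a))) (is_derive_aff k a x).
have := is_deriveZ (k^-1) h => /(@is_derive_eq _ _ _ _ _ _ _) {}h.
have -> : scaled_ramp k a = k^-1 \*: (ramp \o (fun x => k * (x - a))).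
  by apply/funext => y; rewrite /scaled_ramp /= mulrC.
by apply: h; rewrite /GRing.scale/= mulrCA mulVf// mulr1.
Qed.

Lemma scaled_step_ge0 k a x : 0 <= scaled_step k a x. Proof. exact: step_ge0. Qed.
Lemma scaled_step_le1 k a x : scaled_step k a x <= 1. Proof. exact: step_le1. Qed.
Lemma scaled_step_0 k a x : 0 < k -> x <= a -> scaled_step k a x = 0.
Proof. by move=> k0 xa; rewrite /scaled_step step_le0// pmulr_rle0// subr_le0. Qed.
Lemma scaled_step_1 k a x : 0 < k -> a + k^-1 <= x -> scaled_step k a x = 1.
Proof.
move=> k0 xa; rewrite /scaled_step step_ge1// -ler_pdivrMl// mulr1; lra.
Qed.
Lemma pulse_ge0 k a x : 0 < k -> 0 <= pulse k a x.
Proof. by move=> k0; rewrite mulr_ge0 ?dstep_ge0// ltW. Qed.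
Lemma pulse_Cinf k a : Cinf (pulse k a).
Proof.
by have := Cinf_derive1 (scaled_step_Cinf k a); rewrite (derive1_eq (scaled_step_derive k a)).
Qed.

End smooth_line.

(** * Products of functions of one variable as test functions *)

Section tensors.
Variable R : realType.
Implicit Types f g : R -> R.

(** A directional derivative on a normed module is an ordinary derivative at 0 along
    the line. *)
Lemma is_derive_line (V : normedModType R) (F : V -> R) (p v : V) (d : R) :
  is_derive (0:R) 1 (fun h : R => F (h *: v + p)) d -> is_derive p v F d.
Proof.
move=> [dF EF].
have E : (fun h : R => h^-1 *: ((F \o shift p) (h *: v) - F p)) =
   (fun h : R => h^-1 *: (((fun h : R => F (h *: v + p)) \o shift 0) (h *: 1) -
       F (0 *: v + p))).
  by apply/funext => h /=; rewrite addr0 scale0r add0r /GRing.scale/= mulr1.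
apply: DeriveDef.
  by rewrite /derivable E.
by rewrite -EF /derive E.
Qed.

Lemma is_derive_line1 g (g' b v : R) : is_derive b 1 g g' ->
  is_derive (0:R) 1 (fun h : R => g (h * v + b)) (v * g').
Proof.
move=> dg.
have h1 : is_derive (0:R) 1 (fun h : R => h * v + b) v.
  have := is_deriveD (is_deriveM (is_derive_id (0:R) 1) (is_derive_cst v (0:R) 1))
    (is_derive_cst b (0:R) 1).
  move=> /(@is_derive_eq _ _ _ _ _ _ _) HH; apply: HH.
  by rewrite /GRing.scale/= mulr0 add0r mulr1 addr0.
have dg' : is_derive ((fun h : R => h * v + b) 0) 1 g g' by rewrite mul0r add0r.
have := @is_derive1_comp R g (fun h => h * v + b) 0 _ _ dg' h1.
by move=> /(@is_derive_eq _ _ _ _ _ _ _) HH; apply: HH; rewrite mulrC.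
Qed.

Lemma Cinf_smooth f : Cinf f -> smooth f.
Proof.
move=> cf s.
have : exists2 g, Cinf g & foldr (fun v h => 'D_v h) f s = g.
  elim: s => [|v s [g cg /= ->]]; first by exists f.
  exists (fun x => v * derive1 g x).
    by apply: CinfM; [exact: Cinf_cst|exact: Cinf_derive1].
  apply/funext => x.
  by have [_ ->] := is_derive_line (is_derive_line1 v (Cinf_derive cg x)).
case=> g cg /= ->; split; first exact: Cinf_cont.
move=> x v; have := is_derive_line (is_derive_line1 v (Cinf_derive cg x)).
by case.
Qed.

Definition tens f g (p : R * R) : R := f p.1 * g p.2.

(** Partial derivatives of a product f(t) g(h) are again finite sums of such
    products, so this class is stable by derivation and consists of smooth
    functions. *)
Inductive tensor_sum : (R * R -> R) -> Prop :=
| TensorSum1 f g : Cinf f -> Cinf g -> tensor_sum (tens f g)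
| TensorSumD F G : tensor_sum F -> tensor_sum G -> tensor_sum (fun p => F p + G p).

Lemma tens_derive f g (p v : R * R) : Cinf f -> Cinf g ->
  is_derive p v (tens f g)
    (v.1 * derive1 f p.1 * g p.2 + f p.1 * (v.2 * derive1 g p.2)).
Proof.
move=> cf cg; apply: is_derive_line.
have := is_deriveM (is_derive_line1 v.1 (Cinf_derive cf p.1))
  (is_derive_line1 v.2 (Cinf_derive cg p.2)).
move=> /(@is_derive_eq _ _ _ _ _ _ _) HH; apply: HH.
by rewrite !mul0r !add0r /GRing.scale/= addrC [g _ * _]mulrC.
Qed.

Lemma tensor_sum_derive F v : tensor_sum F ->
  exists2 G, tensor_sum G & forall p : R * R, is_derive p v F (G p).
Proof.
elim=> [f g cf cg|{}F G _ [F' tF dF] _ [G' tG dG]].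
  exists (fun p => tens (fun x => v.1 * derive1 f x) g p +
     tens f (fun x => v.2 * derive1 g x) p).
    by apply: TensorSumD; apply: TensorSum1 => //; apply: CinfM;
      by [exact: Cinf_cst|exact: Cinf_derive1].
  by move=> p; exact: tens_derive.
exists (fun p => F' p + G' p); first exact: TensorSumD.
by move=> p; exact: is_deriveD.
Qed.

Lemma tensor_sum_continuous F : tensor_sum F -> continuous F.
Proof.
elim=> [f g cf cg|{}F G _ cF _ cG].
  move=> p; apply: cvgM.
    by apply: (@continuous_comp _ _ _ fst f); [exact: cvg_fst|exact: Cinf_cont].
  by apply: (@continuous_comp _ _ _ snd g); [exact: cvg_snd|exact: Cinf_cont].
by move=> p; apply: cvgD; [exact: cF|exact: cG].
Qed.

Lemma tensor_sum_smooth F : tensor_sum F -> smooth F.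
Proof.
move=> tF s /=.
have [g tg ->] : exists2 G, tensor_sum G & foldr (fun v h => 'D_v h) F s = G.
  elim: s => [|v s [g tg /= ->]]; first by exists F.
  have [G tG dG] := tensor_sum_derive v tg.
  by exists G => //; apply/funext => p; have [] := dG p.
split; first exact: tensor_sum_continuous.
by move=> x v; have [G tG dG] := tensor_sum_derive v tg; case: (dG x).
Qed.

Lemma test_function1 f a b : Cinf f -> (forall x, x <= a -> f x = 0) ->
  (forall x, b <= x -> f x = 0) -> test_function setT f.
Proof.
move=> cf fa fb.
have sub : closure [set x | f x != 0] `<=` `[a, b].
  rewrite closureE; apply: smallest_sub; first exact: interval_closed.
  move=> x /= fx; rewrite in_itv/=; apply/andP; split.
    by rewrite leNgt; apply: contra fx => /ltW/fa ->.
  by rewrite leNgt; apply: contra fx => /ltW/fb ->.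
split => //; first exact: Cinf_smooth.
apply: subclosed_compact sub; first exact: closed_closure.
exact: segment_compact.
Qed.

Lemma test_function2 f g a b c d (U : set (R * R)) : Cinf f -> Cinf g ->
  (forall x, x <= a -> f x = 0) -> (forall x, b <= x -> f x = 0) ->
  (forall x, x <= c -> g x = 0) -> (forall x, d <= x -> g x = 0) ->
  `[a, b] `*` `[c, d] `<=` U ->
  test_function U (tens f g).
Proof.
move=> cf cg fa fb gc gd sU.
have K : compact (`[a, b]%classic `*` `[c, d]%classic : set (R * R)).
  by apply: compact_setX; exact: segment_compact.
have sub : closure [set x | tens f g x != 0] `<=` `[a, b] `*` `[c, d].
  rewrite closureE; apply: smallest_sub.
    by apply: compact_closed => //; exact: norm_hausdorff.
  move=> [x y] /= fx; rewrite !in_itv/=; split; apply/andP; split;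
    rewrite leNgt; apply: contra fx => /ltW.
  - by rewrite /tens/= => /fa ->; rewrite mul0r.
  - by rewrite /tens/= => /fb ->; rewrite mul0r.
  - by rewrite /tens/= => /gc ->; rewrite mulr0.
  - by rewrite /tens/= => /gd ->; rewrite mulr0.
split; last exact: subset_trans sub sU.
- by apply: tensor_sum_smooth; exact: TensorSum1.
- by apply: subclosed_compact sub => //; exact: closed_closure.
Qed.

Lemma iter_dir_t f g : Cinf f -> Cinf g ->
  iter 1 (fun F => 'D_(dir_t R) F) (tens f g) = tens (derive1 f) g.
Proof.
move=> cf cg /=; apply/funext => p; have [_ ->] := tens_derive p (dir_t R) cf cg.
by rewrite /= mul1r mul0r mulr0 addr0.
Qed.

Lemma iter_dir_h k f g : Cinf f -> Cinf g ->
  iter k (fun F => 'D_(dir_h R) F) (tens f g) = tens f (derive1n k g).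
Proof.
move=> cf cg /=; elim: k => [//|k IH].
rewrite iterS IH; apply/funext => p.
have [_ ->] := tens_derive p (dir_h R) cf (Cinf_derive1n k cg).
by rewrite /= mul1r !mul0r add0r.
Qed.

End tensors.

(** * Real-valued integrals *)

Section integration.
Context d (T : measurableType d) (R : realType) (mu : {measure set T -> \bar R}).
Implicit Types (D : set T) (f g h : T -> R).

Lemma integrableZrR D f (c : R) : measurable D -> mu.-integrable D (EFin \o f) ->
  mu.-integrable D (EFin \o (fun x => f x * c)).
Proof. by move=> mD i; have := integrableZr mD c i; apply: eq_integrable. Qed.

Lemma integrableZlR D f (c : R) : measurable D -> mu.-integrable D (EFin \o f) ->
  mu.-integrable D (EFin \o (fun x => c * f x)).
Proof. by move=> mD i; have := integrableZl mD c i; apply: eq_integrable. Qed.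

Lemma integrableDR D f g : measurable D -> mu.-integrable D (EFin \o f) ->
  mu.-integrable D (EFin \o g) ->
  mu.-integrable D (EFin \o (fun x => f x + g x)).
Proof. by move=> mD i j; have := integrableD mD i j; apply: eq_integrable. Qed.

Lemma integrableBR D f g : measurable D -> mu.-integrable D (EFin \o f) ->
  mu.-integrable D (EFin \o g) ->
  mu.-integrable D (EFin \o (fun x => f x - g x)).
Proof. by move=> mD i j; have := integrableB mD i j; apply: eq_integrable. Qed.

(** Used throughout to multiply an integrable density by a cut-off. *)
Lemma integrable_mul_bounded D g h (C : R) : measurable D ->
  mu.-integrable D (EFin \o g) -> measurable_fun D h ->
  (forall x, D x -> `|h x| <= C) ->
  mu.-integrable D (EFin \o (fun x => g x * h x)).
Proof.
move=> mD ig mh hC.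
have mg : measurable_fun D g by apply/measurable_EFinP; exact: measurable_int ig.
apply: (@le_integrable _ _ _ _ _ mD _ (EFin \o (fun x => C * g x))).
- by apply/measurable_EFinP; exact: measurable_funM.
- move=> x Dx /=; rewrite lee_fin !normrM mulrC ler_wpM2r//.
  by rewrite (le_trans (hC x Dx))// ler_norm.
- have := integrableZl mD C ig.
  by apply: eq_integrable.
Qed.

Lemma Rintegral_dct D (f_ : nat -> T -> R) f g : measurable D ->
  (forall n, measurable_fun D (f_ n)) ->
  (forall x, D x -> f_ n x @[n --> \oo] --> f x) ->
  mu.-integrable D (EFin \o g) ->
  (forall n x, D x -> `|f_ n x| <= g x) ->
  \int[mu]_(x in D) f_ n x @[n --> \oo] --> \int[mu]_(x in D) f x.
Proof.
move=> mD mf cf ig fg.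
have mlim : measurable_fun D f by exact: (measurable_fun_cvg mf cf).
have [|||||i _ c] := @dominated_convergence _ _ _ mu D mD
  (fun n => EFin \o f_ n) (EFin \o f) (EFin \o g).
- by move=> n; apply/measurable_EFinP.
- exact/measurable_EFinP.
- by apply/aeW => x Dx; apply: cvg_EFin; [exact: nearW|exact: cf].
- exact: ig.
- by apply/aeW => x n Dx /=; rewrite lee_fin fg.
apply: fine_cvg.
by rewrite fineK//; exact: integrable_fin_num.
Qed.

Lemma Rintegral_dct_mul D (h_ : nat -> T -> R) h g (C : R) : measurable D ->
  mu.-integrable D (EFin \o g) ->
  (forall n, measurable_fun D (h_ n)) ->
  (forall x, D x -> h_ n x @[n --> \oo] --> h x) ->
  (forall n x, D x -> `|h_ n x| <= C) ->
  \int[mu]_(x in D) (g x * h_ n x) @[n --> \oo] --> \int[mu]_(x in D) (g x * h x).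
Proof.
move=> mD ig mh ch hC.
have mg : measurable_fun D g by apply/measurable_EFinP; exact: measurable_int ig.
apply: (@Rintegral_dct _ _ _ (fun x => C * `|g x|)) => //.
- by move=> n; exact: measurable_funM.
- by move=> x Dx; apply: cvgM; [exact: cvg_cst|exact: ch].
- have := integrableZl mD C (integrable_norm ig).
  by apply: eq_integrable.
- by move=> n x Dx; rewrite normrM mulrC ler_wpM2r// hC.
Qed.

Lemma Rintegral_subset D E f : (forall x, ~ D x -> f x = 0) -> D `<=` E ->
  \int[mu]_(x in E) f x = \int[mu]_(x in D) f x.
Proof.
move=> f0 DE; rewrite Rintegral_mkcond [RHS]Rintegral_mkcond.
congr Rintegral; apply/funext => x; rewrite !patchE.
case: ifPn => xE; case: ifPn => xD //.
- by apply: f0; move: xD; rewrite notin_setE.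
- by move: xE; rewrite notin_setE => xE; exfalso; apply: xE; apply: DE; rewrite -inE.
Qed.

(** From |f| <= (lam + f^2 / lam) / 2. Unlike Cauchy-Schwarz it needs no square
    root, and lam is tuned at each use. *)
Lemma Rintegral_le_young D f (lam Q : R) : measurable D -> (mu D < +oo)%E -> 0 < lam ->
  measurable_fun D f ->
  (\int[mu]_(x in D) (f x ^+ 2)%:E <= Q%:E)%E ->
  mu.-integrable D (EFin \o f) /\
  \int[mu]_(x in D) `|f x| <= (lam * fine (mu D) + Q / lam) / 2.
Proof.
move=> mD muD lam0 mf fQ.
have i1 : mu.-integrable D (EFin \o (fun=> lam)).
  by apply: measurable_bounded_integrable => //; exists `|lam|; split => // M ? x _ /=;
     apply: ltW.
have i2 : mu.-integrable D (EFin \o (fun x => f x ^+ 2)).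
  apply/integrableP; split.
    by apply/measurable_EFinP; exact: measurable_funX.
  apply: (@le_lt_trans _ _ Q%:E); last by rewrite ltry.
  apply: le_trans fQ; rewrite le_eqVlt; apply/orP; left; apply/eqP.
  by apply: eq_integral => x _ /=; rewrite ger0_norm// sqr_ge0.
have i3 : mu.-integrable D (EFin \o (fun x => f x ^+ 2 / lam)).
  by have := integrableZr mD lam^-1 i2; apply: eq_integrable.
have i4 : mu.-integrable D (EFin \o (fun x => lam + f x ^+ 2 / lam)).
  by have := integrableD mD i1 i3; apply: eq_integrable.
have i5 : mu.-integrable D (EFin \o (fun x => (lam + f x ^+ 2 / lam) / 2)).
  by have := integrableZr mD 2^-1 i4; apply: eq_integrable.
have le x : `|f x| <= (lam + f x ^+ 2 / lam) / 2.
  have E : lam * (f x ^+ 2 / lam) = `|f x| ^+ 2.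
    by rewrite mulrCA divff ?gt_eqF// mulr1 real_normK ?num_real.
  have := sqr_ge0 (lam - `|f x|) => h.
  rewrite -(ler_pM2l lam0); lra.
have i6 : mu.-integrable D (EFin \o f).
  apply: le_integrable i5 => //; first exact/measurable_EFinP.
  move=> x Dx /=; rewrite lee_fin; exact: le_trans (le x) (ler_norm _).
split => //.
apply: (@le_trans _ _ (\int[mu]_(x in D) ((lam + f x ^+ 2 / lam) / 2))).
  by apply: le_Rintegral => //; exact: (integrable_norm i6).
rewrite RintegralZr// RintegralD// RintegralZr// Rintegral_cst//.
apply: ler_wpM2r; first by rewrite invr_ge0.
rewrite lerD2l; apply: ler_wpM2r; first by rewrite invr_ge0 ltW.
by rewrite -lee_fin fineK//; exact: integrable_fin_num.
Qed.

End integration.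

(** * Approximation of indicators and of Dirac masses *)

Section kernels.
Variable R : realType.
Local Notation mu := (@lebesgue_measure R).
Implicit Types f g h : R -> R.

Lemma derive1_near_cst f (c x : R) : (\near x, f x = c) -> derive1 f x = 0.
Proof.
move=> h; rewrite derive1E.
have nf : \near x, cst c x = f x by apply: filterS h => y.
by have [_ ->] := near_eq_is_derive nf (is_derive_cst c x (1:R)).
Qed.

Lemma derive1_left f (c a x : R) : (forall y, y < a -> f y = c) -> x < a ->
  derive1 f x = 0.
Proof.
move=> fc xa; apply: (@derive1_near_cst _ c); near=> y; apply: fc.
by near: y; exact: lt_nbhsl.
Unshelve. all: by end_near. Qed.

Lemma derive1_right f (c a x : R) : (forall y, a < y -> f y = c) -> a < x ->
  derive1 f x = 0.
Proof.
move=> fc xa; apply: (@derive1_near_cst _ c); near=> y; apply: fc.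
by near: y; exact: lt_nbhsr.
Unshelve. all: by end_near. Qed.

Lemma derive1n_left f (a x : R) k : (forall y, y < a -> f y = 0) -> x < a ->
  derive1n k f x = 0.
Proof.
move=> f0; elim: k x => [|k IH] x xa; first exact: f0.
by rewrite derive1nS; apply: (@derive1_left _ 0 a).
Qed.

Lemma derive1n_right f (a x : R) k : (forall y, a < y -> f y = 0) -> a < x ->
  derive1n k f x = 0.
Proof.
move=> f0; elim: k x => [|k IH] x xa; first exact: f0.
by rewrite derive1nS; apply: (@derive1_right _ 0 a).
Qed.

Lemma pulse_left k (a x : R) : 0 < k -> x < a -> pulse k a x = 0.
Proof.
move=> k0 xa; rewrite /pulse (@derive1_left _ 0 0) ?mulr0//.
  by move=> y /ltW/step_le0.
by rewrite pmulr_rlt0// subr_lt0.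
Qed.

Lemma pulse_right k (a x : R) : 0 < k -> a + k^-1 < x -> pulse k a x = 0.
Proof.
move=> k0 xa; rewrite /pulse (@derive1_right _ 1 1) ?mulr0//.
  by move=> y /ltW/step_ge1.
rewrite -ltr_pdivrMl// mulr1; lra.
Qed.

Lemma continuous_integrable_itv f (a b : R) : continuous f ->
  mu.-integrable `[a, b] (EFin \o f).
Proof.
move=> cf; apply: continuous_compact_integrable; first exact: segment_compact.
exact: continuous_subspaceT.
Qed.

Lemma pulse_int k a : 0 < k -> \int[mu]_(x in `[a, a + k^-1]) pulse k a x = 1.
Proof.
move=> k0; rewrite /Rintegral (@continuous_FTC2 _ _ (scaled_step k a)).
- by rewrite scaled_step_1// scaled_step_0// sube0.
- by rewrite ltrDl invr_gt0.
- apply: continuous_subspaceT; apply: Cinf_cont; exact: pulse_Cinf.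
- have c := Cinf_cont (scaled_step_Cinf k a); split.
  + by move=> x _; have [] := scaled_step_derive k a x.
  + by apply: cvg_at_right_filter; exact: c.
  + by apply: cvg_at_left_filter; exact: c.
- by move=> x _; rewrite (derive1_eq (scaled_step_derive k a)).
Qed.

Lemma bounded_itv f (a b : R) : continuous f ->
  exists2 C, 0 <= C & forall x, `[a, b]%classic x -> `|f x| <= C.
Proof.
move=> cf.
have : compact (f @` `[a, b]).
  apply: continuous_compact; last exact: segment_compact.
  exact: continuous_subspaceT.
move=> /compact_bounded[M [_ hM]].
exists (`|M| + 1); first by rewrite addr_ge0.
move=> x xab; apply: hM; last by exists x.
by rewrite ltr_pwDr// ler_norm.
Qed.

Lemma integrable_compact_support g h (a b : R) :
  mu.-integrable `[a, b] (EFin \o g) -> continuous h ->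
  (forall x, x < a -> h x = 0) -> (forall x, b < x -> h x = 0) ->
  mu.-integrable setT (EFin \o (fun x => g x * h x)).
Proof.
move=> ig ch ha hb.
have [C _ hC] := bounded_itv a b ch.
have i : mu.-integrable `[a, b] (EFin \o (fun x => g x * h x)).
  apply: (@integrable_mul_bounded _ _ _ _ _ _ _ C) => //.
  exact: measurable_funTS (continuous_measurable_fun ch).
have := i; rewrite integrable_mkcond//.
apply: eq_integrable => // x _; rewrite patchE; case: ifPn => //.
rewrite notin_setE/= in_itv/= => /negP; rewrite negb_and -!ltNge => /orP[] xa /=.
  by rewrite ha// mulr0.
by rewrite hb// mulr0.
Qed.

Lemma Rintegral_compact_support f (a b : R) :
  (forall x, x < a -> f x = 0) -> (forall x, b < x -> f x = 0) ->
  \int[mu]_x f x = \int[mu]_(x in `[a, b]) f x.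
Proof.
move=> fa fb; apply: Rintegral_subset => // x /= /negP.
by rewrite in_itv/= negb_and -!ltNge => /orP[/fa|/fb].
Qed.

(** The pulse has mass 1 and lives in [a, a + 1/k], so it averages the values of f
    there. *)
Lemma pulse_avg f (L e k a : R) : 0 < k ->
  measurable_fun `[a, a + k^-1] f ->
  (forall x, a <= x <= a + k^-1 -> `|f x - L| <= e) ->
  `|\int[mu]_x (f x * pulse k a x) - L| <= e.
Proof.
move=> k0 mf fL.
have cr := Cinf_cont (pulse_Cinf k a).
have ir : mu.-integrable `[a, a + k^-1] (EFin \o pulse k a).
  exact: continuous_integrable_itv.
have iF : mu.-integrable `[a, a + k^-1] (EFin \o (fun x => pulse k a x * f x)).
  apply: (@integrable_mul_bounded _ _ _ _ _ _ _ (`|L| + e)) => //.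
  move=> x /=; rewrite in_itv/= => /fL h.
  by rewrite -[f x](subrK L) addrC (le_trans (ler_normD _ _))// lerD2l.
have iL : mu.-integrable `[a, a + k^-1] (EFin \o (fun x => pulse k a x * L)).
  exact: integrableZrR.
rewrite (@Rintegral_compact_support _ a (a + k^-1)); last 2 first.
- by move=> x xa; rewrite pulse_left// mulr0.
- by move=> x xa; rewrite pulse_right// mulr0.
rewrite -[X in _ - X](mul1r L) -(pulse_int a k0) -RintegralZr//.
under eq_Rintegral do rewrite mulrC.
rewrite -RintegralB//.
have iB : mu.-integrable `[a, a + k^-1]
   (EFin \o (fun x => pulse k a x * f x - pulse k a x * L)).
  exact: integrableBR.
apply: le_trans (le_normr_Rintegral _ iB) _ => //.
rewrite -[leRHS]mul1r -(pulse_int a k0) -RintegralZr//.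
apply: le_Rintegral => //.
- exact: integrable_norm.
- exact: integrableZrR.
- move=> x /=; rewrite in_itv/= => /fL h.
  by rewrite -mulrBr normrM ger0_norm ?pulse_ge0// ler_wpM2l ?pulse_ge0.
Qed.

(** Scales tending to infinity. The offset K guarantees from the start that the
    transition layers, of width 1 / zoom K n, fit in the intervals at hand. *)
Definition zoom (K : R) (n : nat) : R := K + n.+1%:R.

Lemma zoom_gt0 (K : R) n : 0 <= K -> 0 < zoom K n.
Proof. by move=> K0; rewrite /zoom ltr_wpDl// ltr0n. Qed.

Lemma zoom_inv_le1 (K : R) n : 0 <= K -> (zoom K n)^-1 <= 1.
Proof.
move=> K0; rewrite invf_le1 ?zoom_gt0// /zoom (@le_trans _ _ (0 + 1))// ?add0r//.
by rewrite (@le_trans _ _ n.+1%:R)// ?ler1n// lerDr.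
Qed.

Lemma zoom_inv_lt (K : R) n : 0 < K -> (zoom K n)^-1 < K^-1.
Proof.
move=> K0; rewrite ltf_pV2 ?posrE ?zoom_gt0 ?(ltW K0)//.
by rewrite /zoom ltrDl ltr0n.
Qed.

Lemma zoom_cvg (K : R) : 0 <= K -> (zoom K n)^-1 @[n --> \oo] --> (0 : R).
Proof.
move=> K0; apply: (@squeeze_cvgr _ _ _ _ (cst 0) (@harmonic R)).
- near=> n; rewrite /= invr_ge0 ltW ?zoom_gt0//=.
  by rewrite lef_pV2 ?posrE ?zoom_gt0 ?ltr0n// /zoom lerDr.
- exact: cvg_cst.
- exact: cvg_harmonic.
Unshelve. all: by end_near. Qed.

Lemma zoom_near (K : R) (d : R) : 0 <= K -> 0 < d -> \forall n \near \oo, (zoom K n)^-1 < d.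
Proof.
move=> K0 d0; have /cvgr0Pnorm_lt/(_ d d0) := zoom_cvg K0.
apply: filterS => n; rewrite ger0_norm// invr_ge0 ltW// zoom_gt0//.
Qed.

Lemma scaled_step_cvg (K a x : R) : 0 <= K ->
  scaled_step (zoom K n) a x @[n --> \oo] --> ((a < x)%R%:R : R).
Proof.
move=> K0; have [ax|xa] := ltP a x; last first.
  apply: cvg_near_cst; near=> n; apply/eqP; rewrite scaled_step_0//; exact: zoom_gt0.
apply: cvg_near_cst; near=> n; apply/eqP; rewrite scaled_step_1//; first exact: zoom_gt0.
suff : (zoom K n)^-1 < x - a by lra.
by near: n; apply: zoom_near => //; lra.
Unshelve. all: by end_near. Qed.

Lemma scaled_ramp_bound k (a x : R) : 0 < k -> 0 <= scaled_ramp k a x <= Num.max (x - a) 0.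
Proof.
move=> k0; rewrite /scaled_ramp; have [ax|xa] := leP 0 (x - a).
  have /andP[h1 h2] := ramp_ge0 (mulr_ge0 (ltW k0) ax).
  by rewrite divr_ge0 ?(ltW k0)//= ler_pdivrMr// [_ * k]mulrC.
by rewrite ramp_le0 ?mul0r ?lexx// pmulr_rle0// ltW.
Qed.

Lemma scaled_ramp_cvg (K a x : R) : 0 <= K ->
  scaled_ramp (zoom K n) a x @[n --> \oo] --> Num.max (x - a) 0.
Proof.
move=> K0; have [xa|ax] := leP (x - a) 0.
  apply: cvg_near_cst; near=> n; apply/eqP.
  by rewrite /scaled_ramp ramp_le0 ?mul0r// pmulr_rle0 ?zoom_gt0.
have h : x - a - (1 - ramp 1) * (zoom K n)^-1 @[n --> \oo] --> (x - a : R).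
  have -> : x - a = x - a - (1 - ramp 1) * 0 by rewrite mulr0 subr0.
  rewrite {1}mulr0 subr0; apply: cvgB; first exact: cvg_cst.
  by apply: cvgM; [exact: cvg_cst|exact: zoom_cvg].
apply: cvg_trans h; apply: near_eq_cvg; near=> n.
have k0 : 0 < zoom K n by exact: zoom_gt0.
rewrite /scaled_ramp (@ramp_ge1 R (zoom K n * (x - a))); first by field; rewrite gt_eqF.
rewrite -ler_pdivrMl// mulr1 ltW//.
by near: n; exact: zoom_near.
Unshelve. all: by end_near. Qed.

Lemma pulse_cvg f (K a : R) : 0 <= K -> continuous f ->
  \int[mu]_x (f x * pulse (zoom K n) a x) @[n --> \oo] --> f a.
Proof.
move=> K0 cf; apply/cvgrPdist_le => e e0.
have /cvgrPdist_le/(_ e e0) := cf a.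
rewrite -nbhs_nearE => /nbhs_normP[r /= r0 hr].
near=> n; rewrite distrC; apply: pulse_avg; first exact: zoom_gt0.
  exact: measurable_funTS (continuous_measurable_fun cf).
move=> x /andP[ax xa]; rewrite distrC; apply: hr => /=.
rewrite /ball_/= distrC ger0_norm ?subr_ge0//.
suff : (zoom K n)^-1 < r by lra.
by near: n; exact: zoom_near.
Unshelve. all: by end_near. Qed.

End kernels.

(** * Weak derivatives of order 0 and 1 *)

Section weak1d.
Variable R : realType.
Local Notation mu := (@lebesgue_measure R).
Implicit Types f g h v : R -> R.

Lemma mu_itv_lty (a b : R) (b0 b1 : bool) :
  (mu [set` Interval (BSide b0 a) (BSide b1 b)] < +oo)%E.
Proof. by rewrite lebesgue_measure_itv/=; case: ifP => _; rewrite -?EFinB ltry. Qed.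

Lemma L2loc_sqr_integrable g (a b : R) : L2loc g ->
  mu.-integrable `[a, b] (EFin \o (fun x => g x ^+ 2)).
Proof.
move=> [mg [m2 _ i2]]; apply/integrableP; split.
  by apply/measurable_EFinP; exact: measurable_funTS.
by apply: i2 => //; exact: segment_compact.
Qed.

Lemma L2loc_sqr_le g (a b : R) : L2loc g ->
  (\int[mu]_(x in `[a, b]) (g x ^+ 2)%:E <=
    (\int[mu]_(x in `[a, b]) (g x ^+ 2))%:E)%E.
Proof.
move=> lg; rewrite fineK//; apply: integrable_fin_num => //.
exact: L2loc_sqr_integrable.
Qed.

Lemma L2loc_integrable g (a b : R) : L2loc g -> mu.-integrable `[a, b] (EFin \o g).
Proof.
move=> lg; have [||||i _] := @Rintegral_le_young _ _ _ mu `[a, b] g 1 _ _ _ _ _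
  (L2loc_sqr_le a b lg) => //.
- exact: mu_itv_lty.
- by apply: measurable_funTS; case: lg.
Qed.

Lemma integrable_locally_integrable g : measurable_fun setT g ->
  (forall a b, mu.-integrable `[a, b] (EFin \o g)) -> locally_integrable setT g.
Proof.
move=> mg ig; split=> //; first exact: openT.
move=> K _ cK; have mK := compact_measurable cK.
have [M [_ hM]] := compact_bounded cK.
have KM : K `<=` `[- (`|M| + 1), `|M| + 1].
  move=> x Kx; rewrite /= in_itv/= -ler_norml; apply: hM => //.
  by rewrite ltr_pwDr// ler_norm.
have /integrableP[_] := ig (- (`|M| + 1)) (`|M| + 1).
apply: le_lt_trans; apply: ge0_subset_integral => //.
apply/measurable_EFinP; apply: measurableT_comp => //; exact: measurable_funTS.
Qed.

Lemma L2loc_locally_integrable g : L2loc g -> locally_integrable setT g.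
Proof.
move=> lg; apply: integrable_locally_integrable; first by case: lg.
by move=> a b; exact: L2loc_integrable.
Qed.

Lemma continuous_L2loc f : continuous f -> L2loc f.
Proof.
move=> cf; have mf := continuous_measurable_fun cf; split => //.
apply: integrable_locally_integrable; first exact: measurable_funX.
move=> a b; apply: continuous_integrable_itv => x.
exact: (cvgM (cf x) (cf x)).
Qed.

(** Lebesgue differentiation along intervals on one side of the point, the form that
    fits increments of a primitive. *)
Lemma lebesgue_right g : locally_integrable setT g ->
  {ae mu, forall x, n.+1%:R * \int[mu]_(y in `]x, x + n.+1%:R^-1]) g y
     @[n --> \oo] --> (g x : R)}.
Proof.
move=> lg.
pose E (x : R) (n : nat) : set R := `]x, x + n.+1%:R^-1]%classic.
have muE x n : mu (E x n) = (n.+1%:R^-1)%:E.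
  rewrite lebesgue_measure_itv/= lte_fin ltrDl invr_gt0 ltr0n/=.
  by rewrite -EFinB addrAC subrr add0r.
have hE x : nicely_shrinking x (E x).
  split; first by move=> n; exact: measurable_itv.
  have p0 n : 0 < 2 * n.+1%:R^-1 :> R by rewrite mulr_gt0// invr_gt0 ltr0n.
  exists (4, fun n => PosNum (p0 n)); split => //=.
  - rewrite -(mulr0 2); apply: cvgM; first exact: cvg_cst.
    exact: cvg_harmonic.
  - move=> n y; rewrite /E/= in_itv/= /ball/= => /andP[xy yx].
    rewrite distrC ger0_norm ?subr_ge0 ?ltW//.
    by move: (p0 n) yx; rewrite /=; move: (_^-1) => s; lra.
  - move=> n; rewrite lebesgue_measure_ball; last exact: ltW; rewrite muE -EFinM lee_fin.
    by rewrite mulr2n; move: (_^-1) => s; lra.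
have := lebesgue_differentiation lg.
apply: filterS; first exact: (ae_filter_ringOfSetsType mu).
move=> x /(nice_lebesgue_differentiation hE lg).
under eq_fun do rewrite muE inver.
move=> /fine_cvg; apply: cvg_trans; apply: near_eq_cvg; near=> n.
rewrite /= ifF; last by rewrite gt_eqF// invr_gt0 ltr0n.
rewrite invrK fineM//.
have [mg _ ig] := lg.
have mE : measurable (E x n) by exact: measurable_itv.
apply: integrable_fin_num => //.
apply: (@integrableS _ _ _ mu `[x, x + n.+1%:R^-1]) => //.
  by apply: subset_itvr; rewrite bnd_simp.
apply/integrableP; split; first by apply/measurable_EFinP; exact: measurable_funTS.
by apply: ig => //; exact: segment_compact.
Unshelve. all: by end_near. Qed.

Lemma test_step_diff k1 k2 (a b : R) : 0 < k1 -> 0 < k2 -> a <= b ->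
  test_function setT (fun x => scaled_step k1 a x - scaled_step k2 b x).
Proof.
move=> k1p k2p ab.
apply: (@test_function1 _ _ a (Num.max (a + k1^-1) (b + k2^-1))).
- by apply: CinfB; exact: scaled_step_Cinf.
- by move=> x xa; rewrite !scaled_step_0// ?subrr// (le_trans xa).
- by move=> x; rewrite ge_max => /andP[h1 h2]; rewrite !scaled_step_1// subrr.
Qed.

Lemma derive1_step_diff k (a b : R) :
  derive1 (fun x => scaled_step k a x - scaled_step k b x) = (fun x => pulse k a x - pulse k b x).
Proof.
by apply: derive1_eq => x; apply: is_deriveB; exact: scaled_step_derive.
Qed.

Lemma indic_oc (a b x : R) : a <= b ->
  (a < x)%R%:R - (b < x)%R%:R = ((a < x <= b)%R%:R : R).
Proof.
move=> ab; rewrite leNgt; have [bx|xb] := ltP b x => /=; last by rewrite andbT subr0.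
by rewrite (le_lt_trans ab bx) subrr.
Qed.

Lemma step_diff_bound k1 k2 (a b x : R) : `|scaled_step k1 a x - scaled_step k2 b x| <= 1.
Proof.
have := scaled_step_ge0 k1 a x; have := scaled_step_le1 k1 a x.
have := scaled_step_ge0 k2 b x; have := scaled_step_le1 k2 b x.
by move=> *; rewrite ler_norml; apply/andP; split; lra.
Qed.

(** The differences of two steps converge boundedly to the indicator of ]a, b]. *)
Lemma cvg_int_step_diff g (K a b : R) : 0 <= K -> a <= b ->
  mu.-integrable `[a, b + 1] (EFin \o g) ->
  \int[mu]_x (g x * (scaled_step (zoom K n) a x - scaled_step (zoom K n) b x)) @[n --> \oo]
    --> \int[mu]_(x in `]a, b]) g x.
Proof.
move=> K0 ab ig.
have k0 n : 0 < zoom K n by exact: zoom_gt0.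
have k1 n : (zoom K n)^-1 <= 1 by exact: zoom_inv_le1.
have -> : \int[mu]_(x in `]a, b]) g x =
    \int[mu]_(x in `[a, b + 1]) (g x * ((a < x)%R%:R - (b < x)%R%:R)).
  rewrite Rintegral_mkcond [RHS]Rintegral_mkcond; congr Rintegral.
  apply/funext => x; rewrite !patchE indic_oc//.
  have [xI|xI] := boolP (a < x <= b).
    rewrite mem_set/= ?in_itv//= mem_set/=; last first.
      by rewrite in_itv/=; move/andP: xI => [? ?]; apply/andP; split; lra.
    by rewrite ?xI mulr1.
  rewrite memNset/= ?in_itv/= ?(negbTE xI)// mulr0.
  by case: ifP.
have E n : \int[mu]_x (g x * (scaled_step (zoom K n) a x - scaled_step (zoom K n) b x)) =
    \int[mu]_(x in `[a, b + 1]) (g x * (scaled_step (zoom K n) a x - scaled_step (zoom K n) b x)).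
  apply: Rintegral_compact_support => x xa.
    by rewrite !scaled_step_0// ?subrr ?mulr0// ltW// (lt_le_trans xa).
  by rewrite !scaled_step_1// ?subrr ?mulr0// ltW//; have := k1 n; lra.
rewrite (eq_fun E).
apply: (@Rintegral_dct_mul _ _ _ _ _ _ _ _ 1) => //.
- move=> n; apply: measurable_funTS; apply: continuous_measurable_fun.
  by apply: Cinf_cont; apply: CinfB; exact: scaled_step_Cinf.
- by move=> x _; apply: cvgB; exact: scaled_step_cvg.
- by move=> n x _; exact: step_diff_bound.
Qed.

Lemma is_wderiv0_int f g (a b : R) : L2loc f -> L2loc g ->
  is_wderiv 0 f g -> a <= b ->
  \int[mu]_(x in `]a, b]) f x = \int[mu]_(x in `]a, b]) g x.
Proof.
move=> lf lg fg ab.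
have hf := cvg_int_step_diff (lexx 0) ab (L2loc_integrable a (b + 1) lf).
have hg := cvg_int_step_diff (lexx 0) ab (L2loc_integrable a (b + 1) lg).
apply: (cvg_unique _ _ hg) => //; apply: cvg_trans hf; apply: near_eq_cvg; near=> n.
have := fg _ (test_step_diff (zoom_gt0 n (lexx 0)) (zoom_gt0 n (lexx 0)) ab).
by rewrite /= expr0 mul1r.
Unshelve. all: by end_near. Qed.

Lemma is_wderiv0_ae f g : L2loc f -> L2loc g -> is_wderiv 0 f g ->
  {ae mu, forall x, f x = g x}.
Proof.
move=> lf lg fg.
have := lebesgue_right (L2loc_locally_integrable lf).
have := lebesgue_right (L2loc_locally_integrable lg).
apply: filterS2; first exact: (ae_filter_ringOfSetsType mu).
move=> x hg hf; apply: (cvg_unique _ hf) => //.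
apply: cvg_trans hg; apply: near_eq_cvg; near=> n.
by rewrite (is_wderiv0_int lf lg)// lerDl invr_ge0.
Unshelve. all: by end_near. Qed.

(** Testing with a difference of two steps, whose derivative is a difference of two
    pulses, gives the fundamental theorem of calculus in the limit. *)
Lemma is_wderiv1_int v g (a b : R) : continuous v -> L2loc g ->
  is_wderiv 1 v g -> a <= b -> v b - v a = \int[mu]_(x in `]a, b]) g x.
Proof.
move=> cv lg vg ab.
have h1 := cvg_int_step_diff (lexx 0) ab (L2loc_integrable a (b + 1) lg).
have h2 : - (\int[mu]_x (v x * pulse (zoom 0 n) a x) -
     \int[mu]_x (v x * pulse (zoom 0 n) b x)) @[n --> \oo] --> - (v a - v b).
  by apply: cvgN; apply: cvgB; exact: pulse_cvg.
have E n := vg _ (test_step_diff (zoom_gt0 n (lexx 0)) (zoom_gt0 n (lexx 0)) ab).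
have -> : v b - v a = - (v a - v b) by rewrite opprB.
apply: (cvg_unique _ _ h1) => //.
apply: cvg_trans h2; apply: near_eq_cvg; near=> n.
rewrite /=; have := E n; rewrite expr1 mulN1r => /(canLR opprK) <-.
rewrite /derive1n/= derive1_step_diff.
have k0 := zoom_gt0 n (lexx (0 : R)).
have ipulse c : mu.-integrable setT (EFin \o (fun x => v x * pulse (zoom 0 n) c x)).
  apply: (@integrable_compact_support _ _ _ c (c + (zoom 0 n)^-1)).
  - exact: continuous_integrable_itv.
  - by apply: Cinf_cont; exact: pulse_Cinf.
  - by move=> x; exact: pulse_left.
  - by move=> x; exact: pulse_right.
rewrite -RintegralB//; congr (- _).
by apply: eq_Rintegral => x _; rewrite mulrBr.
Unshelve. all: by end_near. Qed.

End weak1d.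

(** * Weak second derivatives and divided differences *)

Section weak2.
Variable R : realType.
Local Notation mu := (@lebesgue_measure R).
Implicit Types f g h v : R -> R.

(** A combination of three ramps that vanishes on the right of z, up to the width of
    the transition: its coefficients have zero sum and zero first moment. Its
    second derivative is the corresponding combination of three pulses. *)
Definition tent k (x y z s : R) :=
  (z - y) * scaled_ramp k x s - (z - x) * scaled_ramp k y s + (y - x) * scaled_ramp k z s.

Lemma CinfZ (c : R) f : Cinf f -> Cinf (fun x => c * f x).
Proof. by move=> cf; apply: CinfM => //; exact: Cinf_cst. Qed.

Lemma tent_Cinf k x y z : Cinf (tent k x y z).
Proof.
by apply: CinfD; [apply: CinfB|]; apply: CinfZ; exact: scaled_ramp_Cinf.
Qed.

Lemma scaled_ramp_right k (a s : R) : 0 < k -> a + k^-1 <= s ->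
  scaled_ramp k a s = s - a - (1 - ramp 1) / k.
Proof.
move=> k0 h; rewrite /scaled_ramp (@ramp_ge1 R (k * (s - a))).
  by field; rewrite gt_eqF.
by rewrite -ler_pdivrMl// mulr1; lra.
Qed.

Lemma scaled_ramp_left k (a s : R) : 0 < k -> s <= a -> scaled_ramp k a s = 0.
Proof. by move=> k0 h; rewrite /scaled_ramp ramp_le0 ?mul0r// pmulr_rle0// subr_le0. Qed.

Lemma tent_left k (x y z s : R) : 0 < k -> x <= y -> y <= z -> s <= x -> tent k x y z s = 0.
Proof.
move=> k0 xy yz sx; have sy := le_trans sx xy; have sz := le_trans sy yz.
by rewrite /tent !scaled_ramp_left// !mulr0; ring.
Qed.

Lemma tent_right k (x y z s : R) : 0 < k -> x <= y -> y <= z -> z + k^-1 <= s ->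
  tent k x y z s = 0.
Proof.
move=> k0 xy yz sz; rewrite /tent !scaled_ramp_right//; first by field; rewrite gt_eqF.
- by lra.
- by lra.
Qed.

Lemma test_tent k (x y z : R) : 0 < k -> x <= y -> y <= z ->
  test_function setT (tent k x y z).
Proof.
move=> k0 xy yz; apply: (@test_function1 _ _ x (z + k^-1)).
- exact: tent_Cinf.
- by move=> s; exact: tent_left.
- by move=> s; exact: tent_right.
Qed.

Lemma is_deriveZR f (c x d : R) : is_derive x 1 f d ->
  is_derive x 1 (fun x => c * f x) (c * d).
Proof. by move=> df; have := is_deriveZ c df; exact. Qed.

Lemma derive2_tent k (x y z : R) : k != 0 -> derive1n 2 (tent k x y z) =
  fun s => (z - y) * pulse k x s - (z - x) * pulse k y s + (y - x) * pulse k z s.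
Proof.
move=> k0.
have d1 (s : R) : is_derive s 1 (tent k x y z)
    ((z - y) * scaled_step k x s - (z - x) * scaled_step k y s + (y - x) * scaled_step k z s).
  by apply: is_deriveD; [apply: is_deriveB|]; apply: is_deriveZR; exact: scaled_ramp_derive.
rewrite /derive1n/= (derive1_eq d1); apply: derive1_eq => s.
by apply: is_deriveD; [apply: is_deriveB|]; apply: is_deriveZR; exact: scaled_step_derive.
Qed.

(** The limit of the tents: the piecewise linear function with nodes x, y, z, which
    is up to normalisation the Peano kernel of the second divided difference. *)
Definition hat (x y z s : R) :=
  (z - y) * Num.max (s - x) 0 - (z - x) * Num.max (s - y) 0
  + (y - x) * Num.max (s - z) 0.

Lemma hat_bound (x y z s : R) : x <= y -> y <= z -> 0 <= hat x y z s <= (y - x) * (z - y).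
Proof.
move=> xy yz; rewrite /hat.
have [h1|h1] := leP (s - x) 0; have [h2|h2] := leP (s - y) 0;
  have [h3|h3] := leP (s - z) 0; apply/andP; split; nra.
Qed.

Lemma hat_out (x y z s : R) : x <= y -> y <= z -> ~ (x <= s <= z) -> hat x y z s = 0.
Proof.
move=> xy yz /negP; rewrite negb_and -!ltNge /hat => /orP[sx|zs].
  by rewrite !max_r; [ring| lra..].
by rewrite !max_l; [ring|lra..].
Qed.

Lemma Rintegral_le_subset g (a b c d : R) : (forall x y, mu.-integrable `[x, y] (EFin \o g)) ->
  a <= c -> d <= b ->
  \int[mu]_(x in `[c, d]) `|g x| <= \int[mu]_(x in `[a, b]) `|g x|.
Proof.
move=> ig ac db.
have i x y : mu.-integrable `[x, y] (EFin \o (fun x => `|g x|)).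
  by apply: integrable_norm; exact: ig.
rewrite fine_le//; [by apply: integrable_fin_num => //; exact: i..|].
apply: ge0_subset_integral => //.
  by apply: measurable_int (i a b).
by apply: subset_itv; rewrite bnd_simp.
Qed.

(** Tested with the tents, the weak second derivative expresses in the limit the
    second divided difference of v as the integral of g against the hat
    function. *)
Lemma three_point v g (x y z : R) : continuous v -> L2loc g -> is_wderiv 2 v g ->
  x <= y -> y <= z ->
  `|(v y - v x) * (z - y) - (v z - v y) * (y - x)| <=
     (y - x) * (z - y) * \int[mu]_(s in `[x, z]) `|g s|.
Proof.
move=> cv lg vg xy yz.
have k0 n : 0 < zoom 0 n :> R by exact: zoom_gt0.
have ig := fun a b => L2loc_integrable a b lg.
(* Bound of the tents on [x, z + 1], for dominated convergence. *)
pose C := ((z - y) + (z - x) + (y - x)) * (z + 1 - x).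
have c1 : \int[mu]_s (g s * tent (zoom 0 n) x y z s) @[n --> \oo] -->
    \int[mu]_(s in `[x, z]) (g s * hat x y z s).
  have -> : \int[mu]_(s in `[x, z]) (g s * hat x y z s) =
      \int[mu]_(s in `[x, z + 1]) (g s * hat x y z s).
    apply/esym/Rintegral_subset.
      by move=> s /=; rewrite in_itv/= => xs; rewrite hat_out// mulr0.
    by apply: subset_itvl; rewrite bnd_simp lerDl.
  have E n : \int[mu]_s (g s * tent (zoom 0 n) x y z s) =
      \int[mu]_(s in `[x, z + 1]) (g s * tent (zoom 0 n) x y z s).
    apply: Rintegral_compact_support => s h.
      by rewrite tent_left ?mulr0// ltW.
    rewrite tent_right ?mulr0//.
    by have := zoom_inv_le1 n (lexx (0 : R)); lra.
  rewrite (eq_fun E).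
  apply: (@Rintegral_dct_mul _ _ _ _ _ _ _ _ C) => //.
  - move=> n; apply: measurable_funTS; apply: continuous_measurable_fun.
    by apply: Cinf_cont; exact: tent_Cinf.
  - move=> s _; apply: cvgD; [apply: cvgB|]; apply: cvgM;
      by [exact: cvg_cst|exact: scaled_ramp_cvg].
  - move=> n s /=; rewrite in_itv/= => /andP[xs sz].
    have h a : x <= a -> `|scaled_ramp (zoom 0 n) a s| <= z + 1 - x.
      move=> xa; have /andP[h1 h2] := scaled_ramp_bound a s (k0 n).
      rewrite ger0_norm//; apply: (le_trans h2).
      by rewrite ge_max; apply/andP; split; lra.
    have -> : C = (z - y) * (z + 1 - x) + (z - x) * (z + 1 - x) +
       (y - x) * (z + 1 - x) by rewrite /C; ring.
    rewrite /tent.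
    apply: le_trans (ler_normD _ _) _; apply: lerD.
      apply: le_trans (ler_normB _ _) _; apply: lerD; rewrite normrM;
        rewrite ger0_norm ?subr_ge0 ?(le_trans xy yz)//; apply: ler_wpM2l;
        rewrite ?subr_ge0 ?(le_trans xy yz)//; exact: h.
    rewrite normrM ger0_norm ?subr_ge0//; apply: ler_wpM2l;
        rewrite ?subr_ge0//; apply: h; exact: le_trans xy yz.
have c2 : (z - y) * \int[mu]_s (v s * pulse (zoom 0 n) x s)
    - (z - x) * \int[mu]_s (v s * pulse (zoom 0 n) y s)
    + (y - x) * \int[mu]_s (v s * pulse (zoom 0 n) z s) @[n --> \oo] -->
    (z - y) * v x - (z - x) * v y + (y - x) * v z.
  by apply: cvgD; [apply: cvgB|]; apply: cvgM;
    by [exact: cvg_cst|exact: pulse_cvg].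
have E : \int[mu]_(s in `[x, z]) (g s * hat x y z s) =
    (z - y) * v x - (z - x) * v y + (y - x) * v z.
  apply: (cvg_unique _ c1) => //; apply: cvg_trans c2; apply: near_eq_cvg; near=> n.
  have := vg _ (test_tent (k0 n) xy yz); rewrite sqrrN expr1n mul1r => <-.
  rewrite derive2_tent ?gt_eqF//.
  have ipulse c : mu.-integrable setT (EFin \o (fun x => v x * pulse (zoom 0 n) c x)).
    apply: (@integrable_compact_support _ _ _ c (c + (zoom 0 n)^-1)).
    - exact: continuous_integrable_itv.
    - by apply: Cinf_cont; exact: pulse_Cinf.
    - by move=> s; exact: pulse_left.
    - by move=> s; exact: pulse_right.
  rewrite -!RintegralZl// -RintegralB//; [|exact: integrableZlR..].
  rewrite -RintegralD//; [|by apply: integrableBR => //; exact: integrableZlR|exact: integrableZlR].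
  by apply: eq_Rintegral => s _; ring.
have -> : (v y - v x) * (z - y) - (v z - v y) * (y - x) =
  - \int[mu]_(s in `[x, z]) (g s * hat x y z s) by rewrite E; ring.
rewrite normrN.
have mhat : measurable_fun `[x, z] (hat x y z).
  apply: measurable_funTS; apply: (@measurable_fun_cvg _ _ _ _
     (fun n => tent (zoom 0 n) x y z)) => [n|s _].
    by apply: continuous_measurable_fun; apply: Cinf_cont; exact: tent_Cinf.
  by apply: cvgD; [apply: cvgB|]; apply: cvgM; by [exact: cvg_cst|exact: scaled_ramp_cvg].
have hb s : `|hat x y z s| <= (y - x) * (z - y).
  by have /andP[h1 h2] := hat_bound s xy yz; rewrite ger0_norm.
have igh : mu.-integrable `[x, z] (EFin \o (fun s => g s * hat x y z s)).
  by apply: (@integrable_mul_bounded _ _ _ _ _ _ _ ((y - x) * (z - y))).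
apply: le_trans (le_normr_Rintegral _ igh) _ => //.
have ign : mu.-integrable `[x, z] (EFin \o (fun s => `|g s|)).
  by apply: integrable_norm; exact: ig.
rewrite -RintegralZl//; apply: le_Rintegral => //.
- exact: integrable_norm.
- exact: integrableZlR.
- by move=> s _; rewrite normrM mulrC ler_wpM2r.
Unshelve. all: by end_near. Qed.

(** The slopes over [0, x], [x, y] and [y, 1] differ by at most the integral of |g|,
    and they average to 0 because v takes the same value at 0 and 1. *)
Lemma wderiv2_lipschitz v g (x y : R) : continuous v -> L2loc g -> is_wderiv 2 v g ->
  v 0 = v 1 -> 0 <= x -> x <= y -> y <= 1 ->
  `|v y - v x| <= (y - x) * \int[mu]_(s in `[0, 1]) `|g s|.
Proof.
move=> cv lg vg v01 x0 xy y1.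
set M := \int[mu]_(s in _) _.
have M0 : 0 <= M by apply: Rintegral_ge0.
have ig := fun a b => L2loc_integrable a b lg.
have h1 : `|(v x - v 0) * (y - x) - (v y - v x) * (x - 0)| <= (x - 0) * (y - x) * M.
  apply: le_trans (three_point cv lg vg x0 xy) _.
  apply: ler_wpM2l; first by rewrite mulr_ge0// subr_ge0.
  exact: Rintegral_le_subset.
have h2 : `|(v y - v x) * (1 - y) - (v 1 - v y) * (y - x)| <= (y - x) * (1 - y) * M.
  apply: le_trans (three_point cv lg vg xy y1) _.
  apply: ler_wpM2l; first by rewrite mulr_ge0// subr_ge0.
  exact: Rintegral_le_subset.
have -> : v y - v x = - ((v x - v 0) * (y - x) - (v y - v x) * (x - 0)) +
   ((v y - v x) * (1 - y) - (v 1 - v y) * (y - x)) by rewrite v01; ring.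
apply: le_trans (ler_normD _ _) _; rewrite normrN.
apply: le_trans (lerD h1 h2) _.
have : 0 <= (y - x) * M * (y - x) by rewrite !mulr_ge0// subr_ge0.
by move: M0 x0 xy y1; clear; nra.
Qed.

(** Interpolation: compare the slope over a short interval with the one over an
    adjacent interval of length eta, which is at most 2 e / eta because v is
    within e of a constant; the difference is bounded by the integral of |g|
    nearby. *)
Lemma wderiv2_short_slope v g (c e eta M x y : R) :
  continuous v -> L2loc g -> is_wderiv 2 v g ->
  (forall s, 0 <= s <= 1 -> `|v s - c| <= e) ->
  0 < eta <= 3^-1 ->
  (forall a b, 0 <= a -> a <= b -> b <= 1 -> b - a <= 2 * eta ->
    \int[mu]_(s in `[a, b]) `|g s| <= M) ->
  0 <= x -> x <= y -> y <= 1 -> y - x <= eta ->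
  `|v y - v x| <= (y - x) * (2 * e / eta + M).
Proof.
move=> cv lg vg ve /andP[eta0 eta3] gM x0 xy y1 yx.
have dv s s' : 0 <= s <= 1 -> 0 <= s' <= 1 -> `|v s - v s'| <= 2 * e.
  move=> hs hs'; have := ve _ hs; have := ve _ hs'; rewrite !ler_norml.
  by move=> /andP[? ?] /andP[? ?]; apply/andP; split; lra.
have E D : `|D| <= (y - x) * (2 * e) + (y - x) * eta * M ->
    `|D| / eta <= (y - x) * (2 * e / eta + M).
  rewrite ler_pdivrMr// => /le_trans; apply; rewrite le_eqVlt; apply/orP; left.
  by apply/eqP; field; rewrite gt_eqF.
have -> : `|v y - v x| = `|(v y - v x) * eta| / eta.
  by rewrite normrM (gtr0_norm eta0) mulfK// gt_eqF.
apply: E.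
(* The adjacent interval is taken on the side where it fits in [0, 1]; one does because
   eta <= 1/3 and y - x <= eta. *)
have [h|h] := leP (y + eta) 1.
  have yz : y <= y + eta by rewrite lerDl ltW.
  have := three_point cv lg vg xy yz.
  have -> : y + eta - y = eta by ring.
  move=> h1.
  have : `|(v (y + eta) - v y) * (y - x)| <= (y - x) * (2 * e).
    rewrite normrM mulrC ger0_norm ?subr_ge0// ler_wpM2l ?subr_ge0//.
    by apply: dv; apply/andP; split; lra.
  have : (y - x) * eta * \int[mu]_(s in `[x, y + eta]) `|g s| <= (y - x) * eta * M.
    apply: ler_wpM2l; first by rewrite mulr_ge0 ?subr_ge0// ltW.
    by apply: gM; lra.
  move=> h2 h3; move: (le_trans h1 h2) h3; rewrite !ler_norml.
  by move=> /andP[? ?] /andP[? ?]; apply/andP; split; lra.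
have zx : x - eta <= x by rewrite gerBl ltW.
have := three_point cv lg vg zx xy.
have -> : x - (x - eta) = eta by ring.
move=> h1.
have : `|(v x - v (x - eta)) * (y - x)| <= (y - x) * (2 * e).
  rewrite normrM mulrC ger0_norm ?subr_ge0// ler_wpM2l ?subr_ge0//.
  by apply: dv; apply/andP; split; lra.
have : eta * (y - x) * \int[mu]_(s in `[x - eta, y]) `|g s| <= (y - x) * eta * M.
  rewrite [eta * _]mulrC; apply: ler_wpM2l; first by rewrite mulr_ge0 ?subr_ge0// ltW.
  by apply: gM; lra.
move=> h2 h3; move: (le_trans h1 h2) h3; rewrite !ler_norml.
by move=> /andP[? ?] /andP[? ?]; apply/andP; split; lra.
Qed.

End weak2.

(** * The norm of H^1 *)

Section energy.
Variable R : realType.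
Local Notation mu := (@lebesgue_measure R).
Implicit Types f g h v phi : R -> R.

Lemma wderivP k f : (exists2 g, L2loc g & is_wderiv k f g) ->
  L2loc (wderiv k f) /\ is_wderiv k f (wderiv k f).
Proof.
move=> [g lg wg]; rewrite /wderiv.
by have := @xgetPex _ (cst 0 : R -> R) [set g | L2loc g /\ is_wderiv k f g];
  apply; exists g.
Qed.

Lemma test_function_bounded_support phi : test_function setT phi ->
  exists2 M : R, 0 < M & forall x, M < `|x| -> phi x = 0.
Proof.
move=> [_ /compact_bounded[M [_ hM]] _].
exists (`|M| + 1); first by rewrite ltr_wpDl.
move=> x xM; apply: contrapT => /eqP phi0.
have : closure [set x | phi x != 0] x by apply: subset_closure.
move=> /(hM (`|M| + 1)); rewrite ltr_pwDr ?ler_norm// => /(_ isT).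
by move=> /= xM'; have := lt_le_trans xM xM'; rewrite ltxx.
Qed.

Lemma smooth_derive1 phi : smooth phi ->
  (forall x : R, is_derive x 1 phi (derive1 phi x)) /\ continuous (derive1 phi).
Proof.
move=> sphi; have [_ d] := sphi [::]; have [c _] := sphi [:: (1 : R)].
split; last first.
  suff -> : derive1 phi = 'D_1 phi by [].
  by apply/funext => x; rewrite derive1E.
by move=> x; apply: DeriveDef; [exact: d|rewrite derive1E].
Qed.

Lemma test_function_derive1_supp phi (M : R) : (forall x, M < `|x| -> phi x = 0) ->
  forall x, M < `|x| -> derive1 phi x = 0.
Proof.
move=> h x; rewrite ltr_normr => /orP[xM|xM].
  by apply: (@derive1_right _ _ 0 M) => // y yM; apply: h; rewrite ltr_normr yM.
apply: (@derive1_left _ _ 0 (- M)); last by rewrite ltrNr.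
by move=> y yM; apply: h; rewrite ltr_normr ltrNr yM orbT.
Qed.

Lemma Rintegral_derive1_test phi : test_function setT phi ->
  \int[mu]_x derive1 phi x = 0.
Proof.
move=> tphi; have [M M0 hM] := test_function_bounded_support tphi.
have [d c] := smooth_derive1 (let: And3 s _ _ := tphi in s).
have hM' := test_function_derive1_supp hM.
rewrite (@Rintegral_compact_support _ _ (- (M + 1)) (M + 1)); last 2 first.
- by move=> x xM; apply: hM'; rewrite ltr_normr; apply/orP; right; lra.
- by move=> x xM; apply: hM'; rewrite ltr_normr; apply/orP; left; lra.
have cphi := is_derive_continuous d.
rewrite /Rintegral (@continuous_FTC2 _ _ phi).
- rewrite !hM ?subee// ?normrN ger0_norm ?ltrDl//; lra.
- lra.
- exact: continuous_subspaceT.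
- split.
  + by move=> x _; have [] := d x.
  + by apply: cvg_at_right_filter; exact: cphi.
  + by apply: cvg_at_left_filter; exact: cphi.
- by [].
Qed.

(** A constant has zero weak derivative because test functions have compact support. *)
Lemma is_wderiv1_subC v g (c : R) : continuous v -> is_wderiv 1 v g ->
  is_wderiv 1 (fun x => v x - c) g.
Proof.
move=> cv vg phi tphi; rewrite -(vg _ tphi).
have [M M0 hM] := test_function_bounded_support tphi.
have [d cphi] := smooth_derive1 (let: And3 s _ _ := tphi in s).
have hM' := test_function_derive1_supp hM.
have i f : continuous f -> mu.-integrable setT (EFin \o (fun x => f x * derive1 phi x)).
  move=> cf; apply: (@integrable_compact_support _ _ _ (- M) M) => //.
  - exact: continuous_integrable_itv.
  - by move=> x xM; apply: hM'; rewrite ltr_normr; apply/orP; right; lra.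
  - by move=> x xM; apply: hM'; rewrite ltr_normr; apply/orP; left; lra.
have -> : \int[mu]_x ((v x - c) * derive1n 1 phi x) =
   \int[mu]_x (v x * derive1 phi x - c * derive1 phi x).
  by apply: eq_Rintegral => x _; rewrite /derive1n/= mulrBl.
rewrite RintegralB//; [|exact: i|by apply: (i (cst c)) => x; exact: cvg_cst].
rewrite RintegralZl//; last first.
  have -> : (EFin \o derive1 phi) = (EFin \o (fun x => 1 * derive1 phi x)).
    by apply/funext => x; rewrite /= mul1r.
  by apply: (i (cst 1)) => x; exact: cvg_cst.
by rewrite Rintegral_derive1_test// mulr0 subr0.
Qed.

Lemma Hper1_subC v (c : R) : continuous v -> (forall x, v (x + 1) = v x) ->
  Hper 2 v -> Hper 1 (fun x => v x - c).
Proof.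
move=> cv pv [[_ hk] _]; split; last by apply: aeW => x; rewrite pv.
have cvc : continuous (fun x => v x - c).
  by move=> x; apply: cvgB; [exact: cv|exact: cvg_cst].
have lvc := continuous_L2loc cvc.
split => // -[_|[_|//]].
  by exists (fun x => v x - c) => // phi _; rewrite expr0 mul1r.
have [g lg wg] := hk 1%N isT.
by exists g => //; exact: is_wderiv1_subC.
Qed.

(** The bound is asked on the open interval only, since it will come from increments
    to the right. *)
Lemma sqr_int_le g (B : R) : L2loc g ->
  {ae mu, forall x, 0 < x < 1 -> `|g x| <= B} ->
  \int[mu]_(x in `[0, 1]) (g x ^+ 2) <= B ^+ 2.
Proof.
move=> lg hB.
have mg : measurable_fun setT g by case: lg.
rewrite -lee_fin fineK; last first.
  by apply: integrable_fin_num => //; exact: L2loc_sqr_integrable.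
rewrite -integral_itv_obnd_cbnd; last first.
  by apply/measurable_EFinP; apply: measurable_funTS; exact: measurable_funX.
rewrite -integral_itv_bndo_bndc; last first.
  by apply/measurable_EFinP; apply: measurable_funTS; exact: measurable_funX.
apply: (@le_trans _ _ (\int[mu]_(x in `]0%R, 1%R[) (B ^+ 2)%:E)%E); last first.
  rewrite integral_cst//= lebesgue_measure_itv/= lte_fin ltr01.
  by rewrite oppr0 adde0 mule1.
apply: ae_ge0_le_integral => //.
- by move=> x _; rewrite lee_fin sqr_ge0.
- by apply/measurable_EFinP; apply: measurable_funTS; exact: measurable_funX.
- by move=> x _; rewrite lee_fin sqr_ge0.
apply: filterS hB; first exact: (ae_filter_ringOfSetsType mu).
move=> x hx; rewrite /= in_itv/= => /hx gB; rewrite lee_fin.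
by rewrite -(real_normK (num_real (g x))) lerXn2r// nnegrE (le_trans _ gB).
Qed.

(** A Lipschitz bound for increments passes to the weak derivative at Lebesgue
    points. It is enough to have it for short increments. *)
Lemma Hnorm1_le v (c e L : R) : continuous v -> (forall x, v (x + 1) = v x) ->
  Hper 2 v ->
  (forall x, 0 <= x <= 1 -> `|v x - c| <= e) ->
  (exists2 d, 0 < d & forall x y, 0 <= x -> x <= y -> y <= 1 -> y - x <= d ->
     `|v y - v x| <= (y - x) * L) ->
  (Hnorm 1 (fun x => v x - c)%R <= (Num.sqrt (e ^+ 2 + L ^+ 2))%:E)%E.
Proof.
move=> cv pv h2 ve [d d0 hL].
have H1 := Hper1_subC c cv pv h2.
rewrite /Hnorm asboolT// lee_fin ler_wsqrtr//.
rewrite !big_ord_recr big_ord0/= add0r.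
have [[lvc hk] _] := H1.
have [l0 w0] := wderivP (hk 0%N isT); have [l1 w1] := wderivP (hk 1%N isT).
apply: lerD; apply: sqr_int_le => //.
  have := is_wderiv0_ae lvc l0 w0.
  apply: filterS; first exact: (ae_filter_ringOfSetsType mu).
  by move=> x <- /andP[x0 x1]; apply: ve; rewrite !ltW.
have cvc : continuous (fun x => v x - c).
  by move=> x; apply: cvgB; [exact: cv|exact: cvg_cst].
have := lebesgue_right (L2loc_locally_integrable l1).
apply: filterS; first exact: (ae_filter_ringOfSetsType mu).
move=> x hx /andP[x0 x1].
apply: (@ler_cvg_to _ _ _ _ _ (cst L) _ _ (cvg_norm hx) (cvg_cst _)).
near=> n; rewrite /=.
have r0 : 0 < n.+1%:R^-1 :> R by rewrite invr_gt0.
rewrite -(is_wderiv1_int cvc l1 w1) ?lerDl ?(ltW r0)//.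
have : n.+1%:R^-1 < Num.min d (1 - x).
  by near: n; apply: (cvgr_lt 0 cvg_harmonic); rewrite lt_min d0 subr_gt0.
rewrite lt_min => /andP[rd rx].
set r := n.+1%:R^-1 in r0 rd rx *.
have -> : v (x + r) - c - (v x - c) = v (x + r) - v x by ring.
rewrite normrM ger0_norm// mulrC -ler_pdivlMr//.
have -> : L / n.+1%:R = (x + r - x) * L by rewrite /r; ring.
apply: hL; lra.
Unshelve. all: by end_near. Qed.

End energy.

(** * Consequences of a bound on the energy E *)

Section energy2.
Variable R : realType.
Local Notation mu := (@lebesgue_measure R).
Implicit Types f g h v phi : R -> R.

Lemma energyE_ge0 f : (0 <= energyE f)%E.
Proof.
rewrite /energyE; case: ifP => _; last exact: leey.
by apply: integral_ge0 => x _; rewrite lee_fin mulr_ge0// ?invr_ge0 ?sqr_ge0.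
Qed.

Lemma energyE_wderiv2 f : (energyE f < +oo)%E ->
  Hper 2 (cube f) /\ exists g, [/\ L2loc g, is_wderiv 2 (cube f) g &
    energyE f = (6^-1 * \int[mu]_(x in `[0, 1]) (g x ^+ 2))%:E].
Proof.
rewrite /energyE; case: ifPn => [/asboolP H _|]; last by rewrite ltxx.
split => //; exists (wderiv 2 (cube f)).
have [[_ /(_ 2%N isT)/wderivP[lg wg]] _] := H.
split => //.
have i := L2loc_sqr_integrable 0 1 lg.
by rewrite -RintegralZl// /Rintegral fineK//; apply: integrable_fin_num => //;
  exact: integrableZlR.
Qed.

(** The L^1 norm of the second derivative of f^3 over an interval, in the form given
    by Young's inequality. *)
Lemma energyE_young f (Q : R) : (energyE f <= Q%:E)%E ->
  Hper 2 (cube f) /\ exists g, [/\ L2loc g, is_wderiv 2 (cube f) g &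
    forall lam a b, 0 < lam -> 0 <= a -> a <= b -> b <= 1 ->
      \int[mu]_(x in `[a, b]) `|g x| <= (lam * (b - a) + 6 * Q / lam) / 2].
Proof.
move=> fQ; have [|H [g [lg wg E]]] := @energyE_wderiv2 f.
  by apply: le_lt_trans fQ _; rewrite ltry.
split => //; exists g; split => // lam a b lam0 a0 ab b1.
have gQ : \int[mu]_(x in `[0, 1]) (g x ^+ 2) <= 6 * Q.
  by move: fQ; rewrite E lee_fin mulrC ler_pdivrMr// mulrC.
have mg : measurable_fun setT g by case: lg.
have [||||i le] := @Rintegral_le_young _ _ _ mu `[a, b] g lam (6 * Q) _ _ lam0.
- exact: measurable_itv.
- exact: mu_itv_lty.
- exact: measurable_funTS.
- apply: (@le_trans _ _ (\int[mu]_(x in `[0%R, 1%R]) (g x ^+ 2)%:E)%E); last first.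
    by apply: le_trans (L2loc_sqr_le 0 1 lg) _; rewrite lee_fin.
  apply: ge0_subset_integral => //.
  + by apply/measurable_EFinP; apply: measurable_funTS; exact: measurable_funX.
  + by move=> x _; rewrite lee_fin sqr_ge0.
  + by apply: subset_itv; rewrite bnd_simp.
apply: le_trans le _; rewrite /= lebesgue_measure_itv/= lte_fin.
have [ab'|ba] := ltP a b; first by rewrite -EFinB.
by rewrite (_ : b - a = 0)//; lra.
Qed.

(** With lam = 1 this is a uniform Lipschitz bound; with Q and lam both small it
    says that a function of small energy is almost constant. *)
Lemma energyE_lipschitz f (Q lam x y : R) : continuous (cube f) -> f 0 = f 1 ->
  (energyE f <= Q%:E)%E -> 0 < lam -> 0 <= x -> x <= y -> y <= 1 ->
  `|f y ^+ 3 - f x ^+ 3| <= (y - x) * ((lam + 6 * Q / lam) / 2).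
Proof.
move=> cf f01 fQ lam0 x0 xy y1.
have [H [g [lg wg gM]]] := energyE_young fQ.
apply: le_trans (wderiv2_lipschitz cf lg wg _ x0 xy y1) _; first by rewrite /cube f01.
apply: ler_wpM2l; first by rewrite subr_ge0.
by apply: le_trans (gM lam 0 1 lam0 _ _ _) _ => //; rewrite subr0 mulr1.
Qed.

(** Meant for parameters chosen in the order lam, eta, e: lam makes 6 Q / lam small,
    then eta makes lam eta small, then e makes e / eta small. *)
Lemma energyE_Hnorm1 f (Q c e eta lam : R) : continuous (cube f) ->
  (forall x, f (x + 1) = f x) ->
  (energyE f <= Q%:E)%E -> 0 < lam -> 0 < eta <= 3^-1 ->
  (forall x, 0 <= x <= 1 -> `|f x ^+ 3 - c| <= e) ->
  (Hnorm 1 (fun x => f x ^+ 3 - c)%R <=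
   (Num.sqrt (e ^+ 2 + (2 * e / eta + (lam * (2 * eta) + 6 * Q / lam) / 2) ^+ 2))%:E)%E.
Proof.
move=> cf pf fQ lam0 eta0 fe.
have [H [g [lg wg gM]]] := energyE_young fQ.
apply: Hnorm1_le => //; first by move=> x; rewrite pf.
exists eta; first by case/andP: eta0.
move=> x y x0 xy y1 yx; apply: (wderiv2_short_slope cf lg wg fe eta0) => //.
move=> a b a0 ab b1 ba; apply: le_trans (gM lam _ _ lam0 a0 ab b1) _.
apply: ler_wpM2r; first by rewrite invr_ge0.
by rewrite lerD2r; apply: ler_wpM2l => //; exact: ltW.
Qed.

Lemma smooth_derive1n_continuous phi k : smooth phi -> continuous (derive1n k phi).
Proof.
move=> sphi; have [c _] := sphi (nseq k (1 : R)).
suff -> : derive1n k phi = foldr (fun w h => 'D_w h) phi (nseq k (1 : R)) by [].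
elim: {c} k => [//|k IH].
by rewrite derive1nS IH /=; apply/funext => x; rewrite derive1E.
Qed.

Lemma is_wderiv_ae_eq k f1 f2 g : measurable_fun setT f1 -> measurable_fun setT f2 ->
  {ae mu, forall x, f1 x = f2 x} -> is_wderiv k f2 g -> is_wderiv k f1 g.
Proof.
move=> m1 m2 E wg phi tphi; rewrite -(wg phi tphi); congr fine.
have mphi : measurable_fun setT (derive1n k phi).
  apply: continuous_measurable_fun; apply: smooth_derive1n_continuous.
  by case: tphi.
apply: ae_eq_integral => //.
- by apply/measurable_EFinP; exact: measurable_funM.
- by apply/measurable_EFinP; exact: measurable_funM.
by move: E; apply: filterS; [exact: (ae_filter_ringOfSetsType mu)|move=> x /= -> _].
Qed.

(** The energy depends on the representative u0 only through its class modulo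
    equality almost everywhere, whereas the initial slice of a solution is a
    continuous representative of that class. *)
Lemma energyE_fin f u0 : continuous (cube f) -> (forall x, f (x + 1) = f x) ->
  {ae mu, forall x, f x = u0 x} -> Hper 2 (cube u0) ->
  exists2 Q : R, 0 <= Q & energyE f = Q%:E.
Proof.
move=> cf pf E [[[mu0 _] hk] _].
suff H : Hper 2 (cube f).
  have [|_ [g [lg _ Eg]]] := @energyE_wderiv2 f.
    rewrite /energyE asboolT//.
    have [[_ /(_ 2%N isT)/wderivP[lg wg]] _] := H.
    rewrite -(fineK (_ : (\int[mu]_(x in _) _)%E \is a fin_num)) ?ltry//.
    apply: integrable_fin_num => //; apply: integrableZlR => //.
    exact: L2loc_sqr_integrable.
  exists (6^-1 * \int[mu]_(x in `[0, 1]) (g x ^+ 2)) => //.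
  by rewrite mulr_ge0 ?invr_ge0//; apply: Rintegral_ge0 => x _; exact: sqr_ge0.
split; last by apply: aeW => x; rewrite /cube pf.
split; first exact: continuous_L2loc.
move=> k k2; have [g lg wg] := hk k k2; exists g => //.
apply: is_wderiv_ae_eq wg => //; first exact: continuous_measurable_fun.
by move: E; apply: filterS; [exact: (ae_filter_ringOfSetsType mu)|move=> x; rewrite /cube => ->].
Qed.

End energy2.

(** * Continuous functions of time and space *)

Section plane.
Variable R : realType.
Local Notation mu := (@lebesgue_measure R).
Local Notation mu2 := (mu \x mu)%E.
Implicit Types F G : R * R -> R.

(** An open set of the plane is a countable union of squares with rational centres
    and radii, each of which is measurable for the product sigma-algebra. *)
Lemma plane_open_measurable (U : set (R * R)) : open U -> measurable U.
Proof.
move=> oU.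
pose box (q : rat * rat * rat) : set (R * R) :=
  ball (ratr q.1.1 : R) (ratr q.2 : R) `*` ball (ratr q.1.2 : R) (ratr q.2 : R).
pose B q := if `[< box q `<=` U >] then box q else set0.
have -> : U = \bigcup_q B q.
  apply/seteqP; split=> [[t h] Up|p [q _]]; last first.
    by rewrite /B; case: asboolP => // h /h.
  have [e /= e0 he] : exists2 e, 0 < e & ball ((t, h) : R * R) e `<=` U.
    by apply/nbhs_ballP; apply: open_nbhs_nbhs.
  have [r /andP[r1 r2]] : exists r : rat, e / 3 < ratr r < e / 2.
    have /rat_in_itvoo[r] : e / 3 < e / 2 by lra.
    by rewrite in_itv/=; exists r.
  have H (x : R) : exists c : rat, x - e / 3 < ratr c < x + e / 3.
    have /rat_in_itvoo[c] : x - e / 3 < x + e / 3 by lra.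
    by rewrite in_itv/=; exists c.
  have [c1 /andP[a1 b1]] := H t; have [c2 /andP[a2 b2]] := H h.
  exists ((c1, c2), r) => //; rewrite /B ifT.
    by rewrite /box; split; rewrite /ball/= ltr_norml; apply/andP; split; lra.
  apply/asboolP => -[t' h'] [/=]; rewrite /ball/= !ltr_norml.
  move=> /andP[? ?] /andP[? ?]; apply: he; split;
    rewrite /ball/= ltr_norml; apply/andP; split; lra.
apply: countable_bigcupT_measurable; first exact: countableP.
move=> q; rewrite /B; case: ifP => _; last exact: measurable0.
by apply: measurableX; exact: measurable_ball.
Qed.

Lemma plane_continuous_measurable F : continuous F -> measurable_fun setT F.
Proof.
move=> /continuousP cF; apply: (measurability _ (RGenOpens.measurableE R)).
move=> _ [_ [a [b ->] <-]]; rewrite setTI.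
by apply: plane_open_measurable; apply: cF; exact: interval_open.
Qed.

(** Heine on a rectangle; only one of the two points is required to lie in it. *)
Lemma plane_uniform_continuity F (a b c d e : R) : continuous F -> 0 < e ->
  exists2 r, 0 < r & forall t t' h h', a <= t <= b -> c <= h <= d ->
    `|t - t'| < r -> `|h - h'| < r -> `|F (t, h) - F (t', h')| < e.
Proof.
move=> cF e0.
have : compact (`[a, b]%classic `*` `[c, d]%classic : set (R * R)).
  by apply: compact_setX; exact: segment_compact.
move=> /compact_near_coveringP.
move=> /(_ R (0 : R)^'+ (fun r p => forall q, ball p r q -> `|F p - F q| < e) _).
case.
  move=> p _; have e20 : 0 < e / 2 by rewrite divr_gt0.
  have /cvgrPdist_lt/(_ _ e20)/nbhs_ballP[r /= r0 hr] := cF p.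
  have r20 : 0 < r / 2 by rewrite divr_gt0.
  exists (ball p (r / 2), [set s | 0 < s < r / 2]) => /=.
    split; first exact: nbhsx_ballx.
    near=> s; rewrite /=; apply/andP; split; near: s;
      [exact: nbhs_right_gt|exact: nbhs_right_lt].
  move=> [p' s] /= [pp' /andP[s0 sr]] q p'q.
  have h1 : `|F p - F p'| < e / 2.
    by apply: hr; apply: le_ball pp'; lra.
  have h2 : `|F p - F q| < e / 2.
    apply: hr; have -> : r = r / 2 + r / 2 by lra.
    by apply: ball_triangle pp' _; apply: le_ball p'q; exact: ltW.
  rewrite -(subrKA (F p)) (le_lt_trans (ler_normD _ _))// distrC; lra.
move=> r /= r0 hr; exists (r / 2); first by rewrite divr_gt0.
move=> t t' h h' ht hh tt hh'.
apply: (hr (r / 2)) => //=.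
- by rewrite sub0r normrN gtr0_norm ?divr_gt0//; lra.
- by rewrite divr_gt0.
Unshelve. all: by end_near. Qed.

(** Composing with this projection turns a function continuous within a closed strip
    into a continuous function on the plane. *)
Definition clamp (T : R) (p : R * R) : R * R := (Num.max 0 (Num.min p.1 T), p.2).

Lemma clampE (T t h : R) : 0 <= t <= T -> clamp T (t, h) = (t, h).
Proof. by move=> /andP[t0 tT]; rewrite /clamp/= min_l// max_r. Qed.

Lemma clamp_strip (T : R) p : 0 <= T -> closed_strip T (clamp T p).
Proof.
move=> T0; split => //=; rewrite in_itv/= le_max lexx/=.
by rewrite ge_max T0 ge_min lexx orbT.
Qed.

Lemma clamp_continuous (T : R) : continuous (clamp T).
Proof.
have h : continuous (fun p : R * R => Num.max 0 (Num.min p.1 T)).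
  have cm : continuous (fun p : R * R => Num.min p.1 T).
    move=> q; apply: (@continuous_min R (R * R)%type fst (cst T) q).
      exact: cvg_fst.
    exact: cvg_cst.
  move=> q; apply: (@continuous_max R (R * R)%type (cst 0) (fun p => Num.min p.1 T) q).
    exact: cvg_cst.
  exact: cm.
move=> p; rewrite /continuous_at /clamp.
exact: (cvg_pair (h p) (@cvg_snd _ _ (nbhs p.1) (nbhs p.2) _)).
Qed.

Lemma within_clamp_continuous F (T : R) : 0 <= T ->
  {within closed_strip T, continuous F} -> continuous (fun p => F (clamp T p)).
Proof.
move=> T0 cF p.
have Aq := clamp_strip p T0.
have h := cF (clamp T p).
apply: (@cvg_comp _ _ _ (clamp T) F (nbhs p)
  (nbhs (clamp T p : subspace (closed_strip T))) _ _ h).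
apply/(subspace_cvgP _ Aq) => U hU.
have hU' : \forall x \near p, closed_strip T (clamp T x) -> U (clamp T x).
  exact: (@clamp_continuous T p _ hU).
suff : \forall x \near p, U (clamp T x) by [].
by apply: filterS hU' => q; apply; exact: clamp_strip.
Qed.

End plane.

(** * Fubini for real-valued integrals *)

Section fubini.
Context d1 d2 (T1 : measurableType d1) (T2 : measurableType d2) (R : realType).
Variables (m1 : {sigma_finite_measure set T1 -> \bar R})
  (m2 : {sigma_finite_measure set T2 -> \bar R}).
Variable f : T1 * T2 -> R.
Hypothesis i : (m1 \x m2)%E.-integrable setT (EFin \o f).

Lemma Rintegral_fubini1 :
  \int[(m1 \x m2)%E]_p f p = \int[m1]_t \int[m2]_h f (t, h) /\
  m1.-integrable setT (EFin \o (fun t => \int[m2]_h f (t, h))).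
Proof.
have mF := measurable_fubini_F i.
have mf : measurable_fun setT (EFin \o (fun t => \int[m2]_h f (t, h))).
  by apply/measurable_EFinP; apply: measurableT_comp mF; exact: fine_measurable.
have E : ae_eq m1 setT (fubini_F m2 (EFin \o f))
    (EFin \o (fun t => \int[m2]_h f (t, h))).
  apply: filterS (ae_integrable1 i) => t it _.
  by rewrite /= /Rintegral fineK//; exact: integrable_fin_num.
split.
  rewrite {1}/Rintegral -(integral12_prod_meas1 i); congr fine.
  exact: ae_eq_integral.
apply/integrableP; split => //.
have /integrableP[_] := integrable_fubini_F i; congr (_ < _)%E.
apply: ae_eq_integral => //; do ?exact: measurableT_comp.
by apply: filterS E => t /= h /h ->.
Qed.

(** The inner integral is taken in the reals, hence agrees with the extended one
    only for almost every section. *)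
Lemma Rintegral_fubini2 :
  \int[(m1 \x m2)%E]_p f p = \int[m2]_h \int[m1]_t f (t, h) /\
  m2.-integrable setT (EFin \o (fun h => \int[m1]_t f (t, h))).
Proof.
have mF := measurable_fubini_G i.
have mf : measurable_fun setT (EFin \o (fun h => \int[m1]_t f (t, h))).
  by apply/measurable_EFinP; apply: measurableT_comp mF; exact: fine_measurable.
have E : ae_eq m2 setT (fubini_G m1 (EFin \o f))
    (EFin \o (fun h => \int[m1]_t f (t, h))).
  apply: filterS (ae_integrable2 i) => t it _.
  by rewrite /= /Rintegral fineK//; exact: integrable_fin_num.
split.
  rewrite {1}/Rintegral -(integral21_prod_meas1 i); congr fine.
  exact: ae_eq_integral.
apply/integrableP; split => //.
have mi := measurable_int _ i.
apply: (@le_lt_trans _ _ (\int[m2]_y \int[m1]_x `|(f (x, y))%:E|)%E); last first.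
  by have := i; rewrite integrable21ltyP.
apply: ae_ge0_le_integral => //; first exact: measurableT_comp.
- by move=> y _; exact: integral_ge0.
- apply: (measurable_fun_fubini_tonelli_G (abse \o (EFin \o f))).
    exact: measurableT_comp.
  by move=> x /=.
apply: filterS2 E (ae_integrable2 i) => y Ey /integrableP[my _] _.
rewrite -(Ey I); exact: le_abse_integral.
Qed.

Lemma Rintegral_fubini2_mulr (g : T2 -> R) : measurable_fun setT g ->
  (m1 \x m2)%E.-integrable setT (EFin \o (fun p => f p * g p.2)) ->
  \int[(m1 \x m2)%E]_p (f p * g p.2) = \int[m2]_h (\int[m1]_t f (t, h) * g h).
Proof.
move=> mg ig.
have mS : measurable_fun setT (fun h => \int[m1]_t f (t, h)).
  by apply/measurable_EFinP; exact: measurable_int Rintegral_fubini2.2.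
rewrite {1}/Rintegral -(integral21_prod_meas1 ig); congr fine.
apply: ae_eq_integral => //.
- exact: (measurable_fubini_G ig).
- by apply/measurable_EFinP; exact: measurable_funM.
apply: filterS (ae_integrable2 i) => h ih _.
rewrite /fubini_G -RintegralZr// /Rintegral fineK//; apply: integrable_fin_num => //.
exact: integrableZrR.
Qed.

End fubini.

(** * Smooth plateaus on the line and on the circle *)

Section tools.
Variable R : realType.
Local Notation mu := (@lebesgue_measure R).
Local Notation mu2 := (mu \x mu)%E.
Implicit Types f : R * R -> R.

Lemma Rintegral_fubini_box f (A B : set R) : measurable A -> measurable B ->
  mu2.-integrable (A `*` B) (EFin \o f) ->
  \int[mu2]_(p in A `*` B) f p = \int[mu]_(t in A) \int[mu]_(h in B) f (t, h).
Proof.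
move=> mA mB i.
have i' : mu2.-integrable setT (EFin \o (f \_ (A `*` B))).
  have := i; rewrite integrable_mkcond; last exact: measurableX.
  by rewrite restrict_EFin.
rewrite Rintegral_mkcond (Rintegral_fubini1 i').1 [RHS]Rintegral_mkcond.
apply: eq_Rintegral => t _; rewrite patchE; case: ifPn => tA.
  rewrite [RHS]Rintegral_mkcond; apply: eq_Rintegral => h _.
  by rewrite !patchE in_setX tA.
rewrite /Rintegral integral0_eq// => h _.
by rewrite patchE in_setX (negbTE tA).
Qed.

(** Smooth approximation of the indicator of ]a, b[ supported in [a, b]: the second
    step is shifted to the left by the width of the transition. *)
Definition plateau (k a b x : R) := scaled_step k a x - scaled_step k (b - k^-1) x.

Lemma plateau_Cinf k a b : Cinf (plateau k a b).
Proof. by apply: CinfB; exact: scaled_step_Cinf. Qed.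

Lemma plateau_left k a b x : 0 < k -> a <= b - k^-1 -> x <= a -> plateau k a b x = 0.
Proof. by move=> k0 ab xa; rewrite /plateau !scaled_step_0 ?subrr// (le_trans xa). Qed.

Lemma plateau_right k a b x : 0 < k -> a <= b - k^-1 -> b <= x -> plateau k a b x = 0.
Proof. by move=> k0 ab xa; rewrite /plateau !scaled_step_1 ?subrr//; lra. Qed.

Lemma plateau_bound k a b x : `|plateau k a b x| <= 1.
Proof. exact: step_diff_bound. Qed.

Lemma plateau_derive1 k a b :
  derive1 (plateau k a b) = fun x => pulse k a x - pulse k (b - k^-1) x.
Proof. by apply: derive1_eq => x; apply: is_deriveB; exact: scaled_step_derive. Qed.

Lemma plateau_cvg (K a b x : R) : 0 <= K -> a < b ->
  plateau (zoom K n) a b x @[n --> \oo] --> ((a < x < b)%R%:R : R).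
Proof.
move=> K0 ab.
have -> : (a < x < b)%R%:R = (a < x)%R%:R - (b <= x)%R%:R :> R.
  have [bx|xb] := leP b x; last by rewrite andbT subr0.
  by rewrite andbF (lt_le_trans ab bx) subrr.
apply: cvgB; first exact: scaled_step_cvg.
have k0 n := zoom_gt0 n K0.
have [bx|xb] := leP b x.
  by apply: cvg_near_cst; near=> n; apply/eqP; rewrite scaled_step_1//; lra.
apply: cvg_near_cst; near=> n; apply/eqP; rewrite scaled_step_0//.
suff : (zoom K n)^-1 < b - x by lra.
by near: n; apply: zoom_near => //; lra.
Unshelve. all: by end_near. Qed.

(** Smooth 1-periodic approximation of the indicator of ]m - r, m + r[ on [0, 1].
    Periodicity is for free because the distance to m is measured by a cosine. *)
Definition cplateau (k m r h : R) := step (k * (cos (pi *+ 2 * (h - m)) - cos (pi *+ 2 * r))).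

Lemma cplateau_Cinf k m r : Cinf (cplateau k m r).
Proof.
apply: (@Cinf_comp _ _ (fun h => k * (cos (pi *+ 2 * (h - m)) - cos (pi *+ 2 * r)))).
  exact: step_Cinf.
apply: CinfM; first exact: Cinf_cst.
apply: CinfB; last exact: Cinf_cst.
exact: (@Cinf_comp _ cos (fun h => pi *+ 2 * (h - m)) (@Cinf_cos R) (Cinf_aff _ _)).
Qed.

Lemma cplateau_periodic k m r h : cplateau k m r (h + 1) = cplateau k m r h.
Proof.
rewrite /cplateau; congr (step (_ * (_ - _))).
by rewrite addrAC mulrDr mulr1 cosD2pi.
Qed.

Lemma cplateau_bound k m r h : `|cplateau k m r h| <= 1.
Proof. by rewrite ger0_norm ?step_ge0 ?step_le1. Qed.

(** The cosine decreases with the distance to m as long as that distance is at most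
    half a period; beyond, it increases again but stays under cos(2 pi r). *)
Lemma cplateau_cond (m r h : R) : 0 < r -> 0 < m - r -> m + r < 1 -> 0 <= h <= 1 ->
  (cos (pi *+ 2 * r) < cos (pi *+ 2 * (h - m))) = (`|h - m| < r).
Proof.
move=> r0 mr1 mr2 /andP[h0 h1].
have p0 : 0 < pi :> R := pi_gt0 R.
have pr y : 0 <= y <= 2^-1 -> pi *+ 2 * y \in `[0 : R, pi].
  by move=> /andP[? ?]; rewrite in_itv/= mulr2n; apply/andP; split; nra.
have -> : cos (pi *+ 2 * (h - m)) = cos (pi *+ 2 * `|h - m|).
  by rewrite -cos_norm normrM ger0_norm// mulrn_wge0// ltW.
have d1 : `|h - m| < 1 - r by rewrite ltr_norml; apply/andP; split; lra.
have d0 : 0 <= `|h - m| by [].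
move: (`|h - m|) d0 d1 => d d0 d1.
have r2 : r < 2^-1 by lra.
have P2 : 0 < (pi : R) *+ 2 by rewrite mulr2n; lra.
have [dh|dh] := leP d 2^-1.
  rewrite ltr_cos ?pr// ?ltr_pM2l//; first by apply/andP; split; lra.
  by apply/andP; split; lra.
have -> : cos (pi *+ 2 * d) = cos (pi *+ 2 * (1 - d)).
  by rewrite -cosN -(cosD2pi (- _)); congr cos; ring.
rewrite ltr_cos ?pr// ?ltr_pM2l//; last 2 first.
- by apply/andP; split; lra.
- by apply/andP; split; lra.
rewrite [RHS]lt_gtF; last lra.
by apply/negbTE; rewrite -leNgt; lra.
Qed.

Lemma cplateau_cvg (K m r h : R) : 0 <= K -> 0 < r -> 0 < m - r -> m + r < 1 -> 0 <= h <= 1 ->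
  cplateau (zoom K n) m r h @[n --> \oo] --> ((m - r < h < m + r)%R%:R : R).
Proof.
move=> K0 r0 mr1 mr2 h01.
have -> : (m - r < h < m + r) = (`|h - m| < r).
  by rewrite ltr_norml; apply/idP/idP => /andP[? ?]; apply/andP; split; lra.
rewrite -cplateau_cond// -subr_gt0.
have := @scaled_step_cvg R K 0 (cos (pi *+ 2 * (h - m)) - cos (pi *+ 2 * r)) K0.
by rewrite /scaled_step /cplateau; under eq_fun do rewrite subr0.
Qed.

End tools.

(** * The continuous representative and the flux *)

Section spacetime.
Variable R : realType.
Local Notation mu := (@lebesgue_measure R).
Local Notation mu2 := (mu \x mu)%E.

(** a^3 - b^3 = (a - b)^3 + 3 a b (a - b), where the last term is non-negative when
    b <= a. So the cube root is Hoelder continuous of exponent 1/3. *)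
Lemma dist_cube (a b : R) : 0 <= a -> 0 <= b -> `|a - b| ^+ 3 <= `|a ^+ 3 - b ^+ 3|.
Proof.
wlog : a b / b <= a => [H a0 b0|ba a0 b0].
  have [ba|/ltW ab] := leP b a; first exact: H.
  by rewrite distrC (distrC (a ^+ 3)); exact: H.
have E : a ^+ 3 - b ^+ 3 = (a - b) ^+ 3 + 3 * (a * b * (a - b)) by ring.
have h : 0 <= a * b * (a - b) by rewrite !mulr_ge0// subr_ge0.
have h' : 0 <= (a - b) ^+ 3 by rewrite exprn_ge0// subr_ge0.
by rewrite E (ger0_norm (_ : 0 <= a - b)) ?subr_ge0// ger0_norm; lra.
Qed.

Lemma continuous_cube_root (F : R * R -> R) : (forall p, 0 <= F p) ->
  continuous (fun p => F p ^+ 3) -> continuous F.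
Proof.
move=> F0 cF p; apply/cvgrPdist_lt => e e0.
have e3 : 0 < e ^+ 3 by rewrite exprn_gt0.
have /cvgrPdist_lt/(_ _ e3) := cF p; apply: filterS => q h.
rewrite -(@ltr_pXn2r _ 3) ?nnegrE ?(ltW e0)//.
exact: le_lt_trans (dist_cube _ _) h.
Qed.

Definition box (T : R) : set (R * R) := `[0, T] `*` `[0, 1].

Lemma measurable_box T : measurable (box T).
Proof. by apply: measurableX; exact: measurable_itv. Qed.

Lemma box_lty T : (mu2 (box T) < +oo)%E.
Proof.
rewrite product_measure1E// lte_mul_pinfty//; last exact: mu_itv_lty.
by rewrite ge0_fin_numE//; exact: mu_itv_lty.
Qed.

Lemma measurable_tens (f g : R -> R) D : continuous f -> continuous g ->
  measurable_fun D (tens f g).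
Proof.
move=> cf cg; apply: measurable_funTS; apply: plane_continuous_measurable => p.
apply: cvgM.
  by apply: (@continuous_comp _ _ _ fst f); [exact: cvg_fst|exact: cf].
by apply: (@continuous_comp _ _ _ snd g); [exact: cvg_snd|exact: cg].
Qed.

Variables (T : R) (u0 : R -> R) (u ut w : R * R -> R).
Hypothesis T0 : 0 < T.
Hypothesis ws : weak_solution_with T u0 u ut w.

(** The solution, frozen outside of [0, T]: it is continuous on the whole plane. *)
Definition uc p := u (clamp T p).

Lemma ucE t h : 0 <= t <= T -> uc (t, h) = u (t, h).
Proof. by move=> tT; rewrite /uc clampE. Qed.

Lemma uc_ge0 p : 0 <= uc p.
Proof.
rewrite /uc; case: (clamp T p) (clamp_strip p (ltW T0)) => t h [/=].
by rewrite in_itv/= => tT _; exact: (ws_ge0 ws).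
Qed.

Lemma uc_periodic t h : uc (t, h + 1) = uc (t, h).
Proof.
rewrite /uc /clamp/=; apply: (ws_periodic ws).
by have [] := clamp_strip (t, h) (ltW T0); rewrite /= in_itv.
Qed.

Lemma uc_cont : continuous uc.
Proof.
apply: continuous_cube_root; first exact: uc_ge0.
exact: (within_clamp_continuous (ltW T0) (ws_continuous ws)).
Qed.

Lemma uc_neq0_measurable : measurable [set p | uc p != 0].
Proof.
apply: plane_open_measurable.
have /continuousP/(_ [set x : R | x != 0]) := uc_cont; apply.
rewrite (_ : [set x : R | x != 0] = ~` [set 0]).
  by apply: closed_openC; exact: closed_eq.
by apply/seteqP; split => x /= /eqP.
Qed.

Lemma PTE : PT T u = (`]0, T[ `*` `]0, 1[) `&` [set p | uc p != 0].
Proof.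
apply/seteqP; split => -[t h] [[/= tT hI] up]; split => //=.
  by rewrite ucE; [exact/eqP|move: tT; rewrite in_itv/= => /andP[? ?]; rewrite !ltW].
by move: up; rewrite ucE; [move/eqP|move: tT; rewrite in_itv/= => /andP[? ?]; rewrite !ltW].
Qed.

Lemma PTperE : PTper T u = (`]0, T[ `*` setT) `&` [set p | uc p != 0].
Proof.
apply/seteqP; split => -[t h] [[/= tT hI] up]; split => //=.
  by rewrite ucE; [exact/eqP|move: tT; rewrite in_itv/= => /andP[? ?]; rewrite !ltW].
by move: up; rewrite ucE; [move/eqP|move: tT; rewrite in_itv/= => /andP[? ?]; rewrite !ltW].
Qed.

Lemma measurable_PT : measurable (PT T u).
Proof.
rewrite PTE; apply: measurableI; last exact: uc_neq0_measurable.
by apply: measurableX; exact: measurable_itv.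
Qed.

Lemma measurable_PTper : measurable (PTper T u).
Proof.
rewrite PTperE; apply: measurableI; last exact: uc_neq0_measurable.
by apply: measurableX; [exact: measurable_itv|exact: measurableT].
Qed.

Lemma PT_box : PT T u `<=` box T.
Proof.
move=> [t h] [[/=]]; rewrite /box/= !in_itv/= => /andP[? ?] /andP[? ?] _.
by split; apply/andP; split; exact: ltW.
Qed.

(** In the weak formulation, u_t = - flux. *)
Definition flux : R * R -> R := (fun p => u p ^+ 2 * w p) \_ (PT T u).

Lemma flux_measurable : measurable_fun setT flux.
Proof.
apply/(measurable_restrictT _ measurable_PT); exact: (ws_flux_meas ws).
Qed.

Lemma flux_sqr : (\int[mu2]_(p in box T) (flux p ^+ 2)%:E =
  \int[mu2]_(p in PT T u) ((u p ^+ 2 * w p) ^+ 2)%:E)%E.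
Proof.
rewrite integral_mkcond [RHS]integral_mkcond; apply: eq_integral => p _.
rewrite !patchE /flux; case: ifPn => pB.
  by rewrite patchE; case: ifP => // _; rewrite expr0n.
case: ifPn => // pP; exfalso; move: pB; rewrite notin_setE; apply.
by apply: PT_box; rewrite inE in pP.
Qed.

(** The energy inequality bounds the square integral of the flux by the initial
    energy. *)
Lemma flux_young (D : set (R * R)) (Q lam : R) : measurable D -> D `<=` box T ->
  0 < lam -> energyE (slice u 0) = Q%:E ->
  mu2.-integrable D (EFin \o flux) /\
  \int[mu2]_(p in D) `|flux p| <= (lam * fine (mu2 D) + Q / lam) / 2.
Proof.
move=> mD DB lam0 E.
have mf D' : measurable_fun D' flux by exact: measurable_funTS flux_measurable.
apply: Rintegral_le_young => //.
  apply: le_lt_trans (box_lty T); apply: le_measure => //; rewrite inE//.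
  exact: measurable_box.
  exact: mf.
apply: (@le_trans _ _ (\int[mu2]_(p in box T) (flux p ^+ 2)%:E)%E).
  apply: ge0_subset_integral => //; first exact: measurable_box.
    by apply/measurable_EFinP; apply: measurable_funX; exact: mf.
  by move=> p _; rewrite lee_fin sqr_ge0.
rewrite flux_sqr -E; apply: le_trans (ws_energyE ws).
by rewrite leeDr// energyE_ge0.
Qed.

Lemma flux_integrable (Q : R) : energyE (slice u 0) = Q%:E ->
  mu2.-integrable (box T) (EFin \o flux).
Proof.
by move=> E; have [] := flux_young (measurable_box T) (fun p => id) ltr01 E.
Qed.

Lemma ut_measurable : measurable_fun (box T) ut.
Proof.
have [m _ _] := ws_ut_L2 ws; apply: measurable_funS m.
- by apply: measurableX; [exact: measurable_itv|exact: measurableT].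
- by move=> [t h] [].
Qed.

Lemma ut_integrable : mu2.-integrable (box T) (EFin \o ut).
Proof.
have [_ _ i2] := ws_ut_L2 ws.
have f : (\int[mu2]_(p in box T) (ut p ^+ 2)%:E)%E \is a fin_num.
  by rewrite ge0_fin_numE//; apply: integral_ge0 => p _; rewrite lee_fin sqr_ge0.
have h : (\int[mu2]_(p in box T) (ut p ^+ 2)%:E <=
   (fine (\int[mu2]_(p in box T) (ut p ^+ 2)%:E))%:E)%E by rewrite fineK.
have [|||//] := @Rintegral_le_young _ _ _ mu2 (box T) ut 1 _ _ _ ltr01 _ h.
- exact: measurable_box.
- exact: box_lty.
- exact: ut_measurable.
Qed.

End spacetime.

(** * Convergence of mollified time slices *)

Section slices.
Variable R : realType.
Local Notation mu := (@lebesgue_measure R).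
Local Notation mu2 := (mu \x mu)%E.
Implicit Types (F : R * R -> R) (chi : R -> R).

Lemma slice_continuous F t : continuous F -> continuous (fun h => F (t, h)).
Proof.
move=> cF h; apply: (@continuous_comp _ _ _ (fun h => (t, h)) F); last exact: cF.
have h1 : (fun=> t) x @[x --> nbhs h] --> nbhs t by exact: cvg_cst.
have h2 : (fun x : R => x) x @[x --> nbhs h] --> nbhs h by exact: cvg_id.
exact: (cvg_pair h1 h2).
Qed.

Lemma plane_integrable_compact F (a b c d : R) : continuous F ->
  (forall t h, ~ (a <= t <= b /\ c <= h <= d) -> F (t, h) = 0) ->
  mu2.-integrable setT (EFin \o F).
Proof.
move=> cF F0.
have mB : measurable (`[a, b]%classic `*` `[c, d]%classic : set (R * R)).
  by apply: measurableX; exact: measurable_itv.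
have i : mu2.-integrable (`[a, b] `*` `[c, d]) (EFin \o F).
  apply: measurable_bounded_integrable => //.
  - rewrite /= product_measure1E// lte_mul_pinfty//; last exact: mu_itv_lty.
    by rewrite ge0_fin_numE//; exact: mu_itv_lty.
  - by apply: measurable_funTS; exact: plane_continuous_measurable.
  have : compact (F @` (`[a, b] `*` `[c, d])).
    apply: continuous_compact; first exact: continuous_subspaceT.
    by apply: compact_setX; exact: segment_compact.
  move=> /compact_bounded[M [Mr hM]]; exists M; split => // x Mx p pB.
  by apply: (hM x Mx); exists p.
have := i; rewrite integrable_mkcond//; apply: eq_integrable => // -[t h] _.
rewrite patchE; case: ifPn => //=; rewrite notin_setE => /= B.
by rewrite F0// => -[h1 h2]; apply: B; rewrite !in_itv.
Qed.

Lemma slice_integrable F chi (c d t : R) : continuous F -> continuous chi ->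
  (forall h, h < c -> chi h = 0) -> (forall h, d < h -> chi h = 0) ->
  mu.-integrable setT (EFin \o (fun h => F (t, h) * chi h)).
Proof.
move=> cF cchi chic chid; apply: (@integrable_compact_support _ _ _ c d) => //.
by apply: continuous_integrable_itv; exact: slice_continuous.
Qed.

(** Stated with the factor chi of absolute value at most 1, so that it applies
    uniformly along the plateaus. *)
Lemma slice_dist F chi (c d t t' e : R) : continuous F -> continuous chi -> c <= d ->
  (forall h, h < c -> chi h = 0) -> (forall h, d < h -> chi h = 0) ->
  (forall h, `|chi h| <= 1) ->
  (forall h, c <= h <= d -> `|F (t, h) - F (t', h)| <= e) ->
  `|\int[mu]_h (F (t, h) * chi h) - \int[mu]_h (F (t', h) * chi h)| <= e * (d - c).
Proof.
move=> cF cchi cd chic chid chi1 Fe.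
have i s := slice_integrable s cF cchi chic chid.
rewrite -RintegralB//.
rewrite (@Rintegral_compact_support _ _ c d); last 2 first.
- by move=> h hc; rewrite chic// !mulr0 subrr.
- by move=> h hc; rewrite chid// !mulr0 subrr.
have iB : mu.-integrable `[c, d]
    (EFin \o (fun h => F (t, h) * chi h - F (t', h) * chi h)).
  apply: (integrableS measurableT) => //; exact: integrableBR.
apply: le_trans (le_normr_Rintegral _ iB) _ => //.
apply: (@le_trans _ _ (\int[mu]_(h in `[c, d]) e)); last first.
  rewrite Rintegral_cst//= lebesgue_measure_itv/= lte_fin.
  have [_|dc] := ltP c d; first by rewrite -EFinB.
  by rewrite (_ : d - c = 0) ?mulr0//; lra.
apply: le_Rintegral => //.
- exact: integrable_norm.
- by apply: continuous_integrable_itv => x; exact: cvg_cst.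
move=> h /=; rewrite in_itv/= => hcd.
rewrite -mulrBl normrM; apply: le_trans (Fe h hcd).
by rewrite ler_piMr.
Qed.

Lemma slice_int_continuous F chi (c d : R) : continuous F -> continuous chi -> c <= d ->
  (forall h, h < c -> chi h = 0) -> (forall h, d < h -> chi h = 0) ->
  (forall h, `|chi h| <= 1) ->
  continuous (fun t => \int[mu]_h (F (t, h) * chi h)).
Proof.
move=> cF cchi cd chic chid chi1 t; apply/cvgrPdist_le => e e0.
have e0' : 0 < e / (d - c + 1) by rewrite divr_gt0//; lra.
have [r r0 hr] := plane_uniform_continuity (t - 1) (t + 1) c d cF e0'.
near=> t'.
have tr : `|t - t'| < r.
  by near: t'; apply/nbhs_ballP; exists r.
apply: le_trans (@slice_dist F chi c d t t' (e / (d - c + 1)) _ _ _ _ _ _ _) _ => //.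
  move=> h hcd; apply: ltW; apply: hr => //.
  - by apply/andP; split; lra.
  - by rewrite subrr normr0.
by rewrite mulrAC ler_pdivrMr ?ler_pM2l//; lra.
Unshelve. all: by end_near. Qed.

Lemma plateau_int_cvg (g : R -> R) (K c d : R) : (d - c)^-1 <= K -> c < d -> continuous g ->
  \int[mu]_h (g h * plateau (zoom K n) c d h) @[n --> \oo] --> \int[mu]_(h in `]c, d[) g h.
Proof.
move=> Kcd cd cg.
have dc : 0 < (d - c)^-1 by rewrite invr_gt0; lra.
have K0 : 0 < K by lra.
have k0 n := zoom_gt0 n (ltW K0).
have k1 n : c <= d - (zoom K n)^-1.
  have := zoom_inv_lt n K0; have : K^-1 <= d - c.
    by rewrite -[leRHS]invrK lef_pV2// posrE.
  by lra.
have -> : \int[mu]_(h in `]c, d[) g h =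
    \int[mu]_(h in `[c, d]) (g h * (c < h < d)%R%:R).
  rewrite Rintegral_mkcond [RHS]Rintegral_mkcond; congr Rintegral.
  apply/funext => x; rewrite !patchE.
  have [xI|xI] := boolP (c < x < d).
    rewrite mem_set/= ?in_itv//= mem_set/=; last first.
      by rewrite in_itv/=; move/andP: xI => [? ?]; apply/andP; split; lra.
    by rewrite mulr1.
  rewrite memNset/= ?in_itv/= ?(negbTE xI)// mulr0.
  by case: ifP.
have E n : \int[mu]_x (g x * plateau (zoom K n) c d x) =
    \int[mu]_(x in `[c, d]) (g x * plateau (zoom K n) c d x).
  apply: Rintegral_compact_support => x xa.
    by rewrite plateau_left ?mulr0// ltW.
  by rewrite plateau_right ?mulr0// ltW.
rewrite (eq_fun E).
apply: (@Rintegral_dct_mul _ _ _ _ _ _ _ _ 1) => //.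
- exact: continuous_integrable_itv.
- move=> n; apply: measurable_funTS; apply: continuous_measurable_fun.
  by apply: Cinf_cont; exact: plateau_Cinf.
- by move=> x _; apply: plateau_cvg => //; exact: ltW.
- by move=> n x _; exact: plateau_bound.
Qed.

(** The pulse concentrates in time near s while the plateau tends to the indicator
    of ]c, d[. The point s_ n moves with n because the pulse at the right end of
    a time plateau starts at s - 1 / zoom K n. *)
Lemma pulse_plateau_cvg F (K c d s : R) (s_ : nat -> R) : (d - c)^-1 <= K -> c < d ->
  continuous F -> (forall n, s - (zoom K n)^-1 <= s_ n <= s) ->
  \int[mu]_t (\int[mu]_h (F (t, h) * plateau (zoom K n) c d h) * pulse (zoom K n) (s_ n) t)
    @[n --> \oo] --> \int[mu]_(h in `]c, d[) F (s, h).
Proof.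
move=> Kcd cd cF hs.
have dc : 0 < (d - c)^-1 by rewrite invr_gt0; lra.
have K0 : 0 < K by lra.
have k0 n := zoom_gt0 n (ltW K0).
have k1 n : c <= d - (zoom K n)^-1.
  have := zoom_inv_lt n K0; have : K^-1 <= d - c.
    by rewrite -[leRHS]invrK lef_pV2// posrE.
  by lra.
pose G n t := \int[mu]_h (F (t, h) * plateau (zoom K n) c d h).
have cb n : continuous (plateau (zoom K n) c d) by apply: Cinf_cont; exact: plateau_Cinf.
have bl n h : h < c -> plateau (zoom K n) c d h = 0 by move=> hc; rewrite plateau_left// ltW.
have br n h : d < h -> plateau (zoom K n) c d h = 0 by move=> hc; rewrite plateau_right// ltW.
have bb n h := plateau_bound (zoom K n) c d h.
have cG n : continuous (G n).
  exact: (slice_int_continuous cF (cb n) (ltW cd) (bl n) (br n) (bb n)).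
have h1 : G n s @[n --> \oo] --> \int[mu]_(h in `]c, d[) F (s, h).
  by apply: plateau_int_cvg => //; exact: slice_continuous.
suff h2 : \int[mu]_t (G n t * pulse (zoom K n) (s_ n) t) - G n s @[n --> \oo] --> (0 : R).
  rewrite -[X in _ --> X]add0r.
  have -> : (fun n => \int[mu]_t (G n t * pulse (zoom K n) (s_ n) t)) =
    (fun n => \int[mu]_t (G n t * pulse (zoom K n) (s_ n) t) - G n s + G n s).
    by apply/funext => n; rewrite subrK.
  exact: cvgD h2 h1.
apply/cvgr0Pnorm_le => e e0.
have e0' : 0 < e / (d - c) by rewrite divr_gt0//; lra.
have [r r0 hr] := plane_uniform_continuity (s - 1) (s + 1) c d cF e0'.
near=> n.
have kr : (zoom K n)^-1 < Num.min r 1.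
  by near: n; apply: zoom_near; [exact: ltW|rewrite lt_min r0/=].
apply: pulse_avg => //.
  by apply: measurable_funTS; exact: continuous_measurable_fun.
move=> t ht.
have -> : e = e / (d - c) * (d - c) by rewrite mulfVK//; lra.
apply: (slice_dist cF (cb n) (ltW cd) (bl n) (br n) (bb n)) => h hcd.
move: kr; rewrite lt_min => /andP[kr kr1].
have /andP[s1 s2] := hs n; have /andP[t1 t2] := ht.
apply: ltW; apply: hr => //.
- by apply/andP; split; lra.
- by rewrite ltr_norml; apply/andP; split; lra.
- by rewrite subrr normr0.
Unshelve. all: by end_near. Qed.

End slices.

(** * The equation on rectangles *)

Section identities.
Variable R : realType.
Local Notation mu := (@lebesgue_measure R).
Local Notation mu2 := (mu \x mu)%E.

Definition rect (a b c d : R) (p : R * R) : R :=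
  (a < p.1 < b)%R%:R * (c < p.2 < d)%R%:R.

Lemma plateau_scale (K a b : R) n : a < b -> (b - a)^-1 <= K ->
  0 < zoom K n /\ a <= b - (zoom K n)^-1.
Proof.
move=> ab Kab.
have ba : 0 < (b - a)^-1 by rewrite invr_gt0; lra.
have K0 : 0 < K by lra.
split; first exact: zoom_gt0 (ltW K0).
have := zoom_inv_lt n K0; have : K^-1 <= b - a.
  by rewrite -[leRHS]invrK lef_pV2// posrE.
by lra.
Qed.

Lemma box_dct (T : R) (X h : R * R -> R) (h_ : nat -> R * R -> R) :
  mu2.-integrable (box T) (EFin \o X) ->
  (forall n, measurable_fun (box T) (h_ n)) ->
  (forall p, box T p -> h_ n p @[n --> \oo] --> h p) ->
  (forall n p, `|h_ n p| <= 1) ->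
  \int[mu2]_(p in box T) (X p * h_ n p) @[n --> \oo] -->
  \int[mu2]_(p in box T) (X p * h p).
Proof.
move=> iX mh hc hb; apply: (@Rintegral_dct_mul _ _ _ _ _ _ _ _ 1) => //.
exact: measurable_box.
Qed.

Lemma tens_plateau_cvg (K a b c d : R) p : 0 <= K -> a < b -> c < d ->
  tens (plateau (zoom K n) a b) (plateau (zoom K n) c d) p @[n --> \oo] --> rect a b c d p.
Proof. by move=> K0 ab cd; apply: cvgM; exact: plateau_cvg. Qed.

Lemma tens_le1 (f g : R -> R) p : (forall x, `|f x| <= 1) -> (forall x, `|g x| <= 1) ->
  `|tens f g p| <= 1.
Proof. by move=> f1 g1; rewrite normrM mulr_ile1. Qed.

Variables (T : R) (u0 : R -> R) (u ut w : R * R -> R) (Q : R).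
Hypothesis T0 : 0 < T.
Hypothesis ws : weak_solution_with T u0 u ut w.
Hypothesis E0 : energyE (slice u 0) = Q%:E.
Local Notation uc := (uc T u).
Local Notation flux := (flux T u w).

(** The weak formulation is tested with a time plateau times a periodic plateau,
    which converge to the indicator of the rectangle. *)
Lemma ut_flux_rect (a b c d : R) : a < b -> 0 < c -> c < d -> d < 1 ->
  \int[mu2]_(p in box T) (ut p * rect a b c d p) +
  \int[mu2]_(p in box T) (flux p * rect a b c d p) = 0.
Proof.
move=> ab c0 cd d1.
(* Centre and radius of ]c, d[, the parameters of the periodic plateau. *)
pose m := (c + d) / 2; pose r := (d - c) / 2.
have r0 : 0 < r by rewrite /r divr_gt0// subr_gt0.
have mr1 : m - r = c by rewrite /m /r; field.
have mr2 : m + r = d by rewrite /m /r; field.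
pose phi n := tens (plateau (zoom 0 n) a b) (cplateau (zoom 0 n) m r).
have mphi n : measurable_fun (box T) (phi n).
  by apply: measurable_tens; apply: Cinf_cont; [exact: plateau_Cinf|exact: cplateau_Cinf].
have bphi n p : `|phi n p| <= 1.
  by apply: tens_le1; [exact: plateau_bound|exact: cplateau_bound].
have cphi p : box T p -> phi n p @[n --> \oo] --> rect a b c d p.
  move=> [/=]; rewrite !in_itv/= => _ h01; apply: cvgM; first exact: plateau_cvg.
  by rewrite -mr1 -mr2; apply: cplateau_cvg; rewrite ?mr1 ?mr2.
have iut := ut_integrable ws.
have ifl := flux_integrable T0 ws E0.
have h1 := box_dct iut mphi cphi bphi.
have h2 := box_dct ifl mphi cphi bphi.
have h12 : \int[mu2]_(p in box T) (ut p * phi n p) +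
    \int[mu2]_(p in box T) (flux p * phi n p) @[n --> \oo] -->
    \int[mu2]_(p in box T) (ut p * rect a b c d p) +
    \int[mu2]_(p in box T) (flux p * rect a b c d p).
  by apply: cvgD; [exact: h1|exact: h2].
apply/esym; apply: (cvg_unique _ _ h12) => //.
apply: cvg_trans (@cvg_cst _ (0 : R) _ \oo _); apply: near_eq_cvg; near=> n.
have sphi : smooth (phi n).
  by apply: tensor_sum_smooth; apply: TensorSum1; [exact: plateau_Cinf|exact: cplateau_Cinf].
have per t h : 0 <= t <= T -> phi n (t, h + 1) = phi n (t, h).
  by move=> _; rewrite /phi /tens/= cplateau_periodic.
have e1 : \int[mu]_(t in `[0, T]) \int[mu]_(h in `[0, 1]) (phi n (t, h) * ut (t, h)) =
    \int[mu2]_(p in box T) (ut p * phi n p).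
  have i : mu2.-integrable (box T) (EFin \o (fun p => ut p * phi n p)).
    apply: (@integrable_mul_bounded _ _ _ mu2 (box T) ut (phi n) 1).
    - exact: measurable_box.
    - exact: iut.
    - exact: mphi.
    - by move=> p _; exact: bphi.
  rewrite Rintegral_fubini_box//; apply: eq_Rintegral => t _; apply: eq_Rintegral => h _.
  by rewrite mulrC.
have e2 : \int[mu2]_(p in PT T u) (phi n p * (u p ^+ 2 * w p)) =
    \int[mu2]_(p in box T) (flux p * phi n p).
  rewrite Rintegral_mkcond [RHS]Rintegral_mkcond; apply: eq_Rintegral => p _.
  rewrite !patchE /flux; case: ifPn => pP.
    rewrite ifT ?patchE ?pP 1?mulrC//.
    by rewrite inE; apply: (PT_box (u := u)); rewrite -inE.
  by case: ifP => // _; rewrite patchE (negbTE pP) mul0r.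
have W := ws_weak ws sphi per; rewrite e1 e2 in W.
by rewrite W.
Unshelve. all: by end_near. Qed.

(** The derivative of a time plateau is a difference of two pulses, so the
    distributional time derivative, integrated over a rectangle, is an increment
    of u. *)
Lemma ut_rect (a b c d : R) : 0 < a -> a < b -> b < T -> 0 <= c -> c < d -> d <= 1 ->
  \int[mu2]_(p in box T) (ut p * rect a b c d p) =
  \int[mu]_(h in `]c, d[) uc (b, h) - \int[mu]_(h in `]c, d[) uc (a, h).
Proof.
move=> a0 ab bT c0 cd d1.
(* Any offset above both inverses makes the transitions fit in ]a, b[ and ]c, d[. *)
pose K := (b - a)^-1 + (d - c)^-1.
have i1 : 0 < (b - a)^-1 by rewrite invr_gt0; lra.
have i2 : 0 < (d - c)^-1 by rewrite invr_gt0; lra.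
have K1 : (b - a)^-1 <= K by rewrite lerDl ltW.
have K2 : (d - c)^-1 <= K by rewrite lerDr ltW.
have K0 : 0 <= K by rewrite ltW// addr_gt0.
have k0 n : 0 < zoom K n by exact: zoom_gt0.
have kab n : a <= b - (zoom K n)^-1 by have [] := plateau_scale n ab K1.
have kcd n : c <= d - (zoom K n)^-1 by have [] := plateau_scale n cd K2.
pose th n := plateau (zoom K n) a b; pose ps n := plateau (zoom K n) c d.
have cth n : Cinf (th n) by exact: plateau_Cinf.
have cps n : Cinf (ps n) by exact: plateau_Cinf.
have h1 : \int[mu2]_(p in box T) (ut p * tens (th n) (ps n) p) @[n --> \oo] -->
    \int[mu2]_(p in box T) (ut p * rect a b c d p).
  apply: (box_dct (ut_integrable ws)).
  - by move=> n; apply: measurable_tens; exact: Cinf_cont.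
  - by move=> p _; exact: tens_plateau_cvg.
  - by move=> n p; apply: tens_le1; exact: plateau_bound.
have cu := uc_cont T0 ws.
pose A n s := \int[mu]_t (\int[mu]_h (uc (t, h) * ps n h) * pulse (zoom K n) s t).
have h2 : A n (b - (zoom K n)^-1) - A n a @[n --> \oo] -->
    \int[mu]_(h in `]c, d[) uc (b, h) - \int[mu]_(h in `]c, d[) uc (a, h).
  apply: cvgB; apply: pulse_plateau_cvg => // n; apply/andP; split => //.
  - by rewrite gerBl invr_ge0 ltW.
  - by rewrite gerBl invr_ge0 ltW.
apply: (cvg_unique _ h1) => //; apply: cvg_trans h2; apply: near_eq_cvg; near=> n.
have tphi : test_function (open_strip T) (tens (th n) (ps n)).
  apply: (@test_function2 _ _ _ a b c d) => //.
  - by move=> x; exact: plateau_left.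
  - by move=> x; exact: plateau_right.
  - by move=> x; exact: plateau_left.
  - by move=> x; exact: plateau_right.
  - move=> [t h] [/=]; rewrite !in_itv/= => /andP[? ?] _; split => //=.
    by rewrite in_itv/=; apply/andP; split; lra.
have W := ws_ut ws tphi; rewrite iter_dir_t// expr1 mulN1r in W.
have e1 : \int[mu2]_(p in box T) (ut p * tens (th n) (ps n) p) =
    \int[mu2]_(p in open_strip T) (ut p * tens (th n) (ps n) p).
  rewrite Rintegral_mkcond [RHS]Rintegral_mkcond; apply: eq_Rintegral => -[t h] _.
  rewrite !patchE /open_strip /box !in_setX /tens/= mem_setT andbT !mem_setE !in_itv/=.
  have [at0|ta] := leP t a.
    by rewrite /th plateau_left// mul0r mulr0; case: ifP; case: ifP.
  have [bt|tb] := leP b t.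
    by rewrite /th plateau_right// mul0r mulr0; case: ifP; case: ifP.
  have [ch|hc] := leP h c.
    by rewrite /ps plateau_left// !mulr0; case: ifP; case: ifP.
  have [dh|hd] := leP d h.
    by rewrite /ps plateau_right// !mulr0; case: ifP; case: ifP.
  rewrite !ifT//; first by apply/andP; split; lra.
  by apply/andP; split; apply/andP; split; lra.
pose q s := \int[mu2]_p (uc p * tens (pulse (zoom K n) s) (ps n) p).
have iq s : mu2.-integrable setT (EFin \o (fun p => uc p * tens (pulse (zoom K n) s) (ps n) p)).
  apply: (@plane_integrable_compact _ _ s (s + (zoom K n)^-1) c d).
    move=> p; apply: cvgM; first exact: cu.
    apply: tensor_sum_continuous; apply: TensorSum1 => //; exact: pulse_Cinf.
  move=> t h H; rewrite /tens/=.
  have [ts|st] := ltP t s; first by rewrite pulse_left// mul0r mulr0.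
  have [ts|st'] := ltP (s + (zoom K n)^-1) t; first by rewrite pulse_right// mul0r mulr0.
  have [hc|ch] := ltP h c; first by rewrite /ps plateau_left ?mulr0// ltW.
  have [hc|hd] := ltP d h; first by rewrite /ps plateau_right ?mulr0// ltW.
  by exfalso; apply: H; rewrite st st' ch hd.
have qA s : q s = A n s.
  rewrite /q (Rintegral_fubini1 (iq s)).1; apply: eq_Rintegral => t _.
  rewrite -RintegralZr//.
    by apply: eq_Rintegral => h _; rewrite /tens/=; ring.
  apply: (slice_integrable t cu (Cinf_cont (cps n)) (c := c) (d := d)).
  - by move=> h hc; rewrite /ps plateau_left// ltW.
  - by move=> h hc; rewrite /ps plateau_right// ltW.
have e2 : \int[mu2]_(p in open_strip T) (u p * tens (derive1 (th n)) (ps n) p) =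
    A n a - A n (b - (zoom K n)^-1).
  rewrite -!qA /q -RintegralB//.
  rewrite Rintegral_mkcond; apply: eq_Rintegral => -[t h] _.
  rewrite patchE /tens/= /th plateau_derive1.
  rewrite [RHS](_ : _ = uc (t, h) *
    ((pulse (zoom K n) a t - pulse (zoom K n) (b - (zoom K n)^-1) t) * ps n h)); last by ring.
  case: ifPn => [|].
    rewrite /open_strip in_setX mem_setT andbT mem_setE in_itv/= => /andP[t0 tT].
    by rewrite ucE// !ltW.
  rewrite /open_strip in_setX mem_setT andbT mem_setE in_itv/= negb_and -!leNgt => tT.
  have kp : 0 < (zoom K n)^-1 by rewrite invr_gt0.
  case/orP: tT => [t0|tT].
    rewrite !pulse_left//; first by rewrite subrr mul0r mulr0.
      exact: le_lt_trans t0 (lt_le_trans a0 (kab n)).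
    exact: le_lt_trans t0 a0.
  have bt := lt_le_trans bT tT.
  rewrite !pulse_right//; first by rewrite subrr mul0r mulr0.
    by rewrite subrK.
  by apply: le_lt_trans bt; rewrite -lerBrDr.
by rewrite e1; apply: oppr_inj; rewrite -W e2 opprB.
Unshelve. all: by end_near. Qed.

Lemma flux_rect (a b c d : R) : 0 < a -> a < b -> b < T -> 0 < c -> c < d -> d < 1 ->
  \int[mu]_(h in `]c, d[) uc (b, h) - \int[mu]_(h in `]c, d[) uc (a, h) =
  - \int[mu2]_(p in box T) (flux p * rect a b c d p).
Proof.
move=> a0 ab bT c0 cd d1; apply/eqP; rewrite -addr_eq0; apply/eqP.
by rewrite -(ut_rect a0 ab bT (ltW c0) cd (ltW d1)) ut_flux_rect.
Qed.

End identities.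

(** * Time increments of the solution *)

Section flux_test.
Variable R : realType.
Local Notation mu := (@lebesgue_measure R).
Local Notation mu2 := (mu \x mu)%E.

Lemma itv_indicE (c d x : R) : (x \in `]c, d[%classic) = (c < x < d).
Proof. by rewrite mem_setE in_itv. Qed.

Lemma Rintegral_indic_itv (g : R -> R) (c d : R) :
  \int[mu]_(h in `]c, d[) g h = \int[mu]_h (g h * (c < h < d)%R%:R).
Proof.
rewrite Rintegral_mkcond; apply: eq_Rintegral => h _.
by rewrite patchE itv_indicE; case: ifP => _; rewrite ?mulr1 ?mulr0.
Qed.

Lemma measurable_indic_itv (c d : R) :
  measurable_fun setT (fun h : R => (c < h < d)%R%:R : R).
Proof.
have -> : (fun h : R => (c < h < d)%R%:R : R) = \1_(`]c, d[%classic).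
  by apply/funext => h; rewrite indicE itv_indicE.
exact: measurable_indic.
Qed.

(** Lebesgue differentiation at each point of the interval. *)
Lemma ae_zero_open_itv (D : R -> R) (p q : R) :
  measurable_fun setT D -> mu.-integrable setT (EFin \o D) ->
  (forall c d, p < c -> c < d -> d < q -> \int[mu]_(h in `]c, d[) D h = 0) ->
  {ae mu, forall h, p < h < q -> D h = 0}.
Proof.
move=> mD iD D0.
have lD : locally_integrable setT D.
  by apply: integrable_locally_integrable => // a b; apply: integrableS iD.
have := lebesgue_right lD; apply: filterS; first exact: (ae_filter_ringOfSetsType mu).
move=> x hx /andP[px xq].
apply: (cvg_unique _ hx) => //.
apply: cvg_trans (@cvg_cst _ (0 : R) _ \oo _); apply: near_eq_cvg; near=> n.
rewrite -Rintegral_itv_bndo_bndc; last first.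
  by apply: (integrableS measurableT) iD => //.
rewrite D0 ?mulr0//; first by rewrite ltrDl invr_gt0.
have : (n.+1%:R^-1 : R) < q - x by near: n; apply: (cvgr_lt 0 cvg_harmonic); rewrite subr_gt0.
by rewrite ltrBrDl.
Unshelve. all: by end_near. Qed.

Lemma ae_eq_Rintegral (f g : R -> R) : measurable_fun setT f -> measurable_fun setT g ->
  {ae mu, forall x, f x = g x} -> \int[mu]_x f x = \int[mu]_x g x.
Proof.
move=> mf mg E; congr fine; apply: ae_eq_integral => //; try exact/measurable_EFinP.
by move: E; apply: filterS; [exact: (ae_filter_ringOfSetsType mu)|move=> x /= -> _].
Qed.

Variables (T : R) (u0 : R -> R) (u ut w : R * R -> R) (Q : R).
Hypothesis T0 : 0 < T.
Hypothesis ws : weak_solution_with T u0 u ut w.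
Hypothesis E0 : energyE (slice u 0) = Q%:E.
Local Notation uc := (uc T u).
Local Notation flux := (flux T u w).

Lemma flux_out p : ~ (0 < p.2 < 1) -> flux p = 0.
Proof.
move=> p2; rewrite /flux patchE ifF//; apply/negP; rewrite inE => -[[_ /=]].
by rewrite in_itv.
Qed.

Lemma flux_integrableT : mu2.-integrable setT (EFin \o flux).
Proof.
have i := flux_integrable T0 ws E0.
have := i; rewrite integrable_mkcond; last exact: measurable_box.
apply: eq_integrable => // p _; rewrite patchE; case: ifPn => // pB.
rewrite /= /flux patchE ifF//; apply/negP; rewrite inE => /(PT_box (u := u)).
by move: pB; rewrite notin_setE.
Qed.

Lemma flux_boxT (k : R * R -> R) :
  \int[mu2]_(p in box T) (flux p * k p) = \int[mu2]_p (flux p * k p).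
Proof.
rewrite Rintegral_mkcond; apply: eq_Rintegral => p _; rewrite patchE.
case: ifPn => // pB.
rewrite /flux patchE ifF ?mul0r//; apply/negP; rewrite inE => /(PT_box (u := u)).
by move: pB; rewrite notin_setE.
Qed.

(** For almost every h the increment of u in time is minus the time integral of the
    flux, since both sides have the same integrals over all intervals in h;
    hence the identity can be multiplied by any bounded function of h. *)
Lemma flux_test (a b C : R) (f : R -> R) : 0 < a -> a < b -> b < T ->
  measurable_fun setT f -> (forall h, `|f h| <= C) ->
  \int[mu]_(h in `]0, 1[) (f h * (uc (b, h) - uc (a, h))) =
  - \int[mu2]_p (flux p * ((a < p.1 < b)%R%:R * f p.2)).
Proof.
move=> a0 ab bT mf fC.
have cu := uc_cont T0 ws.
have cub s : continuous (fun h => uc (s, h)) by exact: slice_continuous.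
have iF := flux_integrableT.
have mind1 : measurable_fun setT (fun p : R * R => (a < p.1 < b)%R%:R : R).
  by apply: (measurableT_comp (measurable_indic_itv a b)); exact: measurable_fst.
have mind2 (g : R -> R) : measurable_fun setT g -> measurable_fun setT (fun p : R * R => g p.2).
  by move=> mg; apply: (measurableT_comp mg); exact: measurable_snd.
have i1 : mu2.-integrable setT (EFin \o (fun p => flux p * (a < p.1 < b)%R%:R)).
  apply: (@integrable_mul_bounded _ _ _ mu2 setT flux _ 1) => //.
  by move=> p _; case: (_ < _ < _); rewrite ?normr1 ?normr0.
have i2 (g : R -> R) B : measurable_fun setT g -> (forall h, `|g h| <= B) ->
    mu2.-integrable setT (EFin \o (fun p => flux p * (a < p.1 < b)%R%:R * g p.2)).
  move=> mg gB.
  apply: (@integrable_mul_bounded _ _ _ mu2 setT (fun p => flux p * (a < p.1 < b)%R%:R)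
    (fun p => g p.2) B) => //; exact: mind2.
pose S h := \int[mu]_t (flux (t, h) * (a < t < b)%R%:R).
have iS : mu.-integrable setT (EFin \o S) := (Rintegral_fubini2 i1).2.
have mS : measurable_fun setT S by apply/measurable_EFinP; exact: measurable_int iS.
have ES (g : R -> R) B : measurable_fun setT g -> (forall h, `|g h| <= B) ->
    \int[mu2]_p (flux p * ((a < p.1 < b)%R%:R * g p.2)) = \int[mu]_h (S h * g h).
  move=> mg gB.
  rewrite (_ : \int[mu2]_p _ = \int[mu2]_p (flux p * (a < p.1 < b)%R%:R * g p.2)); last first.
    by apply: eq_Rintegral => p _; rewrite mulrA.
  exact: (Rintegral_fubini2_mulr i1 mg (i2 g B mg gB)).
(* The defect of the identity, to be shown to vanish almost everywhere. *)
pose D h := (uc (b, h) - uc (a, h)) * (0 < h < 1)%R%:R + S h.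
have cuba : continuous (fun h => uc (b, h) - uc (a, h)).
  by move=> h; apply: cvgB; exact: cub.
have mcuba := continuous_measurable_fun cuba.
have iU (g : R -> R) B c d : measurable_fun setT g -> (forall h, `|g h| <= B) ->
    mu.-integrable setT (EFin \o (fun h => (uc (b, h) - uc (a, h)) * (c < h < d)%R%:R * g h)).
  move=> mg gB.
  have i : mu.-integrable `]c, d[ (EFin \o (fun h => uc (b, h) - uc (a, h))).
    apply: (@integrableS _ _ _ mu `[c, d]) => //.
      exact: subset_itv_oo_cc.
    exact: continuous_integrable_itv.
  apply: (@integrable_mul_bounded _ _ _ mu setT
    (fun h => (uc (b, h) - uc (a, h)) * (c < h < d)%R%:R) g B) => //.
  suff -> : (fun h => (uc (b, h) - uc (a, h)) * (c < h < d)%R%:R) =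
      (fun h => uc (b, h) - uc (a, h)) \_ `]c, d[.
    by rewrite -restrict_EFin -integrable_mkcond.
  apply/funext => h; rewrite patchE itv_indicE /=.
  by case: ifP => _; rewrite ?mulr1 ?mulr0.
have iU1 c d : mu.-integrable setT (EFin \o (fun h => (uc (b, h) - uc (a, h)) * (c < h < d)%R%:R)).
  have := iU (cst 1) 1 c d; rewrite /cst/=.
  have -> : (fun h => (uc (b, h) - uc (a, h)) * (c < h < d)%R%:R * 1) =
    (fun h => (uc (b, h) - uc (a, h)) * (c < h < d)%R%:R).
    by apply/funext => h; rewrite mulr1.
  by apply => // h; rewrite normr1.
have iD : mu.-integrable setT (EFin \o D) by exact: integrableDR.
have mD : measurable_fun setT D by apply/measurable_EFinP; exact: measurable_int iD.
have D0 : {ae mu, forall h, 0 < h < 1 -> D h = 0}.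
  apply: ae_zero_open_itv => // c d c0 cd d1.
  rewrite Rintegral_indic_itv.
  have -> : \int[mu]_h (D h * (c < h < d)%R%:R) =
    \int[mu]_h ((uc (b, h) - uc (a, h)) * (c < h < d)%R%:R + S h * (c < h < d)%R%:R).
    apply: eq_Rintegral => h _; rewrite /D mulrDl; congr (_ + _).
    have [/andP[ch hd]|_] := boolP (c < h < d); last by rewrite !mulr0.
    by rewrite (lt_trans c0 ch) (lt_trans hd d1) !mulr1.
  have b1 h : `|(c < h < d)%R%:R : R| <= 1.
    by case: (_ < _ < _); rewrite ?normr1 ?normr0.
  have mcd := measurable_indic_itv c d.
  have iSc : mu.-integrable setT (EFin \o (fun h => S h * (c < h < d)%R%:R)).
    by apply: (@integrable_mul_bounded _ _ _ mu setT S _ 1).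
  rewrite RintegralD// -(ES (fun h => (c < h < d)%R%:R) 1 mcd b1).
  have := flux_rect T0 ws E0 a0 ab bT c0 cd d1.
  rewrite flux_boxT => /eqP; rewrite -addr_eq0 => /eqP.
  rewrite /rect => <-; congr (_ + _).
  rewrite -Rintegral_indic_itv RintegralB//.
    apply: (@integrableS _ _ _ mu `[c, d]) => //; first exact: subset_itv_oo_cc.
    exact: continuous_integrable_itv.
  apply: (@integrableS _ _ _ mu `[c, d]) => //; first exact: subset_itv_oo_cc.
  exact: continuous_integrable_itv.
have S0 h : ~ (0 < h < 1) -> S h = 0.
  move=> h01; rewrite /S; under eq_Rintegral do rewrite flux_out// mul0r.
  by rewrite /Rintegral integral0.
have fD : \int[mu]_h (D h * f h) = 0.
  rewrite (@ae_eq_Rintegral _ (cst 0)) ?/Rintegral ?integral0//.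
    exact: measurable_funM.
  move: D0; apply: filterS; first exact: (ae_filter_ringOfSetsType mu).
  move=> h Dh; have [/Dh ->|h01] := boolP (0 < h < 1); first by rewrite mul0r.
  by rewrite /D (negbTE h01) mulr0 S0 ?addr0 ?mul0r//; exact/negP.
rewrite (ES f C mf fC) Rintegral_indic_itv; apply/eqP; rewrite -addr_eq0; apply/eqP.
rewrite -[RHS]fD -RintegralD//.
- by apply: eq_Rintegral => h _; rewrite /D; ring.
- have := iU f C 0 1 mf fC; apply: eq_integrable => // h _ /=; congr EFin; ring.
- by apply: (@integrable_mul_bounded _ _ _ mu setT S _ C).
Qed.

(** The means of u in h are Hoelder continuous in time, in the form given by Young's
    inequality. *)
Lemma uc_time_reg (a b c d lam : R) : 0 < a -> a < b -> b < T -> 0 < c -> c < d -> d < 1 ->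
  0 < lam ->
  `|\int[mu]_(h in `]c, d[) uc (b, h) - \int[mu]_(h in `]c, d[) uc (a, h)| <=
  (lam * ((b - a) * (d - c)) + Q / lam) / 2.
Proof.
move=> a0 ab bT c0 cd d1 lam0; rewrite (flux_rect T0 ws E0 a0 ab bT c0 cd d1) normrN.
pose B : set (R * R) := `]a, b[%classic `*` `]c, d[%classic.
have mB : measurable B by apply: measurableX; exact: measurable_itv.
have BB : B `<=` box T.
  move=> [t h] [/=]; rewrite !in_itv/= => /andP[? ?] /andP[? ?].
  by split; rewrite /= in_itv/=; apply/andP; split; lra.
have [iB leB] := flux_young T0 ws mB BB lam0 E0.
have muB : fine (mu2 B) = (b - a) * (d - c).
  by rewrite product_measure1E//= !lebesgue_measure_itv/= !lte_fin ab cd.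
rewrite muB in leB; apply: le_trans leB.
have -> : \int[mu2]_(p in box T) (flux p * rect a b c d p) = \int[mu2]_(p in B) flux p.
  rewrite Rintegral_mkcond [RHS]Rintegral_mkcond; apply: eq_Rintegral => -[t h] _.
  rewrite !patchE /rect/= [in RHS]in_setX !itv_indicE.
  have [tI|] := boolP (a < t < b); last by rewrite /= mul0r mulr0; case: ifP.
  have [hI|] := boolP (c < h < d); last by rewrite /= mulr0 mulr0; case: ifP.
  rewrite mul1r mulr1 ifT// inE; apply: BB; split; rewrite /= in_itv//.
exact: le_normr_Rintegral.
Qed.

End flux_test.

(** * The fourth derivative has mean zero on the circle *)

Section conservation.
Variable R : realType.
Local Notation mu := (@lebesgue_measure R).
Local Notation mu2 := (mu \x mu)%E.

Lemma continuous_shift1 (q : R -> R) : continuous q -> continuous (fun h : R => q (h - 1)).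
Proof.
move=> cq h; apply: (@cvg_comp _ _ _ (fun x : R => x - 1) q (nbhs h) (nbhs (h - 1))).
  by apply: cvgB; [exact: cvg_id|exact: cvg_cst].
exact: cq.
Qed.

Lemma tensE (f g : R -> R) t h : tens f g (t, h) = f t * g h. Proof. by []. Qed.

Lemma Rintegral_shift1 (H q : R -> R) : continuous H -> continuous q ->
  (forall h, H (h + 1) = H h) ->
  (forall h, h < 0 -> q h = 0) -> (forall h, 1 < h -> q h = 0) ->
  \int[mu]_h (H h * q (h - 1)) = \int[mu]_h (H h * q h).
Proof.
move=> cH cq pH q0 q1.
rewrite (@Rintegral_compact_support _ _ 1 2); last 2 first.
- by move=> h h1; rewrite q0 ?mulr0//; lra.
- by move=> h h1; rewrite q1 ?mulr0//; lra.
rewrite (@Rintegral_compact_support _ (fun h => H h * q h) 0 1); last 2 first.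
- by move=> h h1; rewrite q0 ?mulr0.
- by move=> h h1; rewrite q1 ?mulr0.
pose F (x : R) := x + 1.
have dF (x : R) : is_derive x 1 F 1.
  have := is_deriveD (is_derive_id x (1 : R)) (is_derive_cst (1 : R) x (1 : R)).
  by move=> /(@is_derive_eq _ _ _ _ _ _ _) HH; apply: HH; rewrite addr0.
have F' : derive1 F = cst 1 by exact: derive1_eq.
have cF : continuous F := is_derive_continuous dF.
have cG : continuous (fun h => H h * q (h - 1)).
  by move=> h; apply: cvgM; [exact: cH|exact: continuous_shift1].
have := @integration_by_substitution_increasing R F (fun h => H h * q (h - 1)) 0 1 ler01.
have F0 : F 0 = 1 by rewrite /F add0r.
have F1 : F 1 = 2 by [].
rewrite F' F0 F1.
rewrite /Rintegral => ->.
- congr fine; apply: eq_integral => h _; congr EFin.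
  by transitivity (H (h + 1) * q (h + 1 - 1) * 1); [|rewrite mulr1 pH addrK].
- by move=> x y _ _; rewrite ltrD2r.
- by move=> x _; exact: cvg_cst.
- by apply/cvg_ex; exists 1; exact: cvg_cst.
- by apply/cvg_ex; exists 1; exact: cvg_cst.
- split.
  + by move=> x _; have [] := dF x.
  + by apply: cvg_at_right_filter; exact: cF.
  + by apply: cvg_at_left_filter; exact: cF.
- exact: continuous_subspaceT.
Qed.

Lemma derive1n_shift1 (f : R -> R) m : Cinf f ->
  derive1n m (fun h => f (h - 1)) = fun h => derive1n m f (h - 1).
Proof.
move=> cf; elim: m => [//|m IH]; rewrite derive1nS IH; apply: derive1_eq => x.
have h1 : is_derive x 1 (fun h : R => h - 1) 1.
  have := is_deriveB (is_derive_id x (1 : R)) (is_derive_cst (1 : R) x (1 : R)).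
  by move=> /(@is_derive_eq _ _ _ _ _ _ _) HH; apply: HH; rewrite subr0.
have := @is_derive1_comp R (derive1n m f) (fun h => h - 1) x _ _
  (Cinf_derive (Cinf_derive1n m cf) (x - 1)) h1.
by move=> /(@is_derive_eq _ _ _ _ _ _ _) HH; apply: HH; rewrite mulr1.
Qed.

Lemma derive1nB (f g : R -> R) m : Cinf f -> Cinf g ->
  derive1n m (fun h => f h - g h) = fun h => derive1n m f h - derive1n m g h.
Proof.
move=> cf cg; elim: m => [//|m IH]; rewrite derive1nS IH; apply: derive1_eq => x.
by apply: is_deriveB; apply: Cinf_derive; exact: Cinf_derive1n.
Qed.

Variables (T : R) (u0 : R -> R) (u ut w : R * R -> R) (Q : R).
Hypothesis T0 : 0 < T.
Hypothesis ws : weak_solution_with T u0 u ut w.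
Hypothesis E0 : energyE (slice u 0) = Q%:E.
Local Notation uc := (uc T u).
Local Notation flux := (flux T u w).

(** The two steps differ by a translation of one period, so by periodicity of H the
    two contributions cancel. This replaces testing with the constant 1, which
    is not compactly supported on the line. *)
Lemma circle_derivative_mean0 (H : R -> R) k m : 1 <= k -> continuous H ->
  (forall h, H (h + 1) = H h) ->
  \int[mu]_h (H h * derive1n m.+1 (fun h => scaled_step k 0 h - scaled_step k 1 h) h) = 0.
Proof.
move=> k1 cH pH; have k0 : 0 < k by apply: lt_le_trans k1.
have ki : k^-1 <= 1 by rewrite invf_le1.
pose q := derive1n m.+1 (scaled_step k 0).
have cq : Cinf q by apply: Cinf_derive1n; exact: scaled_step_Cinf.
have qE : q = derive1n m (pulse k 0).
  by rewrite /q /derive1n iterSr (derive1_eq (scaled_step_derive k 0)).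
have q0 h : h < 0 -> q h = 0.
  by rewrite qE; apply: derive1n_left => y; exact: pulse_left.
have q1 h : 1 < h -> q h = 0.
  move=> h1; rewrite qE; apply: (@derive1n_right _ _ (k^-1)); last exact: le_lt_trans ki h1.
  by move=> y ky; apply: pulse_right => //; rewrite add0r.
have -> : (fun h => scaled_step k 0 h - scaled_step k 1 h) =
    (fun h => scaled_step k 0 h - scaled_step k 0 (h - 1)).
  by apply/funext => h; rewrite /scaled_step !subr0.
have c1 : Cinf (fun h => scaled_step k 0 (h - 1)).
  have -> : (fun h => scaled_step k 0 (h - 1)) = scaled_step k 1.
    by apply/funext => h; rewrite /scaled_step !subr0.
  exact: scaled_step_Cinf.
rewrite derive1nB//; last exact: scaled_step_Cinf.
rewrite derive1n_shift1; last exact: scaled_step_Cinf.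
rewrite -/q.
have i1 : mu.-integrable setT (EFin \o (fun h => H h * q h)).
  apply: (@integrable_compact_support _ _ _ 0 1) => //; last exact: Cinf_cont.
  exact: continuous_integrable_itv.
have i2 : mu.-integrable setT (EFin \o (fun h => H h * q (h - 1))).
  apply: (@integrable_compact_support _ _ (fun h => q (h - 1)) 1 2) => //.
  - exact: continuous_integrable_itv.
  - by apply: continuous_shift1; exact: Cinf_cont.
  - by move=> h h1; rewrite q0//; lra.
  - by move=> h h1; rewrite q1//; lra.
rewrite (_ : \int[mu]_h _ = \int[mu]_h (H h * q h - H h * q (h - 1))); last first.
  by apply: eq_Rintegral => h _; rewrite mulrBr.
by rewrite RintegralB// Rintegral_shift1 ?subrr//; exact: Cinf_cont.
Qed.

Definition cyl (a b : R) : set (R * R) := `[a, b] `*` `[0, 2].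

Lemma measurable_cyl a b : measurable (cyl a b).
Proof. by apply: measurableX; exact: measurable_itv. Qed.

(** The function w lives on the unrolled circle, and two periods leave room for the
    transition of the cut-off beyond h = 1. *)
Lemma w_cyl_integrable (a b : R) : 0 < a -> b < T ->
  (forall t h, a <= t <= b -> uc (t, h) != 0) ->
  mu2.-integrable (cyl a b) (EFin \o w).
Proof.
move=> a0 bT un0.
have cylP : cyl a b `<=` PTper T u.
  move=> [t h] [/=]; rewrite !in_itv/= => tab _; rewrite PTperE; split => /=.
    by split => //=; rewrite in_itv/=; move/andP: tab => [? ?]; apply/andP; split; lra.
  exact: un0.
have [mw iw] := ws_w_loc ws; apply/integrableP; split.
  apply/measurable_EFinP; apply: measurable_funS mw => //; exact: measurable_PTper T0 ws.
by apply: iw => //; apply: compact_setX; exact: segment_compact.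
Qed.

(** The cut-off in h is a difference of steps at 0 and 1, whose fourth derivative
    annihilates periodic functions, and it tends to the indicator of one full
    period. The cut-off in time is a plateau. *)
Lemma w_rect (a b : R) : 0 < a -> a < b -> b < T ->
  (forall t h, a <= t <= b -> uc (t, h) != 0) ->
  \int[mu2]_(p in cyl a b) (w p * rect a b 0 1 p) = 0.
Proof.
move=> a0 ab bT un0.
have iw := w_cyl_integrable a0 bT un0.
pose K := (b - a)^-1.
have i1 : 0 < (b - a)^-1 by rewrite invr_gt0; lra.
have K0 : 0 <= K by exact: ltW.
have k0 n : 0 < zoom K n by exact: zoom_gt0.
have kab n : a <= b - (zoom K n)^-1 by have [] := plateau_scale n ab (lexx _).
have k1 n : 1 <= zoom K n.
  by rewrite /zoom (@le_trans _ _ n.+1%:R)// ?ler1n// lerDr.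
have ki n : (zoom K n)^-1 <= 1 by rewrite invf_le1.
pose th n := plateau (zoom K n) a b.
pose g n h := scaled_step (zoom K n) 0 h - scaled_step (zoom K n) 1 h.
have cth n : Cinf (th n) by exact: plateau_Cinf.
have cg n : Cinf (g n) by apply: CinfB; exact: scaled_step_Cinf.
have gl n h : h <= 0 -> g n h = 0.
  by move=> h0; rewrite /g !scaled_step_0 ?subrr// (le_trans h0).
have gr n h : 2 <= h -> g n h = 0.
  by move=> h2; rewrite /g !scaled_step_1 ?subrr//; have := ki n; move: (_^-1) => s; lra.
have hw : \int[mu2]_(p in cyl a b) (w p * tens (th n) (g n) p) @[n --> \oo] -->
    \int[mu2]_(p in cyl a b) (w p * ((a < p.1 < b)%R%:R * (0 < p.2 <= 1)%R%:R)).
  apply: (@Rintegral_dct_mul _ _ _ _ _ _ _ _ 1) => //.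
  - exact: measurable_cyl.
  - by move=> n; apply: measurable_tens; exact: Cinf_cont.
  - move=> p _; apply: cvgM; first by exact: plateau_cvg.
    by rewrite -indic_oc//; apply: cvgB; exact: scaled_step_cvg.
  - by move=> n p _; apply: tens_le1 => x; [exact: plateau_bound|exact: step_diff_bound].
have -> : \int[mu2]_(p in cyl a b) (w p * rect a b 0 1 p) =
    \int[mu2]_(p in cyl a b) (w p * ((a < p.1 < b)%R%:R * (0 < p.2 <= 1)%R%:R)).
  (* The two integrands differ on the null set h = 1 only. *)
  pose N : set (R * R) := setT `*` [set 1].
  have mN : measurable N by apply: measurableX; [exact: measurableT|exact: measurable_set1].
  have N0 : mu2 N = 0%E by rewrite product_measure1E//= lebesgue_measure_set1 mule0.
  have mr (f : R -> R) : measurable_fun setT f ->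
      measurable_fun (cyl a b) (EFin \o (fun p => w p * ((a < p.1 < b)%R%:R * f p.2))).
    move=> mf; apply/measurable_EFinP; apply: measurable_funM.
      by apply/measurable_EFinP; exact: measurable_int iw.
    apply: measurable_funTS; apply: measurable_funM.
      by apply: (measurableT_comp (measurable_indic_itv a b)); exact: measurable_fst.
    by apply: (measurableT_comp mf); exact: measurable_snd.
  have m1 := mr _ (measurable_indic_itv 0 1).
  have m2 : measurable_fun (cyl a b)
    (EFin \o (fun p => w p * ((a < p.1 < b)%R%:R * (0 < p.2 <= 1)%R%:R))).
    apply: (mr (fun h => (0 < h <= 1)%R%:R)).
    have -> : (fun h : R => (0 < h <= 1)%R%:R : R) = \1_(`]0, 1]%classic).
      by apply/funext => h; rewrite indicE mem_setE in_itv.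
    exact: measurable_indic.
  congr fine; apply: ae_eq_integral => //; first exact: measurable_cyl.
  exists N; split => // -[t h] /=; apply: contra_notP => h1 _.
  by rewrite /rect/= le_eqVlt; case: eqP => // E; exfalso; apply: h1.
apply: (cvg_unique _ hw) => //.
apply: cvg_trans (@cvg_cst _ (0 : R) _ \oo _); apply: near_eq_cvg; near=> n.
have tphi : test_function (PTper T u) (tens (th n) (g n)).
  apply: (@test_function2 _ _ _ a b 0 2) => //.
  - by move=> x; exact: plateau_left.
  - by move=> x; exact: plateau_right.
  - by move=> x; exact: gl.
  - by move=> x; exact: gr.
  - move=> [t h] [/=]; rewrite !in_itv/= => tab _; rewrite PTperE; split => /=.
      by split => //=; rewrite in_itv/=; move/andP: tab => [? ?]; apply/andP; split; lra.
    exact: un0.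
have s4 : (-1) ^+ 4 = 1 :> R by rewrite -signr_odd.
have W := ws_w ws tphi; rewrite iter_dir_h// s4 mul1r in W.
pose V p := uc p ^+ 3.
have cV : continuous V.
  by have cu := uc_cont T0 ws; move=> p; apply: (cvgM (cu p) (cvgM (cu p) (cu p))).
have q0 h : ~ (0 <= h <= 2) -> derive1n 4 (g n) h = 0.
  move=> /negP; rewrite negb_and -!ltNge => /orP[h0|h2].
    by apply: (@derive1n_left _ _ 0) => // y /ltW; exact: gl.
  by apply: (@derive1n_right _ _ 2) => // y /ltW; exact: gr.
have iV : mu2.-integrable setT (EFin \o (fun p => V p * tens (th n) (derive1n 4 (g n)) p)).
  apply: (@plane_integrable_compact _ _ a b 0 2).
    move=> p; apply: cvgM; first exact: cV.
    by apply: tensor_sum_continuous; apply: TensorSum1 => //; exact: Cinf_derive1n.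
  move=> t h H; rewrite tensE.
  have [ta|at0] := leP t a; first by rewrite /th plateau_left// mul0r mulr0.
  have [bt|tb] := leP b t; first by rewrite /th plateau_right// mul0r mulr0.
  by rewrite q0 ?mulr0// => h02; apply: H; split => //; apply/andP; split; exact: ltW.
have e1 : \int[mu2]_(p in PTper T u) (u p ^+ 3 * tens (th n) (derive1n 4 (g n)) p) = 0.
  transitivity (\int[mu2]_p (V p * tens (th n) (derive1n 4 (g n)) p)).
    rewrite Rintegral_mkcond; apply: eq_Rintegral => -[t h] _.
    rewrite patchE; case: ifPn => [|pP].
      rewrite inE => -[[]]; rewrite /= in_itv/= => /andP[t0 tT] _ _.
      by rewrite /V ucE// !ltW.
    rewrite tensE.
    have [ta|at0] := leP t a; first by rewrite /th plateau_left// mul0r mulr0.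
    have [bt|tb] := leP b t; first by rewrite /th plateau_right// mul0r mulr0.
    exfalso; move: pP; rewrite notin_setE; apply; rewrite PTperE; split => /=.
      by split => //=; rewrite in_itv/=; apply/andP; split; lra.
    by apply: un0; rewrite !ltW.
  rewrite (Rintegral_fubini1 iV).1.
  suff key t : \int[mu]_h (V (t, h) * tens (th n) (derive1n 4 (g n)) (t, h)) = 0.
    by under eq_Rintegral do rewrite key; rewrite /Rintegral integral0.
  have cVt : continuous (fun h => V (t, h)) by exact: slice_continuous.
  have := @circle_derivative_mean0 (fun h => V (t, h)) (zoom K n) 3 (k1 n) cVt _.
  rewrite -/(g n) => E.
  transitivity (\int[mu]_h (th n t * (V (t, h) * derive1n 4 (g n) h))).
    by apply: eq_Rintegral => h _; rewrite tensE mulrCA.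
  rewrite RintegralZl//.
    by rewrite E ?mulr0// => h; rewrite /V (uc_periodic T0 ws).
  apply: (@integrable_compact_support _ (fun h => V (t, h)) _ 0 2).
  - exact: continuous_integrable_itv.
  - by apply: Cinf_cont; exact: Cinf_derive1n.
  - by move=> h h0; apply: q0 => /andP[]; rewrite leNgt h0.
  - by move=> h h2; apply: q0 => /andP[_]; rewrite leNgt h2.
rewrite e1 in W; rewrite [LHS]W.
rewrite Rintegral_mkcond [RHS]Rintegral_mkcond; apply: eq_Rintegral => -[t h] _.
rewrite !patchE /tens/=.
have [ta|at0] := leP t a.
  by rewrite /th plateau_left// mul0r mulr0; case: ifP; case: ifP.
have [bt|tb] := leP b t.
  by rewrite /th plateau_right// mul0r mulr0; case: ifP; case: ifP.
have [h0|h0] := leP h 0.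
  by rewrite gl// !mulr0; case: ifP; case: ifP.
have [h2|h2] := leP 2 h.
  by rewrite gr// !mulr0; case: ifP; case: ifP.
rewrite !ifT//; rewrite inE.
  by split; rewrite /= in_itv/= !ltW.
rewrite PTperE; split => /=.
  by split => //=; rewrite in_itv/=; apply/andP; split; lra.
by apply: un0; rewrite !ltW.
Unshelve. all: by end_near. Qed.

End conservation.

(** * Conservation of the inverse mass *)

Section inverse_mass.
Variable R : realType.
Local Notation mu := (@lebesgue_measure R).
Local Notation mu2 := (mu \x mu)%E.

Lemma itv_oo_cc_sub (a b x y t : R) : a <= x -> y <= b -> x < t < y -> a <= t <= b.
Proof. by move=> ax yb /andP[xt ty]; rewrite (le_trans ax (ltW xt)) (le_trans (ltW ty) yb). Qed.

Lemma itv01_02 (h : R) : 0 < h < 1 -> 0 <= h <= 2.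
Proof. by apply: itv_oo_cc_sub => //; rewrite ler1n. Qed.

(** Halving the interval until it is short: local estimates add up along the
    subdivision. *)
Lemma bisection_subadditive (J : R -> R) (m : R -> R -> R) (a b d : R) : 0 < d ->
  (forall x y z, a <= x -> x < y -> y < z -> z <= b -> m x y + m y z <= m x z) ->
  (forall x y, a <= x -> x < y -> y <= b -> y - x <= d -> `|J y - J x| <= m x y) ->
  a < b -> `|J b - J a| <= m a b.
Proof.
move=> d0 sup loc ab.
have H n x y : a <= x -> x < y -> y <= b -> y - x <= d *+ 2 ^ n -> `|J y - J x| <= m x y.
  elim: n x y => [|n IH] x y ax xy yb; first by rewrite expn0 mulr1n; exact: loc.
  rewrite expnS mulnC mulrnA => h.
  pose z := (x + y) / 2.
  have xz : x < z by rewrite /z; lra.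
  have zy : z < y by rewrite /z; lra.
  move: (d *+ 2 ^ n) h IH => D; rewrite mulr2n => h IH.
  apply: le_trans (sup x z y ax xz zy yb).
  have -> : J y - J x = (J z - J x) + (J y - J z) by ring.
  apply: le_trans (ler_normD _ _) _; apply: lerD; apply: IH => //.
  - by rewrite (le_trans (ltW zy)).
  - by rewrite /z; lra.
  - by rewrite (le_trans ax) // ltW.
  - by rewrite /z; lra.
pose N := Num.bound ((b - a) / d).
apply: (H N) => //.
have h1 : (b - a) / d < N%:R by apply: archi_boundP; rewrite divr_ge0 ?ltW// subr_gt0.
rewrite -mulr_natr -ler_pdivrMl// mulrC; apply: le_trans (ltW h1) _.
by rewrite ler_nat ltnW// ltn_expl.
Qed.

Lemma ratio_close (x y z r rho : R) : 0 < rho -> rho <= x -> rho <= y -> rho <= z ->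
  r <= rho -> `|x - y| <= r -> `|x - z| <= r ->
  `|x ^+ 2 * (y * z)^-1 - 1| <= 3 * r / rho.
Proof.
move=> rho0 rx ry rz rrho xy xz.
have y0 : 0 < y by lra.
have z0 : 0 < z by lra.
have yz0 : 0 < y * z by rewrite mulr_gt0.
have -> : x ^+ 2 * (y * z)^-1 - 1 = (x ^+ 2 - y * z) / (y * z).
  by field; rewrite !gt_eqF.
rewrite normrM [X in _ * X]gtr0_norm ?invr_gt0// ler_pdivrMr//.
have -> : 3 * r / rho * (y * z) = 3 * r * (y * z) / rho by rewrite mulrAC.
rewrite ler_pdivlMr//.
have r0 : 0 <= r by apply: le_trans xy.
have -> : x ^+ 2 - y * z = (x - y) * x + y * (x - z) by ring.
have h1 : `|(x - y) * x + y * (x - z)| <= r * x + y * r.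
  apply: le_trans (ler_normD _ _) _; rewrite !normrM (gtr0_norm y0).
  rewrite (ger0_norm (_ : 0 <= x)); last by lra.
  by apply: lerD; [apply: ler_wpM2r => //; lra|apply: ler_wpM2l => //; lra].
apply: (@le_trans _ _ ((r * x + y * r) * rho)).
  by apply: ler_wpM2r => //; exact: ltW.
have x2y : x <= 2 * y.
  have : x - y <= r by apply: le_trans xy; exact: ler_norm.
  by lra.
have : r * x <= r * (2 * y) by apply: ler_wpM2l.
have : r * y * rho <= r * y * z by apply: ler_wpM2l => //; rewrite mulr_ge0// ltW.
move=> h2 h3.
have : (r * x + y * r) * rho <= (3 * (r * y)) * rho by apply: ler_wpM2r; lra.
by lra.
Qed.

Variables (T : R) (u0 : R -> R) (u ut w : R * R -> R) (Q : R).
Hypothesis T0 : 0 < T.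
Hypothesis ws : weak_solution_with T u0 u ut w.
Hypothesis E0 : energyE (slice u 0) = Q%:E.
Local Notation uc := (uc T u).
Local Notation flux := (flux T u w).

Definition inv_mass (t : R) := \int[mu]_(h in `]0, 1[) (uc (t, h))^-1.

Lemma inv_slice_integrable t : (forall h, uc (t, h) != 0) ->
  mu.-integrable `]0, 1[ (EFin \o (fun h => (uc (t, h))^-1)).
Proof.
move=> un0; apply: (@integrableS _ _ _ mu `[0, 1]) => //; first exact: subset_itv_oo_cc.
have cs : continuous (fun h => uc (t, h)) := slice_continuous (uc_cont T0 ws).
apply: continuous_integrable_itv => h; apply: cvgV; first exact: un0.
exact: cs.
Qed.

(** The difference 1/u(x) - 1/u(y) is f (u(y) - u(x)) with f = 1 / (u(x) u(y)), to
    which flux_test applies; u^2 f is 1 up to e and the integral of w alone is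
    0. *)
Lemma inv_mass_local (a b rho x y e : R) : 0 < a -> a < b -> b < T -> 0 < rho ->
  (forall t h, a <= t <= b -> rho <= uc (t, h)) -> a <= x -> x < y -> y <= b ->
  (forall t h, x < t < y -> 0 < h < 1 ->
    `|uc (t, h) ^+ 2 * (uc (x, h) * uc (y, h))^-1 - 1| <= e) ->
  `|inv_mass y - inv_mass x| <=
    e * \int[mu2]_(p in cyl a b) (`|w p| * rect x y 0 1 p).
Proof.
move=> a0 ab bT rho0 urho ax xy yb he.
have un0 t h : a <= t <= b -> uc (t, h) != 0.
  by move=> tab; rewrite gt_eqF// (lt_le_trans rho0) ?urho.
have cu := uc_cont T0 ws.
have xab : a <= x <= b by apply/andP; split; lra.
have yab : a <= y <= b by apply/andP; split; lra.
pose f h := (uc (x, h) * uc (y, h))^-1.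
have cf : continuous f.
  move=> h; apply: cvgV; first by rewrite mulf_neq0// un0.
  have cs s : continuous (fun h => uc (s, h)) := slice_continuous cu.
  by apply: cvgM; exact: cs.
have fC h : `|f h| <= rho ^- 2.
  have h1 := urho x h xab; have h2 := urho y h yab.
  rewrite /f ger0_norm; last by rewrite invr_ge0 mulr_ge0// (le_trans (ltW rho0)).
  rewrite lef_pV2 ?posrE ?exprn_gt0//; last by rewrite mulr_gt0// (lt_le_trans rho0).
  by rewrite expr2 ler_pM// ltW.
have iw := w_cyl_integrable T0 ws a0 bT un0.
have x0 : 0 < x := lt_le_trans a0 ax.
have yT : y < T := le_lt_trans yb bT.
have E1 : inv_mass x - inv_mass y =
    \int[mu]_(h in `]0, 1[) (f h * (uc (y, h) - uc (x, h))).
  rewrite /inv_mass -RintegralB//; [|by apply: inv_slice_integrable => h; exact: un0..].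
  apply: eq_Rintegral => h _; rewrite /f; field.
  by rewrite !un0.
have E2 := flux_test T0 ws E0 x0 xy yT (continuous_measurable_fun cf) fC.
have mrect : measurable_fun setT (rect x y 0 1).
  apply: measurable_funM.
    by apply: (measurableT_comp (measurable_indic_itv x y)); exact: measurable_fst.
  by apply: (measurableT_comp (measurable_indic_itv 0 1)); exact: measurable_snd.
have rect01 p : 0 <= rect x y 0 1 p <= 1.
  by rewrite /rect; case: (_ < _ < _); case: (_ < _ < _); rewrite ?mulr1 ?mulr0 ?lexx ?ler01.
have nrect p : `|rect x y 0 1 p| <= 1 by have /andP[? ?] := rect01 p; rewrite ger0_norm.
have mcyl := measurable_cyl a b.
have iwr : mu2.-integrable (cyl a b) (EFin \o (fun p => w p * rect x y 0 1 p)).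
  apply: (@integrable_mul_bounded _ _ _ mu2 _ w _ 1) => //.
  exact: measurable_funTS.
pose k p := uc p ^+ 2 * f p.2 - 1.
have ck : continuous k.
  move=> p; apply: cvgB; last exact: cvg_cst.
  apply: cvgM; first exact: (cvgM (cu p) (cu p)).
  by apply: (@continuous_comp _ _ _ snd f); [exact: cvg_snd|exact: cf].
have kb p : `|rect x y 0 1 p * k p| <= e * rect x y 0 1 p.
  rewrite /rect; have [tI|_] := boolP (x < p.1 < y); last by rewrite !mul0r mulr0 normr0.
  have [hI|_] := boolP (0 < p.2 < 1); last by rewrite !mulr0 mul0r normr0.
  by rewrite !mulr1 mul1r /k /f; case: p tI hI => t h /= tI hI; exact: he.
have e0 : 0 <= e.
  apply: le_trans (normr_ge0 _) (he ((x + y) / 2) (1 / 2) _ _).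
    by apply/andP; split; lra.
  by apply/andP; split; lra.
have iwk : mu2.-integrable (cyl a b) (EFin \o (fun p => w p * (rect x y 0 1 p * k p))).
  apply: (@integrable_mul_bounded _ _ _ mu2 _ w _ e) => //.
    apply: measurable_funTS; apply: measurable_funM => //.
    exact: plane_continuous_measurable.
  move=> p _; apply: le_trans (kb p) _; have /andP[? ?] := rect01 p.
  by rewrite ler_piMr.
have E3 : \int[mu2]_p (flux p * ((x < p.1 < y)%R%:R * f p.2)) =
    \int[mu2]_(p in cyl a b) (w p * rect x y 0 1 p + w p * (rect x y 0 1 p * k p)).
  rewrite [RHS]Rintegral_mkcond; apply: eq_Rintegral => -[t h] _.
  rewrite patchE -mulrDr -[X in _ * (X + _)]mulr1 -mulrDr /k addrC subrK /rect/=.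
  have [hI|hI] := boolP (0 < h < 1); last first.
    rewrite flux_out; last by move=> h01; move: hI; rewrite h01.
    by rewrite mul0r mulr0 mul0r mulr0; case: ifP.
  have [tI|tI] := boolP (x < t < y); last by rewrite !mul0r !mulr0; case: ifP.
  move/andP: (tI) => [t1 t2]; move/andP: (hI) => [h1 h2].
  rewrite ifT; last first.
    by rewrite inE; split; rewrite /= in_itv/= ?itv01_02// (itv_oo_cc_sub ax yb tI).
  rewrite /flux patchE ifT; last first.
    rewrite inE PTE; split; last by apply: un0; exact: itv_oo_cc_sub tI.
    by split; rewrite /= in_itv//= (lt_trans x0 t1) (lt_trans t2 yT).
  rewrite ucE; last by rewrite (ltW (lt_trans x0 t1)) (ltW (lt_trans t2 yT)).
  by rewrite !mul1r; ring.
have E4 : \int[mu2]_(p in cyl a b) (w p * rect x y 0 1 p) = 0.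
  have un0' t h : x <= t <= y -> uc (t, h) != 0.
    by move=> /andP[xt ty]; apply: un0; rewrite (le_trans ax xt) (le_trans ty yb).
  rewrite -[RHS](w_rect T0 ws x0 xy yT un0').
  rewrite Rintegral_mkcond [RHS]Rintegral_mkcond; apply: eq_Rintegral => -[t h] _.
  rewrite !patchE /rect/=.
  have [tI|tI] := boolP (x < t < y); last by rewrite !mul0r !mulr0; case: ifP; case: ifP.
  have [hI|hI] := boolP (0 < h < 1); last by rewrite !mulr0; case: ifP; case: ifP.
  move/andP: (tI) => [t1 t2]; move/andP: (hI) => [h1 h2].
  by rewrite !ifT// inE; split; rewrite /= in_itv/= ?itv01_02// ?(itv_oo_cc_sub _ _ tI).
have E5 : inv_mass x - inv_mass y =
    - \int[mu2]_(p in cyl a b) (w p * (rect x y 0 1 p * k p)).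
  by rewrite E1 E2 E3 RintegralD// E4 add0r.
rewrite distrC E5 normrN.
apply: le_trans (le_normr_Rintegral _ iwk) _ => //.
have inw : mu2.-integrable (cyl a b) (EFin \o (fun p => `|w p|)) := integrable_norm iw.
have inwr : mu2.-integrable (cyl a b) (EFin \o (fun p => `|w p| * rect x y 0 1 p)).
  apply: (@integrable_mul_bounded _ _ _ mu2 _ (fun p => `|w p|) _ 1) => //.
  exact: measurable_funTS.
rewrite -RintegralZl//; apply: le_Rintegral => //.
- exact: integrable_norm.
- exact: integrableZlR.
- move=> p _; rewrite normrM mulrCA; apply: ler_wpM2l => //; exact: kb.
Qed.

(** By uniform continuity the hypothesis of inv_mass_local holds with arbitrarily
    small e on short intervals, and the errors are additive in the interval. *)
Lemma inv_mass_conserved (a b rho : R) : 0 < a -> a < b -> b < T -> 0 < rho ->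
  (forall t h, a <= t <= b -> rho <= uc (t, h)) -> inv_mass a = inv_mass b.
Proof.
move=> a0 ab bT rho0 urho.
have un0 t h : a <= t <= b -> uc (t, h) != 0.
  by move=> tab; rewrite gt_eqF// (lt_le_trans rho0) ?urho.
have cu := uc_cont T0 ws.
have iw := w_cyl_integrable T0 ws a0 bT un0.
have mcyl := measurable_cyl a b.
have inw : mu2.-integrable (cyl a b) (EFin \o (fun p => `|w p|)) := integrable_norm iw.
pose m x y := \int[mu2]_(p in cyl a b) (`|w p| * rect x y 0 1 p).
have mrect x y : measurable_fun (cyl a b) (rect x y 0 1).
  apply: measurable_funTS; apply: measurable_funM.
    by apply: (measurableT_comp (measurable_indic_itv x y)); exact: measurable_fst.
  by apply: (measurableT_comp (measurable_indic_itv 0 1)); exact: measurable_snd.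
have im x y : mu2.-integrable (cyl a b) (EFin \o (fun p => `|w p| * rect x y 0 1 p)).
  apply: (@integrable_mul_bounded _ _ _ mu2 _ (fun p => `|w p|) _ 1) => //.
    exact: mrect.
  move=> p _; rewrite /rect; case: (x < p.1 < y); case: (0 < p.2 < 1);
    by rewrite ?mulr1 ?mulr0 ?normr0 ?normr1.
have msup x y z : a <= x -> x < y -> y < z -> z <= b -> m x y + m y z <= m x z.
  move=> ax xy yz zb; rewrite /m -RintegralD//; apply: le_Rintegral => //.
    exact: integrableDR.
  move=> p _; rewrite -mulrDr; apply: ler_wpM2l => //.
  rewrite /rect -mulrDl; apply: ler_wpM2r; first by case: (0 < p.2 < 1).
  have [/andP[t1 t2]|_] := boolP (x < p.1 < y).
    by rewrite (lt_gtF t2)/= addr0 t1 (lt_trans t2 yz).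
  rewrite add0r; have [/andP[t1 t2]|_] := boolP (y < p.1 < z); last by case: (x < p.1 < z).
  by rewrite t2 (lt_trans xy t1).
have m0 : 0 <= m a b.
  apply: Rintegral_ge0 => p _; rewrite mulr_ge0// /rect.
  by case: (a < p.1 < b); case: (0 < p.2 < 1); rewrite ?mulr1 ?mulr0.
suff H e : 0 < e -> `|inv_mass b - inv_mass a| <= e * m a b.
  apply/eqP; rewrite eq_sym -subr_eq0 -normr_le0; apply/ler_addgt0Pl => e e0.
  rewrite addr0; have e0' : 0 < e / (m a b + 1) by rewrite divr_gt0//; lra.
  apply: le_trans (H _ e0') _; rewrite mulrAC ler_pdivrMr; last by lra.
  by rewrite ler_pM2l//; lra.
move=> e0.
(* Variation of u below which the ratio of ratio_close is within e of 1. *)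
pose r := Num.min rho (e * rho / 3).
have r0 : 0 < r by rewrite lt_min rho0 divr_gt0// mulr_gt0.
have [d d0 hd] := plane_uniform_continuity a b 0 1 cu r0.
have d20 : 0 < d / 2 by rewrite divr_gt0.
apply: (@bisection_subadditive inv_mass (fun x y => e * m x y) a b (d / 2) d20) => //.
  by move=> x y z ax xy yz zb; rewrite -mulrDr; apply: ler_wpM2l; [exact: ltW|exact: msup].
move=> x y ax xy yb yx; apply: (inv_mass_local a0 ab bT rho0 urho) => //.
move=> t h /andP[xt ty] /andP[h0 h1].
have e3 : 3 * r / rho <= e.
  by rewrite ler_pdivrMr// mulrC -ler_pdivlMr// ge_min lexx orbT.
apply: le_trans e3; apply: ratio_close => //.
- by apply: urho; apply/andP; split; lra.
- by apply: urho; apply/andP; split; lra.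
- by apply: urho; apply/andP; split; lra.
- by rewrite ge_min lexx.
- apply/ltW/hd; rewrite ?subrr ?normr0//.
  + by apply/andP; split; lra.
  + by apply/andP; split; lra.
  + by rewrite ger0_norm; lra.
- apply/ltW/hd; rewrite ?subrr ?normr0//.
  + by apply/andP; split; lra.
  + by apply/andP; split; lra.
  + by rewrite ler0_norm; lra.
Qed.

End inverse_mass.

(** * Times of small energy *)

Section long_time.
Variable R : realType.
Local Notation mu := (@lebesgue_measure R).
Implicit Types (f : R -> R) (e : R -> \bar R).

(** The integral of a non-negative function is a supremum over the simple functions
    below it, which gives the bound even for an integrand such as t |-> E(u(t)),
    whose measurability is not known. *)
Lemma ge0_integral_lower_bound e (A D : set R) (c : R) :
  measurable A -> A `<=` D -> 0 <= c -> (forall x, D x -> (0 <= e x)%E) ->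
  (forall x, A x -> (c%:E <= e x)%E) -> (c%:E * mu A <= \int[mu]_(x in D) e x)%E.
Proof.
move=> mA AD c0 e0 ce; rewrite -integral_cst// integral_mkcond [leRHS]integral_mkcond.
have p1 x : (0 <= ((fun=> c%:E) \_ A) x)%E by apply: erestrict_ge0 => y _; rewrite lee_fin.
have p2 x : (0 <= (e \_ D) x)%E by apply: erestrict_ge0.
rewrite !ge0_integralTE//; apply: le_ereal_sup => _ [g /= gA <-]; exists g => //= x.
apply: le_trans (gA x) _; rewrite !patchE; case: ifPn => xA.
  by rewrite ifT ?inE; [apply: ce; rewrite inE in xA|apply: AD; rewrite inE in xA].
by case: ifPn => // xD; apply: e0; rewrite inE in xD.
Qed.

(** Otherwise e exceeds c on infinitely many disjoint intervals of length d, which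
    contradicts the bound F on the integrals. *)
Lemma recurrent_smallness e (F d c : R) :
  (forall t, 0 <= t -> (0 <= e t)%E) ->
  (forall T, 0 < T -> (\int[mu]_(t in `[0%R, T]) e t <= F%:E)%E) ->
  0 < d -> 0 < c ->
  exists2 t0, 0 < t0 & forall t, t0 <= t -> exists2 s, t < s <= t + d & (e s <= c%:E)%E.
Proof.
move=> e0 eF d0 c0; apply: contrapT => H.
have step t0 : 0 < t0 -> exists2 t, t0 <= t & forall s, t < s <= t + d -> (c%:E < e s)%E.
  move=> t00; apply: contrapT => H'; apply: H; exists t0 => // t tt.
  apply: contrapT => H2; apply: H'; exists t => // s ts; rewrite ltNge; apply/negP => es.
  by apply: H2; exists s.
have bad (N : nat) : exists (T : R) (A : set R), [/\ 0 < T, measurable A, A `<=` `[0, T],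
    forall x, A x -> (c%:E <= e x)%E & (mu A = (N%:R * d)%:E)%E].
  elim: N => [|N [T [A [T0 mA AT Ae muA]]]].
    by exists 1, set0; split => //; rewrite mul0r measure0.
  have [t Tt te] := step T T0; exists (t + d), (A `|` `]t, t + d]); split.
  - by rewrite addr_gt0// (lt_le_trans T0).
  - by apply: measurableU => //; exact: measurable_itv.
  - move=> x [/AT|]; rewrite /= !in_itv/= => /andP[x1 x2].
      by rewrite x1/= (le_trans x2)// (le_trans Tt)// lerDl ltW.
    by rewrite x2 (ltW (lt_trans (lt_le_trans T0 Tt) x1)).
  - by move=> x [/Ae//|]; rewrite /= in_itv/= => /te/ltW.
  - rewrite measureU//; last first.
      apply/seteqP; split => // x [/AT]; rewrite /= !in_itv/= => /andP[_ x1] /andP[x2 _].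
      by have := lt_le_trans x2 (le_trans x1 Tt); rewrite ltxx.
    rewrite /= lebesgue_measure_itv/= lte_fin ltrDl d0 -EFinD.
    have E : (mu A + (t + d - t)%:E)%E = (N.+1%:R * d)%:E.
      rewrite muA -(EFinD (N%:R * d)) -natr1; apply/eqP; rewrite eqe; apply/eqP.
      by ring.
    exact: E.
have F0 N : c * (N%:R * d) <= F.
  have [T [A [T0 mA AT Ae muA]]] := bad N.
  rewrite -lee_fin EFinM -muA; apply: le_trans (eF T T0).
  apply: ge0_integral_lower_bound => //; first exact: ltW.
  by move=> x; rewrite /= in_itv/= => /andP[/e0].
have F00 : 0 <= F by have := F0 0%N; rewrite mul0r mulr0.
have := F0 (Num.truncn (F / (c * d))).+1; apply/negP; rewrite -ltNge.
have cd : 0 < c * d by rewrite mulr_gt0.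
by rewrite mulrCA -ltr_pdivrMr// truncnS_gt.
Qed.

End long_time.

(** * Global solutions *)

Section global_solution.
Variables (R : realType) (u0 : R -> R) (u : R * R -> R) (Q : R).
Local Notation mu := (@lebesgue_measure R).
Hypothesis u_sol : forall T : R, 0 < T -> weak_solution T u0 u.
Hypothesis E0 : energyE (slice u 0) = Q%:E.

Lemma sol_ge0 t h : 0 <= t -> 0 <= u (t, h).
Proof.
move=> t0; have [|ut [w ws]] := u_sol (T := t + 1); first by lra.
by apply: (ws_ge0 ws); lra.
Qed.

Lemma sol_periodic t h : 0 <= t -> u (t, h + 1) = u (t, h).
Proof.
move=> t0; have [|ut [w ws]] := u_sol (T := t + 1); first by lra.
by apply: (ws_periodic ws); lra.
Qed.

Lemma sol_slice_continuous t : 0 <= t -> continuous (slice u t).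
Proof.
move=> t0; have T0 : 0 < t + 1 by lra.
have [ut [w ws]] := u_sol T0.
have -> : slice u t = fun h => uc (t + 1) u (t, h).
  by apply/funext => h; rewrite /slice ucE//; lra.
by apply: slice_continuous; exact: uc_cont T0 ws.
Qed.

Lemma sol_cube_continuous t : 0 <= t -> continuous (cube (slice u t)).
Proof.
move=> t0 h; rewrite /cube; apply: (@continuous_comp _ _ _ (slice u t) (fun x => x ^+ 3)).
  exact: sol_slice_continuous.
exact: exprn_continuous.
Qed.

Lemma sol_time_continuous t h : 0 < t -> {for t, continuous (fun s => u (s, h))}.
Proof.
move=> t0; have T0 : 0 < t + 1 by lra.
have [ut [w ws]] := u_sol T0.
have cu := uc_cont T0 ws.
rewrite /prop_for /continuous_at -(@ucE _ (t + 1)); last by lra.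
have h1 : uc (t + 1) u (s, h) @[s --> t] --> uc (t + 1) u (t, h).
  apply: (@continuous_comp _ _ _ (fun s : R => (s, h)) (uc (t + 1) u)); last exact: cu.
  have h1 : id @ t --> t by exact: cvg_id.
  have h2 : (fun=> h) @ t --> h by exact: cvg_cst.
  exact: (cvg_pair h1 h2).
apply: cvg_trans h1; apply: near_eq_cvg; near=> s.
have s0 : 0 < s by near: s; exact: lt_nbhsr.
have s1 : s < t + 1 by near: s; apply: lt_nbhsl; lra.
by rewrite ucE// !ltW.
Unshelve. all: by end_near. Qed.

Lemma sol_energyE t : 0 <= t -> (energyE (slice u t) <= Q%:E)%E.
Proof.
rewrite le_eqVlt => /predU1P[<-|t0]; first by rewrite E0.
have [ut [w ws]] := u_sol t0.
rewrite -E0; apply: le_trans (ws_energyE ws); rewrite leeDl// integral_ge0// => p _.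
by rewrite lee_fin sqr_ge0.
Qed.

Lemma energyF_ge0 (f : R -> R) : (0 <= energyF f)%E.
Proof.
by rewrite mule_ge0// integral_ge0// => h _; rewrite lee_fin sqr_ge0.
Qed.

Lemma energyF_fin (f : R -> R) : continuous f -> exists F, energyF f = F%:E.
Proof.
move=> cf; have i : mu.-integrable `[0, 1] (EFin \o (fun h => f h ^+ 2)).
  apply: continuous_integrable_itv => h.
  by apply: (@continuous_comp _ _ _ f (fun x => x ^+ 2)); [exact: cf|exact: exprn_continuous].
exists (2^-1 * fine (\int[mu]_(h in `[0%R, 1%R]) (f h ^+ 2)%:E)).
rewrite /energyF EFinM fineK//; exact: integrable_fin_num i.
Qed.

Lemma sol_dissipation : exists F, forall T, 0 < T ->
  (\int[mu]_(t in `[0%R, T]) energyE (slice u t) <= F%:E)%E.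
Proof.
have [F FE] := energyF_fin (sol_slice_continuous (lexx 0)).
exists (F / 6) => T T0; have [ut [w ws]] := u_sol T0.
have i0 : (0 <= \int[mu]_(t in `[0%R, T]) energyE (slice u t))%E.
  by apply: integral_ge0 => t _; exact: energyE_ge0.
have : (6%:E * \int[mu]_(t in `[0%R, T]) energyE (slice u t) <= F%:E)%E.
  by rewrite -FE; apply: le_trans (ws_energyF ws); rewrite leeDr// energyF_ge0.
move: i0; case: (\int[mu]_(t in _) _)%E => [r|_|//].
  by rewrite -EFinM !lee_fin ler_pdivlMr// mulrC.
by rewrite mulry gtr0_sg// mul1e leye_eq.
Qed.

Lemma sol_time_reg (a b c d lam : R) : 0 < a -> a < b -> 0 < c -> c < d -> d < 1 ->
  0 < lam ->
  `|\int[mu]_(h in `]c, d[) u (b, h) - \int[mu]_(h in `]c, d[) u (a, h)| <=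
  (lam * ((b - a) * (d - c)) + Q / lam) / 2.
Proof.
move=> a0 ab c0 cd d1 lam0; have T0 : 0 < b + 1 by lra.
have [ut [w ws]] := u_sol T0.
have bT : b < b + 1 by lra.
apply: le_trans (uc_time_reg T0 ws E0 a0 ab bT c0 cd d1 lam0).
have E t : 0 <= t <= b + 1 ->
    \int[mu]_(h in `]c, d[) uc (b + 1) u (t, h) = \int[mu]_(h in `]c, d[) u (t, h).
  by move=> tT; apply: eq_Rintegral => h _; rewrite ucE.
by rewrite !E//; lra.
Qed.

Definition sol_inv_mass t := \int[mu]_(h in `]0, 1[) (u (t, h))^-1.

Lemma sol_inv_mass_conserved (a b rho : R) : 0 < a -> a <= b -> 0 < rho ->
  (forall t h, a <= t <= b -> rho <= u (t, h)) -> sol_inv_mass a = sol_inv_mass b.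
Proof.
move=> a0; rewrite le_eqVlt => /predU1P[<-//|ab] rho0 ur.
have T0 : 0 < b + 1 by lra.
have [ut [w ws]] := u_sol T0.
have bT : b < b + 1 by lra.
have E t : 0 <= t <= b + 1 -> inv_mass (b + 1) u t = sol_inv_mass t.
  by move=> tT; apply: eq_Rintegral => h _; rewrite ucE.
rewrite -!E; [|lra|lra].
apply: (inv_mass_conserved T0 ws E0 a0 ab bT rho0) => t h /andP[ta tb].
by rewrite ucE; [apply: ur; rewrite ta tb|lra].
Qed.

Lemma sol_inv_integrable t : 0 <= t -> (forall h, u (t, h) != 0) ->
  mu.-integrable `]0, 1[ (EFin \o (fun h => (u (t, h))^-1)).
Proof.
move=> t0 un0; have T0 : 0 < t + 1 by lra.
have [ut [w ws]] := u_sol T0.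
have tT : 0 <= t <= t + 1 by lra.
have -> : (EFin \o (fun h => (u (t, h))^-1)) = (EFin \o (fun h => (uc (t + 1) u (t, h))^-1)).
  by apply/funext => h /=; rewrite ucE.
by apply: (inv_slice_integrable T0 ws) => h; rewrite ucE.
Qed.

End global_solution.

(** * Flattening *)

Lemma continuous_integrable_oo (R : realType) (f : R -> R) (c d : R) : continuous f ->
  (@lebesgue_measure R).-integrable `]c, d[ (EFin \o f).
Proof.
move=> cf; apply: (@integrableS _ _ _ (@lebesgue_measure R) `[c, d]) => //.
  by apply: subset_itv; rewrite bnd_simp.
exact: continuous_integrable_itv.
Qed.

Lemma Rintegral_itv_close (R : realType) (f : R -> R) (c d k e : R) : c < d ->
  (@lebesgue_measure R).-integrable `]c, d[ (EFin \o f) ->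
  (forall h, c < h < d -> `|f h - k| <= e) ->
  `|\int[@lebesgue_measure R]_(h in `]c, d[) f h - (d - c) * k| <= (d - c) * e.
Proof.
move=> cd i fk.
have ic (z : R) : (@lebesgue_measure R).-integrable `]c, d[ (EFin \o cst z).
  by apply: continuous_integrable_oo => x; exact: cvg_cst.
have E (z : R) : \int[@lebesgue_measure R]_(h in `]c, d[) cst z h = z * (d - c).
  by rewrite Rintegral_cst//= lebesgue_measure_itv/= lte_fin cd.
have h1 : \int[@lebesgue_measure R]_(h in `]c, d[) f h <= (k + e) * (d - c).
  rewrite -E; apply: le_Rintegral => // h; rewrite /= in_itv/= => /fk.
  by rewrite ler_distl => /andP[].
have h2 : (k - e) * (d - c) <= \int[@lebesgue_measure R]_(h in `]c, d[) f h.
  rewrite -E; apply: le_Rintegral => // h; rewrite /= in_itv/= => /fk.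
  by rewrite ler_distl => /andP[].
rewrite ler_norml; move: h1 h2; set I := Rintegral _ _ _; move: I => I; clear.
by move=> h1 h2; apply/andP; split; lra.
Qed.

Section flattening.
Variables (R : realType) (u0 : R -> R) (u : R * R -> R) (Q : R).
Local Notation mu := (@lebesgue_measure R).
Hypothesis u_sol : forall T : R, 0 < T -> weak_solution T u0 u.
Hypothesis E0 : energyE (slice u 0) = Q%:E.

(** The Lipschitz bound for u^3, transferred to u by dist_cube. *)
Lemma sol_energy_osc t c lam x y : 0 <= t -> (energyE (slice u t) <= c%:E)%E -> 0 < lam ->
  0 <= x <= 1 -> 0 <= y <= 1 ->
  `|u (t, x) - u (t, y)| ^+ 3 <= `|x - y| * ((lam + 6 * c / lam) / 2).
Proof.
move=> t0 Ec lam0 x01 y01; apply: le_trans (dist_cube _ _) _; try exact: (sol_ge0 u_sol).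
wlog : x y x01 y01 / y <= x.
  move=> H; have [yx|/ltW xy] := leP y x; first exact: H.
  by rewrite distrC (distrC x); exact: H.
move=> yx; rewrite (ger0_norm (_ : 0 <= x - y)) ?subr_ge0//.
have [y0 _] := andP y01; have [_ x1] := andP x01.
apply: (energyE_lipschitz (f := slice u t) (sol_cube_continuous u_sol t0)) => //.
by rewrite -[in RHS](add0r 1) /slice (sol_periodic u_sol).
Qed.

Lemma sol_space_modulus e : 0 < e -> exists2 eta, 0 < eta <= 2^-1 &
  forall t x y, 0 <= t -> 0 <= x <= 1 -> 0 <= y <= 1 -> `|x - y| <= eta ->
    `|u (t, x) - u (t, y)| <= e.
Proof.
move=> e0; pose L := (1 + 6 * Q / 1) / 2.
have L0 : 0 <= L.
  have : 0 <= Q by rewrite -lee_fin -E0 energyE_ge0.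
  by rewrite /L divr1 => Q0; lra.
have e3 : 0 < e ^+ 3 by rewrite exprn_gt0.
have L1 : 0 < L + 1 by lra.
exists (Num.min 2^-1 (e ^+ 3 / (L + 1))).
  by rewrite lt_min invr_gt0 ltr0n divr_gt0//= ge_min lexx.
move=> t x y t0 x01 y01; rewrite le_min => /andP[_ xy].
rewrite -(@ler_pXn2r _ 3) ?nnegrE ?(ltW e0)//.
apply: le_trans (sol_energy_osc t0 (sol_energyE u_sol E0 t0) ltr01 x01 y01) _.
apply: le_trans (ler_wpM2r L0 xy) _.
rewrite -mulrA ler_piMr ?(ltW e3)// ler_pdivrMl// mulr1; lra.
Qed.

Lemma sol_slice_integrable t c d : 0 <= t ->
  mu.-integrable `]c, d[ (EFin \o (fun h => u (t, h))).
Proof.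
move=> t0; apply: continuous_integrable_oo; exact: (sol_slice_continuous u_sol t0).
Qed.

(** The values of u at (t, h) and (s, h) are compared with the means over an
    interval of length l close to h, on which u varies by at most e in space. *)
Lemma sol_time_modulus e : 0 < e -> exists2 d, 0 < d &
  forall t s h, 0 < t -> t < s <= t + d -> 0 <= h <= 1 ->
    `|u (s, h) - u (t, h)| <= 3 * e.
Proof.
move=> e0; have Q0 : 0 <= Q by rewrite -lee_fin -E0 energyE_ge0.
have [eta /andP[eta0 eta1] mod_] := sol_space_modulus e0.
pose l := eta / 4; have l0 : 0 < l by rewrite divr_gt0.
have el0 : 0 < e * l by rewrite mulr_gt0.
(* Makes the term Q / lam at most e l; the time window e / lam then bounds the other
   term of sol_time_reg. *)
pose lam := Q / (e * l) + 1.
have lam0 : 0 < lam by rewrite ltr_wpDl// divr_ge0// ltW.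
have lamQ : Q / lam <= e * l.
  rewrite ler_pdivrMr// /lam mulrDr mulr1 mulrC divfK ?gt_eqF//.
  by rewrite lerDl ltW.
exists (e / lam) => [|t s h t0 /andP[ts st] h01]; first by rewrite divr_gt0.
have [c [d [c0 cd d1 cdl hcd]]] : exists c d, [/\ 0 < c, c < d, d < 1, d - c = l &
    forall x, c < x < d -> `|x - h| <= eta].
  have [h2|h2] := leP h 2^-1.
    exists (h + l), (h + l + l); rewrite /l; split; [lra|lra|lra|lra|].
    by move=> x /andP[x1 x2]; rewrite ler_norml; apply/andP; split; lra.
  exists (h - l - l), (h - l); rewrite /l; split; [lra|lra|lra|lra|].
  by move=> x /andP[x1 x2]; rewrite ler_norml; apply/andP; split; lra.
have close r : 0 <= r ->
    `|\int[mu]_(x in `]c, d[) u (r, x) - l * u (r, h)| <= l * e.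
  move=> r0; rewrite -cdl; apply: Rintegral_itv_close => //.
    exact: sol_slice_integrable.
  by move=> x xcd; apply: mod_ => //; [lra|exact: hcd].
have s0 : 0 <= s by lra.
have := close s s0; have := close t (ltW t0).
have := sol_time_reg u_sol E0 t0 ts c0 cd d1 lam0; rewrite cdl.
set Is := \int[mu]_(x in _) u (s, x); set It := \int[mu]_(x in _) u (t, x).
have lamd : lam * ((s - t) * l) <= e * l.
  rewrite mulrA ler_pM2r// mulrC -ler_pdivlMr//; lra.
move=> h1 h2 h3; rewrite -(ler_pM2l l0) -{1}(gtr0_norm l0) -normrM.
have {}h1 : `|Is - It| <= e * l by apply: le_trans h1 _; lra.
move: h1 h2 h3; rewrite !ler_norml => /andP[? ?] /andP[? ?] /andP[? ?].
by apply/andP; split; lra.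
Qed.

(** Jump from t to a time s of small energy within the time modulus, where u is
    flat, and back. *)
Lemma sol_flattens e : 0 < e -> exists2 t0, 0 < t0 &
  forall t x y, t0 <= t -> 0 <= x <= 1 -> 0 <= y <= 1 -> `|u (t, x) - u (t, y)| <= e.
Proof.
(* Two changes of time cost 3 r each, the oscillation at time s costs r. *)
move=> e0; pose r := e / 7; have r0 : 0 < r by rewrite divr_gt0.
have [d d0 dr] := sol_time_modulus r0.
have [F FE] := sol_dissipation u_sol.
have r3 : 0 < r ^+ 3 by rewrite exprn_gt0.
(* With this energy and lam = r^3, the bound of sol_energy_osc on the cube of the
   oscillation is r^3. *)
have c0 : 0 < r ^+ 6 / 6 by rewrite divr_gt0// exprn_gt0.
have [t0 t00 small] := recurrent_smallness (fun t _ => energyE_ge0 (slice u t)) FE d0 c0.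
exists t0 => // t x y tt x01 y01.
have [s sI Es] := small t tt; have [ts std] := andP sI.
have t_gt0 := lt_le_trans t00 tt.
have s0 : 0 <= s by lra.
have h1 := dr t s x t_gt0 sI x01; have h2 := dr t s y t_gt0 sI y01.
have h3 : `|u (s, x) - u (s, y)| <= r.
  rewrite -(@ler_pXn2r _ 3) ?nnegrE ?(ltW r0)//.
  apply: le_trans (sol_energy_osc s0 Es r3 x01 y01) _.
  have -> : (r ^+ 3 + 6 * (r ^+ 6 / 6) / r ^+ 3) / 2 = r ^+ 3 by field; rewrite gt_eqF.
  rewrite ler_piMl ?(ltW r3)// ler_norml.
  by case/andP: x01 y01 => ? ? /andP[? ?]; apply/andP; split; lra.
move: h1 h2 h3; rewrite /r !ler_norml => /andP[? ?] /andP[? ?] /andP[? ?].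
by apply/andP; split; lra.
Qed.

End flattening.

(** * The uniform limit *)

(** Translation by the integer part. *)
Lemma periodic_unit_interval (R : realType) (f : R -> R) (P : R -> Prop) :
  (forall h, f (h + 1) = f h) -> (forall h, 0 <= h <= 1 -> P (f h)) -> forall h, P (f h).
Proof.
move=> pf Pf h.
have pn n x : f (x + n%:R) = f x := periodicn pf n x.
have fh : P (f (h - (Num.floor h)%:~R)).
  apply: Pf; have := floor_itv h; rewrite intrD => /andP[? ?].
  by apply/andP; split; lra.
case: (Num.floor h) fh => [n|n].
  by rewrite -(pn n (h - _)) subrK.
by rewrite NegzE mulrNz opprK pn.
Qed.

(** If c went below m, consider the infimum of the times when it does. Just before
    it c is at least M by the hypothesis, and just after it c takes values less
    than m, which contradicts continuity. *)
Lemma barrier (R : realType) (c : R -> R) (t0 m M : R) : m < M ->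
  (forall t, t0 <= t -> {for t, continuous c}) -> M <= c t0 ->
  (forall s, t0 <= s -> (forall t, t0 <= t <= s -> m <= c t) -> M <= c s) ->
  forall s, t0 <= s -> M <= c s.
Proof.
move=> mM cc c0 step s ts; apply: (step s ts) => t /andP[tt _]; rewrite leNgt; apply/negP => ct.
pose B := [set r | t0 <= r /\ c r < m].
have B0 : B !=set0 by exists t.
have lB : lbound B t0 by move=> r [].
have hB : has_inf B by split=> //; exists t0.
have tB : t0 <= inf B by exact: lb_le_inf.
have e0 : 0 < (M - m) / 2 by rewrite divr_gt0// subr_gt0.
have /cvgrPdist_lt/(_ _ e0)/nbhs_ballP[d /= d0 near_inf] := cc _ tB.
have [b [tb cb] bd] := inf_adherent d0 hB.
have Bb : inf B <= b by apply: ge_inf; [exists t0|split].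
have hb : `|c (inf B) - c b| < (M - m) / 2.
  by apply: near_inf; rewrite /ball/= ler0_norm ?subr_le0//; lra.
have [tB'|tB'] := ltP t0 (inf B); last first.
  have E : inf B = t0 by apply/eqP; rewrite eq_le tB' tB.
  by move: hb; rewrite E ltr_norml => /andP[_ ?]; lra.
pose r := Num.max t0 (inf B - d / 2).
have rB : r < inf B by rewrite /r gt_max tB'/=; lra.
have tr : t0 <= r by rewrite /r le_max lexx.
have cr : M <= c r.
  apply: (step r tr) => q /andP[tq qr]; rewrite leNgt; apply/negP => cq.
  have := ge_inf (ex_intro _ t0 lB) (conj tq cq : B q).
  by rewrite leNgt (le_lt_trans qr).
have hr : `|c (inf B) - c r| < (M - m) / 2.
  apply: near_inf; rewrite /ball/= ger0_norm ?subr_ge0 ?(ltW rB)//.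
  have : inf B - d / 2 <= r by rewrite /r le_max lexx orbT.
  by lra.
by move: hb hr; rewrite !ltr_norml => /andP[? ?] /andP[? ?]; lra.
Qed.

Section limit.
Variables (R : realType) (u0 : R -> R) (u : R * R -> R) (Q : R).
Local Notation mu := (@lebesgue_measure R).
Hypothesis u_sol : forall T : R, 0 < T -> weak_solution T u0 u.
Hypothesis E0 : energyE (slice u 0) = Q%:E.

Lemma sol_inv_mass_bounds t a b : 0 <= t -> 0 < a -> (forall h, a <= u (t, h) <= b) ->
  b^-1 <= sol_inv_mass u t <= a^-1.
Proof.
move=> t0 a0 ab.
have u_gt0 h : 0 < u (t, h) by have /andP[ah _] := ab h; exact: lt_le_trans ah.
have i : mu.-integrable `]0, 1[ (EFin \o (fun h => (u (t, h))^-1)).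
  by apply: (sol_inv_integrable u_sol t0) => h; rewrite gt_eqF.
have ic (z : R) : mu.-integrable `]0, 1[ (EFin \o cst z).
  by apply: continuous_integrable_oo => x; exact: cvg_cst.
have E (z : R) : \int[mu]_(h in `]0, 1[) cst z h = z.
  by rewrite Rintegral_cst//= lebesgue_measure_itv/= lte_fin ltr01 oppr0 adde0 mulr1.
apply/andP; split.
- rewrite -[leLHS]E; apply: le_Rintegral => // h _; have /andP[ah hb] := ab h.
  by rewrite /= lef_pV2 ?posrE// (lt_le_trans _ hb).
- rewrite -[leRHS]E; apply: le_Rintegral => // h _; have /andP[ah hb] := ab h.
  by rewrite /= lef_pV2 ?posrE.
Qed.

Lemma sol_flattens_all e : 0 < e -> exists2 t0, 0 < t0 &
  forall t h, t0 <= t -> `|u (t, h) - u (t, 0)| <= e.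
Proof.
move=> e0; have [t0 t00 H] := sol_flattens u_sol E0 e0; exists t0 => // t h tt.
apply: (periodic_unit_interval (f := fun x => u (t, x)) (P := fun y => `|y - u (t, 0)| <= e)).
  by move=> x; apply: (sol_periodic u_sol); exact: ltW (lt_le_trans t00 tt).
by move=> x x01; apply: H => //; rewrite lexx ler01.
Qed.

(** While u >= e the inverse mass is constant. It is at most 1/(4 e) at t0, and at
    time s it is at least 1/(u(s, 0) + e), whence u(s, 0) >= 3 e. The gap
    between 2 e and 3 e closes the argument by continuity. *)
Lemma sol_stays_positive t0 e : 0 < e -> 0 < t0 ->
  (forall t h, t0 <= t -> `|u (t, h) - u (t, 0)| <= e) -> 5 * e <= u (t0, 0) ->
  forall t h, t0 <= t -> 2 * e <= u (t, h).
Proof.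
move=> e0 t00 flat u5.
have flat' t h : t0 <= t -> u (t, 0) - e <= u (t, h) <= u (t, 0) + e.
  by move=> tt; rewrite -ler_distl; exact: flat.
have H : forall s, t0 <= s -> 3 * e <= u (s, 0).
  apply: (@barrier _ _ _ (2 * e)); first by lra.
  - by move=> t tt; apply: (sol_time_continuous u_sol); exact: lt_le_trans tt.
  - by lra.
  move=> s ts us.
  have us' t h : t0 <= t <= s -> e <= u (t, h).
    by move=> /[dup] /us ? /andP[tt _]; have /andP[? _] := flat' t h tt; lra.
  have E := sol_inv_mass_conserved u_sol E0 t00 ts e0 us'.
  have e4 : 0 < 4 * e by lra.
  have /andP[_ J1] : (u (t0, 0) + e)^-1 <= sol_inv_mass u t0 <= (4 * e)^-1.
    apply: sol_inv_mass_bounds (ltW t00) e4 _ => h.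
    by have /andP[? ?] := flat' t0 h (lexx _); apply/andP; split; lra.
  have s0 : 0 <= s by lra.
  have /andP[J2 _] : (u (s, 0) + e)^-1 <= sol_inv_mass u s <= e^-1.
    apply: sol_inv_mass_bounds s0 e0 _ => h.
    by have /andP[? ->] := flat' s h ts; rewrite us'// ts lexx.
  have us0 : 0 <= u (s, 0) by exact: (sol_ge0 u_sol).
  have se : 0 < u (s, 0) + e by lra.
  have : (u (s, 0) + e)^-1 <= (4 * e)^-1 by rewrite (le_trans J2)// -E.
  by rewrite lef_pV2 ?posrE//; lra.
move=> t h tt; have := H t tt; have /andP[? _] := flat' t h tt; lra.
Qed.

(** Either u(t, 0) is at least 5 e at arbitrarily late times, for some e, and the
    limit is the inverse of the conserved inverse mass; or u(t, 0) tends to 0. *)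
Lemma sol_uniform_limit : exists2 c, 0 <= c & forall e, 0 < e -> exists2 t0, 0 < t0 &
  forall t h, t0 <= t -> `|u (t, h) - c| <= e.
Proof.
have [[e e0 H]|H] := pselect (exists2 e, 0 < e &
    forall t1, 0 < t1 -> exists2 t, t1 <= t & 5 * e <= u (t, 0)).
  have [t1 t10 flat] := sol_flattens_all e0.
  have [t0 t01 u5] := H t1 t10.
  have t00 := lt_le_trans t10 t01.
  have pos := sol_stays_positive e0 t00 (fun t h tt => flat t h (le_trans t01 tt)) u5.
  have e20 : 0 < 2 * e by lra.
  have J t : t0 <= t -> sol_inv_mass u t0 = sol_inv_mass u t.
    move=> tt; apply: (sol_inv_mass_conserved u_sol E0 t00 tt e20).
    by move=> r h /andP[tr _]; exact: pos.
  have J0 : 0 < sol_inv_mass u t0.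
    have /andP[J0 _] : (u (t0, 0) + e)^-1 <= sol_inv_mass u t0 <= (2 * e)^-1.
      apply: sol_inv_mass_bounds (ltW t00) e20 _ => h; rewrite pos//=.
      by have := flat t0 h t01; rewrite ler_distl => /andP[].
    by apply: lt_le_trans J0; rewrite invr_gt0; lra.
  exists (sol_inv_mass u t0)^-1; first by rewrite invr_ge0 ltW.
  move=> r r0; pose s := Num.min (r / 2) e.
  have s0 : 0 < s by rewrite lt_min e0 divr_gt0.
  have [t2 t20 flat2] := sol_flattens_all s0.
  exists (Num.max t0 t2); first by rewrite lt_max t00.
  move=> t h; rewrite ge_max => /andP[tt0 tt2].
  have ut0 := pos t 0 tt0.
  have se : s <= e by rewrite /s ge_min lexx orbT.
  have sr : s <= r / 2 by rewrite /s ge_min lexx.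
  have a0 : 0 < u (t, 0) - s by lra.
  have b0 : 0 < u (t, 0) + s by lra.
  have t_ge0 : 0 <= t by lra.
  have /andP[J1 J2] : (u (t, 0) + s)^-1 <= sol_inv_mass u t0 <= (u (t, 0) - s)^-1.
    by rewrite (J t tt0); apply: sol_inv_mass_bounds => // x; rewrite -ler_distl flat2.
  have K1 : (sol_inv_mass u t0)^-1 <= u (t, 0) + s.
    by rewrite -[leRHS]invrK lef_pV2 ?posrE ?invr_gt0.
  have K2 : u (t, 0) - s <= (sol_inv_mass u t0)^-1.
    by rewrite -[leLHS]invrK lef_pV2 ?posrE ?invr_gt0.
  have := flat2 t h tt2; rewrite !ler_distl => /andP[? ?].
  by apply/andP; split; lra.
exists 0 => // e e0; pose r := e / 7; have r0 : 0 < r by rewrite divr_gt0.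
have [t1 t10 flat] := sol_flattens_all r0.
have [t2 t20 small] : exists2 t2, 0 < t2 & forall t, t2 <= t -> u (t, 0) < 5 * r.
  apply: contrapT => N; apply: H; exists r => // t2 t20; apply: contrapT => N2.
  apply: N; exists t2 => // t tt; rewrite ltNge; apply/negP => rt; apply: N2.
  by exists t.
exists (Num.max t1 t2) => [|t h]; first by rewrite lt_max t10.
rewrite ge_max => /andP[tt1 tt2]; have := flat t h tt1; have := small t tt2.
have t_ge0 : 0 <= t by rewrite ltW// (lt_le_trans t10).
have := sol_ge0 u_sol h t_ge0; rewrite subr0 ler_distl /r => ? ? /andP[? ?].
by rewrite ger0_norm//; lra.
Qed.

End limit.

(** * Convergence of the norms *)

Lemma ge0_cvge0 (R : realType) (f : R -> \bar R) : (forall t, (0 <= f t)%E) ->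
  (forall e, 0 < e -> exists t0, forall t, t0 <= t -> (f t <= e%:E)%E) ->
  f t @[t --> +oo%R] --> 0%E.
Proof.
move=> f0 fe; have fin t e : (f t <= e%:E)%E -> f t \is a fin_num.
  by move=> h; rewrite ge0_fin_numE// (le_lt_trans h)// ltry.
apply/fine_cvgP; split.
  have [t0 t0f] := fe 1 ltr01; near=> t; apply: (fin _ 1); apply: t0f.
  by near: t; apply: nbhs_pinfty_ge; exact: num_real.
apply/cvgr0Pnorm_le => e e0; have [t0 t0f] := fe e e0.
near=> t; have te : (f t <= e%:E)%E.
  by apply: t0f; near: t; apply: nbhs_pinfty_ge; exact: num_real.
by rewrite /= ger0_norm ?fine_ge0// -lee_fin fineK// (fin _ e).
Unshelve. all: by end_near. Qed.

Lemma Hnorm_ge0 (R : realType) m (f : R -> R) : (0 <= Hnorm m f)%E.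
Proof. by rewrite /Hnorm; case: ifP => _; rewrite ?leey// lee_fin sqrtr_ge0. Qed.

Lemma Lnorm_pinfty_le d (T : measurableType d) (R : realType)
  (m : {measure set T -> \bar R}) (f : T -> R) e : 0 <= e -> (forall x, `|f x| <= e) ->
  (Lnorm m +oo%E (fun x => (f x)%:E) <= e%:E)%E.
Proof.
move=> e0 fe; rewrite unlock; case: ifP => _; last by rewrite lee_fin.
by apply/ess_supP; apply: nearW => x /=; rewrite lee_fin.
Qed.

Lemma cube_close (R : realType) (c r : R) : 0 <= c -> 0 < r -> exists2 d, 0 < d &
  forall x, 0 <= x -> `|x - c| <= d -> `|x ^+ 3 - c ^+ 3| <= r.
Proof.
move=> c0 r0; pose K := 3 * (c + 1) ^+ 2.
have K0 : 0 < K by rewrite mulr_gt0// exprn_gt0//; lra.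
exists (Num.min 1 (r / K)) => [|x x0]; first by rewrite lt_min ltr01 divr_gt0.
rewrite le_min => /andP[x1 xr].
have -> : x ^+ 3 - c ^+ 3 = (x - c) * (x ^+ 2 + x * c + c ^+ 2) by ring.
have xc : x <= c + 1 by move: x1; rewrite ler_norml => /andP[_ ?]; lra.
have s0 : 0 <= x ^+ 2 + x * c + c ^+ 2 by rewrite !addr_ge0 ?sqr_ge0 ?mulr_ge0.
have sK : x ^+ 2 + x * c + c ^+ 2 <= K by rewrite /K; nra.
rewrite normrM (ger0_norm s0); apply: le_trans (ler_wpM2l (normr_ge0 _) sK) _.
by rewrite -ler_pdivlMr.
Qed.

(** The parameters of energyE_Hnorm1 depend on Q and r only, so that one choice
    serves for all late times. *)
Lemma energyE_Hnorm1_small (R : realType) (Q r : R) : 0 <= Q -> 0 < r ->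
  exists2 e, 0 < e & forall (f : R -> R) (c : R), continuous (cube f) ->
    (forall x, f (x + 1) = f x) -> (energyE f <= Q%:E)%E ->
    (forall x, 0 <= x <= 1 -> `|f x ^+ 3 - c| <= e) ->
    (Hnorm 1 (fun x => f x ^+ 3 - c)%R <= r%:E)%E.
Proof.
move=> Q0 r0; pose lam := 24 * Q / r + 1.
have lam0 : 0 < lam by rewrite ltr_wpDl// divr_ge0 ?mulr_ge0// ltW.
have lamQ : 6 * Q / lam <= r / 4.
  rewrite ler_pdivrMr// /lam mulrDr mulr1.
  have -> : r / 4 * (24 * Q / r) = 6 * Q by field; rewrite gt_eqF.
  by rewrite lerDl ltW// divr_gt0.
pose eta := Num.min 3^-1 (r / (8 * lam)).
have eta0 : 0 < eta by rewrite lt_min invr_gt0 ltr0n divr_gt0// mulr_gt0.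
have eta1 : eta <= 3^-1 by rewrite /eta ge_min lexx.
have lame : lam * (2 * eta) <= r / 4.
  have : eta <= r / (8 * lam) by rewrite /eta ge_min lexx orbT.
  by rewrite ler_pdivlMr ?mulr_gt0//; lra.
pose e := Num.min (r / 2) (r * eta / 8).
have e0 : 0 < e by rewrite lt_min !divr_gt0// mulr_gt0.
have er : e <= r / 2 by rewrite /e ge_min lexx.
have ee : 2 * e / eta <= r / 4.
  have : e <= r * eta / 8 by rewrite /e ge_min lexx orbT.
  by rewrite ler_pdivrMr//; lra.
exists e => // f c cf pf fQ fe.
have eta01 : 0 < eta <= 3^-1 by rewrite eta0.
apply: le_trans (energyE_Hnorm1 cf pf fQ lam0 eta01 fe) _.
rewrite lee_fin -(ger0_norm (ltW r0)) -sqrtr_sqr ler_sqrt ?sqr_ge0//.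
set s := 2 * e / eta + _.
have s0 : 0 <= s.
  have := (ltW e0, ltW eta0, ltW lam0) => -[[e0' eta0'] lam0'].
  have h1 : 0 <= 2 * e / eta by apply: divr_ge0 => //; apply: mulr_ge0.
  have h2 : 0 <= lam * (2 * eta) by do !apply: mulr_ge0 => //.
  have h3 : 0 <= 6 * Q / lam by apply: divr_ge0 => //; apply: mulr_ge0.
  by rewrite /s; lra.
have sr : s <= r / 2 by rewrite /s; lra.
have e2 : e ^+ 2 <= (r / 2) ^+ 2 by rewrite lerXn2r ?nnegrE// ?(ltW e0) ?divr_ge0 ?(ltW r0).
have s2 : s ^+ 2 <= (r / 2) ^+ 2 by rewrite lerXn2r ?nnegrE// ?divr_ge0 ?(ltW r0).
apply: le_trans (lerD e2 s2) _.
have -> : (r / 2) ^+ 2 + (r / 2) ^+ 2 = r ^+ 2 / 2 by field.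
by rewrite ler_pdivrMr// ler_peMr ?sqr_ge0// ler1n.
Qed.

(* The inverse in the hypothesis on 1 / u0 is that of \bar R, where 0^-1 = +oo. *)
Theorem theorem3p1 (R : realType) (u0 : R -> R) (m0 : R) (u : R * R -> R)
  (u0_ge0 : forall h, 0 <= u0 h)
  (u0_periodic : forall h, u0 (h + 1) = u0 h)
  (u0_H2 : Hper 2 (cube u0))
  (u0_inv : (\int[lebesgue_measure]_(h in `[0%R, 1%R]) ((u0 h)%:E)^-1 = m0%:E)%E)
  (u_sol : forall T : R, 0 < T -> weak_solution T u0 u)
  (u_gt0 : forall T : R, 0 < T ->
    {ae (lebesgue_measure \x lebesgue_measure)%E,
      forall p, (`[0, T] `*` `[0, 1]) p -> 0 < u p}) :
  exists ustar : R,
    Hnorm 1 (fun h => u (t, h) ^+ 3 - ustar ^+ 3) @[t --> +oo%R] --> 0%E /\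
    Lnorm (mrestr lebesgue_measure (measurable_itv `[0%R, 1%R])) +oo%E
      (fun h => (u (t, h) - ustar)%:E) @[t --> +oo%R] --> 0%E.
Proof.
have [Q Q0 E0] : exists2 Q, 0 <= Q & energyE (slice u 0) = Q%:E.
  have [ut [w ws]] := u_sol 1 ltr01.
  apply: (energyE_fin (u0 := u0)) => //; first exact: (sol_cube_continuous u_sol).
    by move=> h; exact: (sol_periodic u_sol).
  exact: (ws_init ws).
have [c c0 H] := sol_uniform_limit u_sol E0; exists c; split; apply: ge0_cvge0.
- by move=> t; exact: Hnorm_ge0.
- move=> r r0; have [e e0 small] := energyE_Hnorm1_small Q0 r0.
  have [d d0 close] := cube_close c0 e0; have [t0 t00 lim_] := H d d0.
  exists t0 => t tt; have t_ge0 : 0 <= t by rewrite ltW// (lt_le_trans t00).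
  apply: (small (slice u t)).
  + exact: (sol_cube_continuous u_sol).
  + by move=> h; exact: (sol_periodic u_sol).
  + exact: (sol_energyE u_sol).
  + by move=> h _; apply: close; [exact: (sol_ge0 u_sol)|exact: lim_].
- by move=> t; exact: Lnorm_ge0.
- move=> r r0; have [t0 _ lim_] := H r r0; exists t0 => t tt.
  by apply: Lnorm_pinfty_le => [|h]; [exact: ltW|exact: lim_].
Qed.
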